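(* Let $-2<s\le-1$ and $\beta>0$, and let $\mathsf{P}_{s,\beta}$ be a one-dimensional Riesz gas with parameters $s,\beta$, i.e. any accumulation point, for the local topology, of the sequence $\{\mathsf{P}_n^{s,\beta,\mathrm{stat}}\}_n$ of stationarized finite-volume Riesz gases. Then $\mathsf{P}_{s,\beta}$ is an $L^2$-perturbed lattice: $$\mathsf{Wass}_2(\mathsf{P}_{s,\beta},\mathsf{P}^{\mathbb{Z}})<+\infty,$$ where $\mathsf{P}^{\mathbb{Z}}$ is the law of $\sum_{j\in\mathbb{Z}}\delta_{j+U}$ with $U$ uniform on $[0,1]$. In particular, $\mathsf{P}_{s,\beta}$ is Hyperuniform of type I, meaning that $\{\mathrm{Var}_{\mathsf{P}_{s,\beta}}(N_I)\}_{I}$ is bounded as $I$ ranges over (bounded) intervals of $\mathbb{R}$, where $N_I(\xi)=\xi(I)$. Moreover, $\mathsf{P}_{s,\beta}$ is Number-Rigid and has a Cyclic-Factor.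
   Context: A configuration is a locally finite integer-valued measure $\xi=\sum_j\delta_{x_j}$ on $\mathbb{R}$ (multiple points allowed); $\Gamma$ is the space of configurations, with the $\sigma$-algebra generated by the maps $\xi\mapsto\xi(A)$, $A$ Borel. A point process is a $\Gamma$-valued random variable, or its law. Translations act by $\theta_x\sum_j\delta_{x_j}=\sum_j\delta_{x_j+x}$; a law $\mathsf{P}$ is stationary ($\mathbb{R}$-stationary) if $\mathsf{P}\circ\theta_x^{-1}=\mathsf{P}$ for all $x\in\mathbb{R}$, and $\mathbb{Z}$-stationary if this holds for all $x\in\mathbb{Z}$. Finite-volume Riesz gas: let $\square_n=[-\frac n2,\frac n2]$ and $g_s(x-y)=-|x-y|^{-s}$. For a configuration $\gamma$ of $n$ points in $\square_n$, $$H_n^{(s)}(\gamma)=\frac12\iint_{\square_n\times\square_n}g_s(x-y)\,\nu(dx)\,\nu(dy),\qquad \nu=\gamma-\mathsf{Leb}_{\square_n},$$ and $$\mathsf{P}_n^{s,\beta}(d\gamma)=\frac{1}{Z_n^{(s,\beta)}}e^{-\beta H_n^{(s)}(\gamma)}\,\mathsf{Bin}_{n,\square_n}(d\gamma),\qquad Z_n^{(s,\beta)}=\int e^{-\beta H_n^{(s)}(\gamma)}\,\mathsf{Bin}_{n,\square_n}(d\gamma),$$ where $\mathsf{Bin}_{n,\square_n}$ is the law of $\sum_{j=1}^n\delta_{X_j}$ with $X_1,\dots,X_n$ i.i.d. uniform on $\square_n$. Stationarized version: given a point process law $\mathsf{P}_\square$ in a bounded interval $\square$ of length $m$, tile $\mathbb{R}=\bigcup_{k\in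 m\mathbb{Z}}\theta_k\square$, let $\{\xi_k\}_{k\in m\mathbb{Z}}$ be independent with $\xi_k$ distributed as the translate by $k$ of $\mathsf{P}_\square$, and let $U$ be uniform in $\square$, independent of the $\xi_k$. Then $\mathsf{P}_\square^{\mathrm{stat}}$ is the law of $\sum_{k\in m\mathbb{Z}}\theta_U\xi_k$. $\mathsf{P}_n^{s,\beta,\mathrm{stat}}$ is the stationarized version of $\mathsf{P}_n^{s,\beta}$ with $\square=\square_n$. Local topology: $\mathsf{P}_n\to\mathsf{P}$ locally iff $\mathbb{E}_{\mathsf{P}_n}[F(\xi)]\to\mathbb{E}_{\mathsf{P}}[F(\xi)]$ for every measurable, local, tame functional $F$ on $\Gamma$. $F$ is local if there is a bounded box $\square$ such that $F(\xi)$ depends only on the restriction $\xi_\square$ of $\xi$ to $\square$; it is tame if moreover $|F(\xi)|\le C(1+\xi(\square))$ for some $C>0$. An accumulation point is a limit along a subsequence. Transport distance: for $p\ge 1$ and stationary laws $\mathsf{P},\mathsf{R}$, $$\mathsf{Wass}_p^p(\mathsf{P},\mathsf{R})=\inf_{(\xi,\eta)}\mathbb{E}\Big[\inf_q\limsup_{n\to\infty}\frac{1}{|\square_n|}\int_{\square_n\times\mathbb{R}}|x-y|^p\,dq(x,y)\Big],$$ where the first infimum is over couplings $(\xi,\eta)$ with $\xi\sim\mathsf{P}$, $\eta\sim\mathsf{R}$, and the second is, for each realization, over couplings $q$ of the measures $\xi$ and $\eta$ (measures on $\mathbb{R}\times\mathbb{R}$ with marginals $\xi$ and $\eta$). Number-Rigid: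 for every bounded Borel set $A\subset\mathbb{R}$, with $\xi\sim\mathsf{P}$, $\xi(A)$ is almost surely equal to a measurable function of the restriction $\xi(A^c\cap\cdot)$. Cyclic-Factor: a stationary law $\mathsf{P}$ of unit intensity has a Cyclic-Factor if $\mathsf{P}=\int_0^1 \mathsf{P}_0\circ\theta_u^{-1}\,du$ for some law $\mathsf{P}_0$ on $\Gamma$ that is $\mathbb{Z}$-stationary but not $\mathbb{R}$-stationary, and such that the supports of the phases $\{\mathsf{P}_0\circ\theta_u^{-1}\}_{u\in[0,1)}$ are mutually disjoint, i.e. there are pairwise disjoint measurable sets $\Gamma_u\subset\Gamma$, $u\in[0,1)$, with $(\mathsf{P}_0\circ\theta_u^{-1})(\Gamma_u)=1$. *)

(* Defs.v *)
From HB Require Import structures.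
From mathcomp Require Import all_boot all_order all_algebra.
From mathcomp Require Import all_classical all_reals all_analysis measurable_realfun.

Set Implicit Arguments.
Unset Strict Implicit.
Unset Printing Implicit Defensive.

Import Order.TTheory GRing.Theory Num.Theory.
Import numFieldNormedType.Exports.

Local Open Scope classical_set_scope.
Local Open Scope ring_scope.
Local Open Scope ereal_scope.

Definition locally_finite_integer (R : realType) (xi : set R -> \bar R) :=
  forall A : set R, measurable A -> bounded_set A ->
    exists n : nat, xi A = n%:R%:E.

(* Measures of MathComp-Analysis are total functions on [set R], whose values
   on non-Borel sets are irrelevant here: every notion below only looks at the
   values of a configuration on Borel sets. *)
Record config (R : realType) := Config {
  config_measure :> {measure set R -> \bar R} ;
  configP : locally_finite_integer config_measure }.

Section config_measurable.
Variable R : realType.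

Lemma locally_finite_integer0 :
  locally_finite_integer (mzero : {measure set R -> \bar R}).
Proof. by move=> A _ _; exists 0%N. Qed.

HB.instance Definition _ := gen_eqMixin (config R).
HB.instance Definition _ := gen_choiceMixin (config R).
HB.instance Definition _ :=
  isPointed.Build (config R) (Config locally_finite_integer0).

Definition config_ev (A : set R) (xi : config R) : \bar R := xi A.

Definition config_evs : set (set (config R)) :=
  \bigcup_(A in measurable)
    preimage_set_system [set: config R] (config_ev A) measurable.

Definition config_display : measure_display.
Proof. by constructor. Qed.

HB.instance Definition _ :=
  @isMeasurable.Build config_display (config R) <<s config_evs >>
    (@sigma_algebra0 _ setT config_evs)
    (@sigma_algebraC _ config_evs)
    (@sigma_algebra_bigcup _ setT config_evs).

Lemma measurable_config_ev (A : set R) : measurable A ->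
  measurable_fun [set: config R] (config_ev A).
Proof.
move=> mA _ B mB; apply: sub_sigma_algebra.
by exists A => //; exists B.
Qed.

Lemma measurable_config d (T : measurableType d) (f : T -> config R) :
  (forall A, measurable A -> measurable_fun setT (fun t => f t A)) ->
  measurable_fun setT f.
Proof.
move=> mf; apply: (@measurability _ _ _ _ setT f config_evs) => //.
move=> _ [_ [A mA [B mB <-]] <-].
rewrite !setTI -[X in measurable X]setTI; exact: mf.
Qed.

End config_measurable.

Section config_operations.
Variable R : realType.
Implicit Types (xi : config R) (A D : set R) (u : R).

Lemma bounded_set_shift A u : bounded_set A ->
  bounded_set ((fun y : R => y + u)%R @^-1` A).
Proof.
move=> /pinfty_ex_gt0[M M0 AM]; exists (M + `|u|)%R; split.
  by rewrite num_real.
move=> N MN x /= /AM xuM; apply: le_trans (ltW MN).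
by rewrite -(addrK u x) (le_trans (ler_normB _ _))// lerD2r.
Qed.

Lemma measurable_shift u : measurable_fun setT (fun y : R => y + u)%R.
Proof. exact: measurable_funD. Qed.

Definition translate_measure u xi : set R -> \bar R :=
  pushforward xi (fun y : R => y + u)%R.

Section translate_measure.
Variables (u : R) (xi : config R).
Local Notation mu := (translate_measure u xi).
Local Notation pushforward_measure :=
  (measure_function_pushforward__canonical__measure_function_Measure
    xi (measurable_shift u)).

Let mu0 : mu set0 = 0. Proof. exact: (measure0 pushforward_measure). Qed.

Let mu_ge0 A : 0 <= mu A. Proof. exact: (measure_ge0 pushforward_measure). Qed.

Let mu_sigma_additive : semi_sigma_additive mu.
Proof. exact: (@measure_semi_sigma_additive _ _ _ pushforward_measure). Qed.

HB.instance Definition _ := isMeasure.Build _ _ _ mu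
  mu0 mu_ge0 mu_sigma_additive.

Lemma translate_lfi : locally_finite_integer mu.
Proof.
move=> A mA bA; apply: (@configP R xi).
  by rewrite -[X in measurable X]setTI; exact: measurable_shift.
exact: bounded_set_shift.
Qed.

Definition translate : config R := Config translate_lfi.

End translate_measure.

Lemma restrict_lfi xi D (mD : measurable D) :
  locally_finite_integer (mrestr xi mD).
Proof.
move=> A mA bA; apply: (@configP R xi); first exact: measurableI.
move: bA => /pinfty_ex_gt0[M M0 AM]; exists M; split.
  by rewrite num_real.
by move=> N MN x [/AM xM _]; exact: le_trans xM (ltW MN).
Qed.

Definition restrict_config D (mD : measurable D) xi : config R :=
  @Config R [the {measure set R -> \bar R} of mrestr xi mD]
    (@restrict_lfi xi D mD).

Definition lattice_measure u : {measure set R -> \bar R} :=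
  measure_add
    (mseries (fun n => \d_((Posz n)%:~R + u)%R : {measure set R -> \bar R}) 0)
    (mseries (fun n => \d_((Negz n)%:~R + u)%R : {measure set R -> \bar R}) 0).

Let dirac_series_nat (x : nat -> R) A :
  (exists N, forall n, (N <= n)%N -> ~ A (x n)) ->
  exists n : nat, \sum_(0 <= k <oo) \d_(x k) A = n%:R%:E :> \bar R.
Proof.
move=> [N xN]; exists (\sum_(0 <= k < N) (x k \in A))%N.
rewrite (nneseries_split 0 N)// add0n [X in _ + X]eseries0; last first.
  by move=> n Nn _; rewrite diracE memNset//; exact: xN.
by rewrite adde0 natr_sum -sumEFin; apply: eq_bigr => k _; rewrite diracE.
Qed.

Lemma lattice_lfi u : locally_finite_integer (lattice_measure u).
Proof.
move=> A mA /pinfty_ex_gt0[M M0 AM].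
have [N MN] : exists N, forall n, (N <= n)%N -> (M + `|u| < n%:R)%R.
  exists (Num.truncn (M + `|u|)).+1 => n Nn.
  by rewrite (lt_le_trans (truncnS_gt _))// ler_nat.
have aux (z : int) : (M + `|u| < `|z%:~R : R|)%R -> ~ A (z%:~R + u)%R.
  move=> zM /AM; apply/negP; rewrite -ltNge.
  rewrite -ltrBrDr in zM; apply: (lt_le_trans zM).
  exact: lerB_normD.
have [p pE] : exists n : nat,
    \sum_(0 <= k <oo) \d_((Posz k)%:~R + u)%R A = n%:R%:E :> \bar R.
  apply: dirac_series_nat; exists N => n Nn; apply: aux.
  by rewrite -intr_norm; exact: MN.
have [q qE] : exists n : nat,
    \sum_(0 <= k <oo) \d_((Negz k)%:~R + u)%R A = n%:R%:E :> \bar R.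
  apply: dirac_series_nat; exists N => n Nn; apply: aux.
  by rewrite -intr_norm; exact/MN/leqW.
by exists (p + q)%N; rewrite natrD EFinD -pE -qE; exact: measure_addE.
Qed.

(* [measurableTypeR R] is [R] with the same Borel sets, under the display used
   by [lebesgue_measure] and [uniform_prob]. *)
Definition lattice (u : measurableTypeR R) : config R :=
  Config (lattice_lfi u).

Lemma measurable_lattice : measurable_fun setT lattice.
Proof.
apply: measurable_config => A mA.
rewrite (_ : (fun _ => _) = (fun u =>
    \sum_(0 <= k <oo) \d_((Posz k)%:~R + u)%R A +
    \sum_(0 <= k <oo) \d_((Negz k)%:~R + u)%R A)); last first.
  by apply/funext => u; exact: measure_addE.
have aux (z : nat -> int) :
    measurable_fun setT (fun u : R => \sum_(0 <= k <oo) \d_((z k)%:~R + u)%R A).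
  apply: ge0_emeasurable_sum => // k _; apply/measurable_EFinP.
  rewrite (_ : (fun _ => _) = \1_A \o (fun u => (z k)%:~R + u)%R)//.
  apply: measurableT_comp; first exact: measurable_indic.
  exact: measurable_funD.
by apply: emeasurable_funD; exact: aux.
Qed.

HB.instance Definition _ := isMeasurableFun.Build _ _ _ _ lattice
  measurable_lattice.

End config_operations.

(* Two laws are compared on measurable events only. *)
Definition same_law d (T : measurableType d) (R : realType)
    (P Q : set T -> \bar R) :=
  forall A, measurable A -> P A = Q A.

(* [independent F]: the families of events [F i], [i : I], are mutually
   independent; with [F i] the sigma-algebra generated by a random element this
   is the mutual independence of these random elements, which may take values
   in different spaces. *)
Definition independent d (T : measurableType d) (R : realType)
    (mu : probability T R) (I : choiceType) (F : I -> set (set T)) :=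
  forall (J : seq I) (E : I -> set T), uniq J ->
    (forall i, i \in J -> F i (E i)) ->
    mu (\bigcap_(i in [set` J]) E i) = \prod_(i <- J) mu (E i).

Section point_processes.
Variable R : realType.
Implicit Types P Q : probability (config R) R.

Definition translate_law (x : R) P : set (config R) -> \bar R :=
  pushforward P (translate x).

Definition stationary P := forall x : R, same_law (translate_law x P) P.

Definition Z_stationary P :=
  forall z : int, same_law (translate_law z%:~R P) P.

Definition unit_intensity P := forall A : set R, measurable A ->
  \int[P]_xi xi A = lebesgue_measure A.

Definition number_in (A : set R) (xi : config R) : R := fine (xi A).

Definition lattice_law : probability (config R) R :=
  distribution (uniform_prob (@ltr01 R)) (@lattice R).

Definition box (n : nat) : set R := `[(- (n%:R / 2))%R, (n%:R / 2)%R]%classic.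

Lemma box_lt (n : nat) : (0 < n)%N -> (- (n%:R / 2) < n%:R / 2 :> R)%R.
Proof. by move=> n0; rewrite gtrN// divr_gt0// ltr0n. Qed.

(* [P] is the law of [\sum_(i < n) \d_(X i)] with i.i.d. uniform [X i]; like the
   stationarized laws below, it is characterized through a realization on some
   probability space, since the library has no products of arbitrary families
   of probabilities. *)
Definition is_binomial_law (n : nat) (a b : R) (ab : (a < b)%R) P :=
  exists d (Omega : measurableType d) (mu : probability Omega R)
      (X : 'I_n -> {mfun Omega >-> R}) (xi : {mfun Omega >-> config R}),
    [/\ independent mu (fun i => g_sigma_algebra_preimage (X i)),
        forall i, same_law (distribution mu (X i)) (uniform_prob ab),
        forall w A, measurable A -> xi w A = \sum_(i < n) \d_(X i w) A &
        same_law (distribution mu xi) P].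

Definition riesz_kernel (s t : R) : R := (- (`|t| `^ (- s)))%R.

(* Integration over [box n] against the signed measure [xi - Leb]. *)
Definition centered_integral (n : nat) (xi : config R) (f : R -> R) : R :=
  (\int[xi]_(x in box n) f x - \int[lebesgue_measure]_(x in box n) f x)%R.

Definition riesz_energy (n : nat) (s : R) (xi : config R) : R :=
  (2^-1 * centered_integral n xi (fun y =>
     centered_integral n xi (fun x => riesz_kernel s (x - y))))%R.

Definition boltzmann (n : nat) (s beta : R) (xi : config R) : \bar R :=
  (expR (- (beta * riesz_energy n s xi)))%:E.

Definition is_finite_riesz_law (n : nat) (n0 : (0 < n)%N) (s beta : R) P :=
  exists Bin : probability (config R) R,
    is_binomial_law n (box_lt n0) Bin /\
    forall A, measurable A ->
      P A = (\int[Bin]_(xi in A) boltzmann n s beta xi) /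
            (\int[Bin]_xi boltzmann n s beta xi).

(* [P] is the stationarized version of the law [Q] of a point process in
   [[a, b]]; the tile of index [k : int] is the translate of [[a, b]] by
   [k * (b - a)]. *)
Definition is_stationarized (a b : R) (ab : (a < b)%R) Q P :=
  exists d (Omega : measurableType d) (mu : probability Omega R)
      (U : {mfun Omega >-> R}) (xi : int -> {mfun Omega >-> config R})
      (zeta : {mfun Omega >-> config R}),
    [/\ independent mu (fun o : option int =>
          if o is Some k then g_sigma_algebra_preimage (xi k)
          else g_sigma_algebra_preimage U),
        same_law (distribution mu U) (uniform_prob ab),
        forall k, same_law (distribution mu (xi k))
                           (translate_law (k%:~R * (b - a)) Q),
        {ae mu, forall w, forall A, measurable A ->
           zeta w A = \esum_(k in [set: int]) translate (U w) (xi k w) A} &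
        same_law (distribution mu zeta) P].

Definition is_stationarized_riesz_law (n : nat) (n0 : (0 < n)%N) (s beta : R)
    P :=
  exists Q, is_finite_riesz_law n0 s beta Q /\
            is_stationarized (box_lt n0) Q P.

Definition local_tame (F : config R -> R) := exists a b : R,
  (forall xi eta : config R,
     (forall A, measurable A -> A `<=` `[a, b]%classic -> xi A = eta A) ->
     F xi = F eta) /\
  (exists2 C : R, (0 < C)%R &
     forall xi, (`|F xi| <= C * (1 + number_in `[a, b]%classic xi))%R).

Definition local_cvg (P_ : nat -> probability (config R) R) P :=
  forall F : config R -> R, measurable_fun setT F -> local_tame F ->
    'E_(P_ k)[F] @[k --> \oo] --> 'E_P[F].

(* The finite-volume laws are only defined for [n > 0]; the value of the
   sequence at [n = 0] is irrelevant. *)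
Definition is_riesz_gas (s beta : R) P :=
  exists P_ : nat -> probability (config R) R,
    (forall (n : nat) (n0 : (0 < n)%N),
       is_stationarized_riesz_law n0 s beta (P_ n)) /\
    exists2 phi : nat -> nat, {homo phi : m n / (m < n)%N} &
      local_cvg (P_ \o phi) P.

Definition config_coupling (xi eta : config R)
    (q : {measure set (R * R) -> \bar R}) :=
  (forall A, measurable A -> q (A `*` setT) = xi A) /\
  (forall B, measurable B -> q (setT `*` B) = eta B).

(* An infimum over the empty set is [+oo]. *)
Definition transport_cost (p : R) (xi eta : config R) : \bar R :=
  ereal_inf [set limn_esup (fun n : nat => (n%:R^-1)%:E *
      \int[q]_(z in box n `*` setT) (`|z.1 - z.2| `^ p)%:E)
    | q in config_coupling xi eta].

(* A coupling of two point processes is encoded by its joint law. *)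
Definition law_coupling P Q
    (J : probability (config R * config R)%type R) :=
  (forall A, measurable A -> J (A `*` setT) = P A) /\
  (forall B, measurable B -> J (setT `*` B) = Q B).

(* [transport_cost] is universally measurable rather than Borel measurable; the
   integral, which for nonnegative functions is the supremum of the integrals
   of the smaller measurable simple functions, is then its integral with
   respect to the completion of [J]. *)
Definition wass_pow (p : R) P Q : \bar R :=
  ereal_inf [set \int[J]_z transport_cost p z.1 z.2 | J in law_coupling P Q].

Definition wass (p : R) P Q : \bar R := wass_pow p P Q `^ p^-1.

Definition hyperuniform_I P := exists M : R,
  forall I : set R, is_interval I -> bounded_set I ->
    variance P (number_in I) <= M%:E.

Definition number_rigid P :=
  forall (A : set R) (mA : measurable A), bounded_set A ->
    exists2 f : config R -> \bar R, measurable_fun setT f &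
      {ae P, forall xi : config R, xi A = f (restrict_config (measurableC mA) xi)}.

Definition has_cyclic_factor P :=
  [/\ stationary P, unit_intensity P &
    exists P0 : probability (config R) R,
    [/\ forall A, measurable A ->
          P A = \int[lebesgue_measure]_(u in `[0%R, 1%R]) translate_law u P0 A,
        Z_stationary P0, ~ stationary P0 &
        exists G : R -> set (config R),
          [/\ forall u, u \in `[0%R, 1%R[ -> measurable (G u),
              forall u, u \in `[0%R, 1%R[ -> translate_law u P0 (G u) = 1 &
              trivIset `[0%R, 1%R[ G]]].

End point_processes.

(* Main.v *)
Require Import Defs.
From HB Require Import structures.
From mathcomp Require Import all_boot all_order all_algebra perm.
From mathcomp Require Import all_classical all_reals all_analysis measurable_realfun.
From mathcomp Require Import ring lra.

Set Implicit Arguments.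
Unset Strict Implicit.
Unset Printing Implicit Defensive.

Import Order.TTheory GRing.Theory Num.Theory.
Import numFieldNormedType.Exports.

Local Open Scope classical_set_scope.
Local Open Scope ring_scope.

(** Let D(x) be the number of points of the configuration between 0 and x, minus
    x.  Everything follows from two properties of a Riesz gas P: it is
    stationary, and the second moment of D(x) is bounded uniformly in x
    ([riesz_gas_stationary_variance]).

    These come from the finite gas.  For a = - s between 1 and 2, the kernel
    |x - y|^a is proportional to the integral of the squares
    (Phi_t(x) - Phi_t(y))^2, where the functions Phi_t are the indicators of all
    rays if a = 1, and ramps of all widths and positions if a > 1.  As the
    system is neutral, its energy is then proportional to the integral of the
    squares of the fluctuations of the linear statistics Phi_t ([neutral_energy_square]).  A
    narrow ramp is close to the indicator of a ray, so the energy controls the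
    integral of D^2 over the box, up to a multiple of the number n of points
    ([discr_le_energy]).  On the other hand, Jensen's inequality on the event
    that each unit cell contains one point bounds the partition function from
    below exponentially in n ([partition_function_ge]).  Together these show
    that the integral of D^2 over the box has expectation at most C n
    ([finite_riesz_discr]).  The stationarization samples a uniform position of
    the box, so windows of a fixed length have bounded variance, and so has the
    limit.

    In particular P is hyperuniform of type I.  For the other claims, consider
    the averages of finitely many values of D with dyadic weights.  The radius
    of an average is its largest mean-square distance to the values D(x).  By
    the parallelogram identity any sequence of averages whose radii tend to the
    infimum is Cauchy in mean square ([average_discr_close]); its limit is
    called the phase.  Translating the averages does not change their radii, by
    stationarity, so the phase can be read off averages located anywhere, and
    the translation of a configuration changes its phase by the value of D at
    the new origin ([phase_translate]).

    Number rigidity: reading the phase once from far to the left and once from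
    far to the right of a window, and comparing, reveals the number of points in
    the window ([window_count]).

    Cyclic factor: as D(x) + x is an integer, the fractional part of minus the
    phase is rotated by translations.  Undoing this rotation gives a law that is
    invariant under integer translations and lives on configurations of angle
    0, and P is the mixture of its rotations ([unwound_mean]).

    Transport: match the points of the configuration, in increasing order, with
    those of the lattice that has the same phase Y.  The cost in a box is
    bounded, up to a constant factor, by the sum of (1 + |D(m) - Y|)^2 over the
    integers m of the box
    ([match_plan_cost]).  Now D(m) - Y is minus the phase of a translate, so
    these terms form a stationary sequence with finite mean, and the integral
    of the superior limit of their averages is at most that mean
    ([ergodic_inequality]). *)

(** * Configurations *)

Section config_theory.
Variable R : realType.
Implicit Types (xi eta : config R) (u a b c : R).

Lemma bounded_itv (i : interval R) a b : [set` i] `<=` `[a, b]%classic ->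
  bounded_set [set` i].
Proof.
move=> iab; exists (`|a| + `|b|)%R; split; first exact: num_real.
move=> M abM x /iab /=; rewrite in_itv/= => /andP[ax xb].
apply: le_trans (ltW abM); rewrite ler_norml; apply/andP; split.
  have := normr_ge0 b; have := ler_norm (- a); rewrite normrN; lra.
by have := normr_ge0 a; have := ler_norm b; lra.
Qed.

Lemma bounded_oc a b : bounded_set `]a, b]%classic.
Proof. by apply: (@bounded_itv _ a b); exact: subset_itv_oc_cc. Qed.

Lemma config_fin xi (A : set R) : measurable A -> bounded_set A ->
  xi A \is a fin_num.
Proof. by move=> mA bA; have [n ->] := configP xi mA bA. Qed.

Lemma config_ext xi eta : (forall A, xi A = eta A) -> xi = eta.
Proof.
case: xi eta => [m mP] [m' m'P] /= mm'.
have E : m = m' by apply: eq_measure; apply/funext.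
by subst m'; congr Config; exact: Prop_irrelevance.
Qed.

Import HBNNSimple.

(** A locally finite random measure integrates jointly measurable functions
    measurably: a monotone class argument inside each bounded window, followed
    by exhaustion. *)
Lemma measurable_config_xsection d (X : measurableType d) (xi : X -> config R)
    (E : set (X * R)) : measurable_fun setT xi -> measurable E ->
  measurable_fun setT (fun t => xi t (xsection E t)).
Proof.
move=> mxi mE.
pose D (k : nat) := `](- k%:R)%R, k%:R]%classic : set R.
have mD k : measurable (D k) by rewrite /D; exact: measurable_itv.
have mxiA A : measurable A -> measurable_fun setT (fun x => xi x A).
  move=> mA; exact: (measurableT_comp (measurable_config_ev mA) mxi).
have aux k : measurable_fun setT (fun x => xi x (xsection E x `&` D k)).
  pose phi (A : set (X * R)) x := mrestr (xi x) (mD k) (xsection A x).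
  pose XY := [set A : set (X * R) | measurable A /\
                measurable_fun [set: X] (phi A)].
  suff : measurable `<=` XY by move=> /(_ E mE)[].
  rewrite measurable_prod_measurableType.
  set C := [set A `*` B | A in measurable & B in measurable].
  have CI : setI_closed C.
    move=> _ _ [X1 mX1 [X2 mX2 <-]] [Y1 mY1 [Y2 mY2 <-]].
    exists (X1 `&` Y1); first exact: measurableI.
    by exists (X2 `&` Y2); [exact: measurableI|rewrite setXI].
  have CT : C setT by exists setT => //; exists setT => //; rewrite setXTT.
  have CXY : C `<=` XY.
    move=> _ [A mA [B mB <-]]; split; first exact: measurableX.
    rewrite (_ : phi _ = fun x => mrestr (xi x) (mD k) B * (\1_A x)%:E)%E.
      apply: emeasurable_funM => //; first exact/mxiA/measurableI.
      by apply/measurable_EFinP; rewrite (_ : \1_ _ = mindic R mA).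
    apply/funext => x; rewrite /phi/= indicE.
    have [xA|xA] := boolP (x \in A); first by rewrite mule1 in_xsectionX.
    by rewrite mule0 notin_xsectionX// measure0.
  apply: lambda_system_subset => //.
  split => //; [exact: CXY| |].
  - move=> A B BA [mA mphiA] [mB mphiB]; split; first exact: measurableD.
    rewrite (_ : phi _ = (fun x => phi A x - phi B x)%E).
      exact: emeasurable_funB.
    apply/funext => x; rewrite /phi/= xsectionD// measureD.
    + by rewrite setIidr//; exact: le_xsection.
    + exact: measurable_xsection.
    + exact: measurable_xsection.
    + rewrite -ge0_fin_numE//; apply: config_fin.
        by apply: measurableI => //; exact: measurable_xsection.
      apply: (@sub_boundedr _ _ _ _ (globally (D k))); last first.
        exact: bounded_oc.
      by move=> P; rewrite /globally/= => PD y [_ /PD].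
  - move=> F ndF FXY; split.
      by apply: bigcupT_measurable => n; have [] := FXY n.
    apply: (@emeasurable_fun_cvg _ _ _ _ (fun n => phi (F n))) => //.
      by move=> n; have [] := FXY n.
    move=> x _; rewrite /phi xsection_bigcup.
    apply: nondecreasing_cvg_mu.
    + by move=> n; apply: measurable_xsection; case: (FXY n).
    + by apply: bigcupT_measurable => n; apply: measurable_xsection;
        case: (FXY n).
    + by move=> m n mn; apply/subsetPset; apply: le_xsection; exact/subsetPset/ndF.
apply: (@emeasurable_fun_cvg _ _ _ _
  (fun k x => xi x (xsection E x `&` D k))) => // x _.
rewrite [X in _ --> _ X](_ : _ = \bigcup_k (xsection E x `&` D k)); last first.
  by rewrite -setI_bigcupr bigcup_itvT setIT.
apply: nondecreasing_cvg_mu.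
- by move=> k; apply: measurableI => //; exact: measurable_xsection.
- by apply: bigcupT_measurable => k; apply: measurableI => //;
    exact: measurable_xsection.
- move=> m n mn; apply/subsetPset; apply: setIS => y; rewrite /D/= !in_itv/=.
  move=> /andP[my ym]; rewrite (le_trans ym) ?ler_nat// andbT.
  by apply: le_lt_trans my; rewrite lerN2 ler_nat.
Qed.

Lemma measurable_config_integral d (X : measurableType d) (xi : X -> config R)
    (f : X * R -> \bar R) : measurable_fun setT xi -> measurable_fun setT f ->
  (forall z, 0 <= f z)%E ->
  measurable_fun setT (fun t => \int[xi t]_y f (t, y))%E.
Proof.
move=> mxi mf f0.
apply: (measurable_fun_xsection_integral f xi (nnsfun_approx measurableT mf)).
- by move=> a b ab; exact/nd_nnsfun_approx.
- by move=> z; exact/cvg_nnsfun_approx.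
- move=> n r; exact: measurable_config_xsection.
Qed.

Lemma measurable_translate2 d (X : measurableType d) (u : X -> R)
    (xi : X -> config R) : measurable_fun setT u -> measurable_fun setT xi ->
  measurable_fun setT (fun t => translate (u t) (xi t)).
Proof.
move=> mu mxi; apply: measurable_config => A mA.
pose E := [set z : X * R | A (z.2 + u z.1)].
have mE : measurable E.
  rewrite -[E]setTI.
  have mf : measurable_fun setT (fun z : X * R => z.2 + u z.1).
    apply: measurable_funD => //; exact: measurableT_comp.
  exact: mf.
have := measurable_config_xsection mxi mE.
apply: eq_measurable_fun => t _ /=; rewrite /translate_measure /pushforward.
by congr (xi t _); apply/seteqP; split => y; rewrite /xsection/= inE.
Qed.

Lemma measurable_translate u : measurable_fun setT (@translate R u).
Proof. by apply: measurable_translate2. Qed.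

Lemma translate0 xi : translate 0 xi = xi.
Proof.
apply: config_ext => A; rewrite /= /translate_measure /pushforward.
by congr (xi _); apply/seteqP; split => y /=; rewrite addr0.
Qed.

Lemma translateD u v xi : translate u (translate v xi) = translate (v + u) xi.
Proof.
apply: config_ext => A; rewrite /= /translate_measure /pushforward.
by congr (xi _); apply/seteqP; split => y /=; rewrite addrA.
Qed.

Lemma translate_oc u xi a b :
  translate u xi `]a, b]%classic = xi `](a - u), (b - u)]%classic.
Proof.
rewrite /= /translate_measure /pushforward; congr (xi _).
by apply/seteqP; split => y /=; rewrite !in_itv/= ltrBlDr lerBrDr.
Qed.

Definition cnt xi a b : R := fine (xi `]a, b]%classic).
(** The sign convention makes increments of [counting] count points on the
    whole line, see [cnt_counting]. *)
Definition counting xi x : R := cnt xi 0 x - cnt xi x 0.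

Lemma cntE xi a b : xi `]a, b]%classic = (cnt xi a b)%:E.
Proof. by rewrite /cnt fineK//; apply: config_fin => //; exact: bounded_oc. Qed.

Lemma cnt_nat xi a b : exists n : nat, cnt xi a b = n%:R.
Proof.
have [|n nE] := @configP _ xi `]a, b]%classic _ (@bounded_oc a b) => //.
by exists n; rewrite /cnt nE.
Qed.

Lemma cnt_ge0 xi a b : 0 <= cnt xi a b.
Proof. by rewrite /cnt fine_ge0. Qed.

Lemma cnt_eq0 xi a b : b <= a -> cnt xi a b = 0.
Proof. by move=> ba; rewrite /cnt set_itv_ge ?measure0// bnd_simp -leNgt. Qed.

Lemma cntD xi a b c : a <= b -> b <= c -> cnt xi a c = cnt xi a b + cnt xi b c.
Proof.
move=> ab bc; apply: EFin_inj; rewrite EFinD -!cntE.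
rewrite -measureU//=.
  by congr (xi _); rewrite -itv_bndbnd_setU// ?bnd_simp.
apply/seteqP; split => // y [] /=; rewrite !in_itv/= => /andP[_ yb] /andP[+ _].
by rewrite ltNge yb.
Qed.

Lemma cnt_counting xi a b : a <= b -> cnt xi a b = counting xi b - counting xi a.
Proof.
move=> ab; rewrite /counting.
have [a0|a0] := leP 0 a.
  have b0 := le_trans a0 ab.
  rewrite (@cnt_eq0 xi b 0)// (@cnt_eq0 xi a 0)// (@cntD xi 0 a b)//; ring.
have [b0|b0] := leP 0 b.
  rewrite (@cnt_eq0 xi b 0)// (@cnt_eq0 xi 0 a) ?ltW// (@cntD xi a 0 b)// ?ltW//.
  ring.
rewrite (@cnt_eq0 xi 0 a) ?ltW// (@cnt_eq0 xi 0 b) ?ltW//.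
by rewrite (@cntD xi a b 0)// ?ltW//; ring.
Qed.

Lemma counting0 xi : counting xi 0 = 0.
Proof. by rewrite /counting subrr. Qed.

Lemma counting_mono xi a b : a <= b -> counting xi a <= counting xi b.
Proof. by move=> ab; rewrite -subr_ge0 -cnt_counting// cnt_ge0. Qed.

Lemma counting_int xi x : exists z : int, counting xi x = z%:~R.
Proof.
rewrite /counting; have [n ->] := cnt_nat xi 0 x; have [m ->] := cnt_nat xi x 0.
by exists (n%:Z - m%:Z); rewrite rmorphB.
Qed.

Lemma cnt_translate u xi a b :
  cnt (translate u xi) a b = cnt xi (a - u) (b - u).
Proof. by rewrite /cnt translate_oc. Qed.

Lemma counting_translate u xi x : counting (translate u xi) x = counting xi (x - u) - counting xi (- u).
Proof.
rewrite /counting !cnt_translate sub0r -/(counting xi (x - u)) -/(counting xi (- u)).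
have [x0|x0] := leP 0 x.
  by rewrite (@cnt_eq0 _ (x - u)) ?lerD2r// ?subr0 ?cnt_counting// ?lerD2r ?lerBrDr ?addNr;
     lra.
rewrite (@cnt_eq0 _ (- u)) ?sub0r; last lra.
by rewrite cnt_counting ?opprB//; lra.
Qed.

Lemma measurable_cnt2 d (X : measurableType d) (xi : X -> config R)
    (a b : X -> R) : measurable_fun setT xi -> measurable_fun setT a ->
  measurable_fun setT b ->
  measurable_fun setT (fun t => cnt (xi t) (a t) (b t)).
Proof.
move=> mxi ma mb; apply: (measurableT_comp (@fine_measurable R setT measurableT)).
pose E := [set z : X * R | a z.1 < z.2] `&` [set z : X * R | z.2 <= b z.1].
have mE : measurable E.
  apply: measurableI.
    rewrite -[X in measurable X]setTI.
    by apply: measurable_fun_ltr => //; exact: measurableT_comp.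
  rewrite -[X in measurable X]setTI.
  by apply: measurable_fun_ler => //; exact: measurableT_comp.
have := measurable_config_xsection mxi mE.
apply: eq_measurable_fun => t _ /=; congr (xi t _).
apply/seteqP; split => y; rewrite /xsection/= inE /E/= in_itv/=.
  by move=> [-> ->].
by move=> /andP[].
Qed.

Lemma measurable_counting2 d (X : measurableType d) (xi : X -> config R)
    (x : X -> R) : measurable_fun setT xi -> measurable_fun setT x ->
  measurable_fun setT (fun t => counting (xi t) (x t)).
Proof.
by move=> mxi mx; apply: measurable_funB; apply: measurable_cnt2.
Qed.

Lemma measurable_counting x : measurable_fun setT (fun xi : config R => counting xi x).
Proof. by apply: measurable_counting2. Qed.

Definition discr xi x : R := counting xi x - x.

Lemma measurable_discr x : measurable_fun setT (fun xi : config R => discr xi x).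
Proof. by apply: measurable_funB => //; exact: measurable_counting. Qed.

Lemma discr_translate u xi x : discr (translate u xi) x = discr xi (x - u) - discr xi (- u).
Proof. by rewrite /discr counting_translate; ring. Qed.

(** The intervals from [x] to [x + n.+1%:R^-1] decrease to the empty set, so
    their integer masses eventually vanish. *)
Lemma counting_right xi x : exists2 e, 0 < e & counting xi (x + e) = counting xi x.
Proof.
pose F n := `]x, (x + n.+1%:R^-1)]%classic : set R.
have F0 : \bigcap_n F n = set0.
  apply/seteqP; split => // y Fy.
  have := Fy 0%N I; rewrite /F/= in_itv/= => /andP[xy _].
  have yx0 : 0 < y - x by rewrite subr_gt0.
  have [n _ /(_ n (leqnn n)) /= nyx] := near_infty_natSinv_lt (PosNum yx0).
  have := Fy n I; rewrite /F/= in_itv/= => /andP[_ yx].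
  by move: nyx; rewrite ltrBrDl ltNge yx.
have mF n : measurable (F n) by rewrite /F; exact: measurable_itv.
have F0fin : (xi (F 0%N) < +oo)%E.
  by rewrite -ge0_fin_numE//; apply: config_fin => //; exact: bounded_oc.
have ndF : {homo F : n m / (n <= m)%N >-> (m <= n)%O}.
  move=> n m nm; apply/subsetPset => y; rewrite /F/= !in_itv/= => /andP[-> ym].
  by rewrite (le_trans ym)// lerD2l lef_pV2 ?posrE// ler_nat.
have mcap : measurable (\bigcap_n F n) by rewrite F0.
have := nonincreasing_cvg_mu F0fin mF mcap ndF.
rewrite F0 measure0 => /fine_cvgP[_] /cvgrPdist_lt /(_ 1 ltr01) [n _].
move=> /(_ n (leqnn n)) /=; rewrite sub0r normrN => xiF.
exists n.+1%:R^-1; first by rewrite invr_gt0.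
apply/eqP; rewrite -subr_eq0 -cnt_counting; last by rewrite lerDl invr_ge0.
have [[|m] E] := cnt_nat xi x (x + n.+1%:R^-1); first by rewrite E.
move: xiF; rewrite -/(cnt xi x (x + n.+1%:R^-1)) E ger0_norm// ltrn1.
by [].
Qed.

End config_theory.

(** * Energies as integrals of squares *)

Section bounded_integrals.
Context d (Y : measurableType d) (R : realType) (U : probability Y R).

Lemma bounded_integrable (g : Y -> R) (K : R) : measurable_fun setT g ->
  (forall y, `|g y| <= K) -> U.-integrable setT (EFin \o g).
Proof.
move=> mg gK; apply: measurable_bounded_integrable => //.
  by rewrite -ge0_fin_numE// fin_num_measure.
exists K; split; first exact: num_real.
by move=> M KM y _ /=; apply: le_trans (ltW KM).
Qed.

Lemma integral_EFin (g : Y -> R) : U.-integrable setT (EFin \o g) ->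
  (\int[U]_y (g y)%:E = (\int[U]_y g y)%:E)%E.
Proof. by move=> ig; rewrite /Rintegral fineK// integrable_fin_num. Qed.

End bounded_integrals.

(** The algebra of [neutral_energy_square]: [i] and [j] stand for the mean and
    the mean square of one function under the background. *)
Lemma sum_sqr_dev (R : comNzRingType) (n : nat) (p : 'I_n -> R) (i j : R) :
  \sum_(k < n) \sum_(l < n) (p k - p l) ^+ 2 +
  n%:R ^+ 2 * (2 * (j - i ^+ 2)) + 2 * (\sum_(k < n) p k - n%:R * i) ^+ 2 =
  2 * n%:R * \sum_(k < n) (p k ^+ 2 - 2 * p k * i + j).
Proof.
pose P := \sum_(k < n) p k; pose Q := \sum_(k < n) p k ^+ 2.
have -> : \sum_(k < n) (p k ^+ 2 - 2 * p k * i + j) = Q - 2 * P * i + n%:R * j.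
  rewrite big_split/= sumrB -/Q sumr_const card_ord -[j *+ n]mulr_natl.
  by rewrite -mulr_suml -mulr_sumr.
have -> : \sum_(k < n) \sum_(l < n) (p k - p l) ^+ 2 =
    2 * n%:R * Q - 2 * P ^+ 2.
  rewrite (eq_bigr (fun k => n%:R * p k ^+ 2 - 2 * p k * P + Q)).
    rewrite big_split/= sumrB -mulr_sumr -/Q -mulr_suml -mulr_sumr -/P.
    by rewrite sumr_const card_ord -mulr_natl; ring.
  move=> k _; rewrite (eq_bigr (fun l => p k ^+ 2 - 2 * p k * p l + p l ^+ 2)).
    rewrite big_split/= sumrB sumr_const card_ord -mulr_sumr -/P -/Q.
    by rewrite -(mulr_natl (p k ^+ 2)).
  by move=> l _; ring.
by rewrite -/P; ring.
Qed.

Section energy_square.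
Local Open Scope ereal_scope.
Context dS dY (S : measurableType dS) (Y : measurableType dY) (R : realType).
Variables (m : {sigma_finite_measure set S -> \bar R}) (U : probability Y R).
Variables (Phi : S * Y -> R) (K : S -> R).
Hypothesis mPhi : measurable_fun setT Phi.
Hypothesis PhiK : forall s y, (`|Phi (s, y)| <= K s)%R.

Let mPhis s : measurable_fun setT (fun y => Phi (s, y)).
Proof. exact: measurableT_comp. Qed.

Let I s : R := (\int[U]_y Phi (s, y))%R.
Let J s : R := (\int[U]_y (Phi (s, y) ^+ 2))%R.

Let iPhi s : U.-integrable setT (fun y => (Phi (s, y))%:E).
Proof. exact: (bounded_integrable U (mPhis s) (PhiK s)). Qed.

Let iPhi2 s : U.-integrable setT (fun y => (Phi (s, y) ^+ 2)%:E).
Proof.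
apply: (@bounded_integrable _ _ _ U (fun y => Phi (s, y) ^+ 2)%R (K s ^+ 2)).
  exact: measurable_funX.
by move=> y; rewrite normrX lerXn2r// nnegrE (le_trans _ (PhiK s y)).
Qed.

Let EI s : \int[U]_y (Phi (s, y))%:E = (I s)%:E.
Proof. exact: (integral_EFin (iPhi s)). Qed.

Let EJ s : \int[U]_y (Phi (s, y) ^+ 2)%:E = (J s)%:E.
Proof. exact: (@integral_EFin _ _ _ U (fun y => Phi (s, y) ^+ 2)%R (iPhi2 s)). Qed.

Let sq (s : S) (y z : Y) : \bar R := ((Phi (s, y) - Phi (s, z)) ^+ 2)%:E.

Let sq_ge0 s y z : 0 <= sq s y z. Proof. by rewrite lee_fin sqr_ge0. Qed.

Let msq d (T : measurableType d) (f : T -> S) (g h : T -> Y) :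
  measurable_fun setT f -> measurable_fun setT g -> measurable_fun setT h ->
  measurable_fun setT (fun t => sq (f t) (g t) (h t)).
Proof.
move=> mf mg mh; apply/measurable_EFinP; apply: measurable_funX.
by apply: measurable_funB; apply: (measurableT_comp mPhi); apply/measurable_fun_pair.
Qed.

Let int_sq s y : \int[U]_z sq s y z =
  (Phi (s, y) ^+ 2 - 2 * Phi (s, y) * I s + J s)%:E.
Proof.
rewrite /sq (_ : (fun z => _) = (fun z =>
   ((Phi (s, y) ^+ 2)%:E - (2 * Phi (s, y))%:E * (Phi (s, z))%:E) +
   (Phi (s, z) ^+ 2)%:E)); last first.
  by apply/funext => z; rewrite -EFinM -EFinB -EFinD; congr _%:E; ring.
have ic : U.-integrable setT (fun=> (Phi (s, y) ^+ 2)%:E).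
  exact: finite_measure_integrable_cst.
have iM : U.-integrable setT (fun z => (2 * Phi (s, y))%:E * (Phi (s, z))%:E).
  by apply: integrableZl.
rewrite integralD//; last exact: integrableB.
rewrite integralB// integralZl// ?integral_cst//= ?probability_setT ?mule1.
by rewrite EI EJ.
Qed.

Let int2_sq s : \int[U]_y \int[U]_z sq s y z = (2 * (J s - I s ^+ 2))%:E.
Proof.
under eq_integral do rewrite int_sq.
rewrite (_ : (fun y => _) = (fun y =>
   ((Phi (s, y) ^+ 2)%:E - (2 * I s)%:E * (Phi (s, y))%:E) +
   (J s)%:E)); last first.
  by apply/funext => z; rewrite -EFinM -EFinB -EFinD; congr _%:E; ring.
have ic : U.-integrable setT (fun=> (J s)%:E).
  exact: finite_measure_integrable_cst.
have iM : U.-integrable setT (fun z => (2 * I s)%:E * (Phi (s, z))%:E).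
  by apply: integrableZl.
rewrite integralD//; last exact: integrableB.
rewrite integralB// integralZl// ?integral_cst//= ?probability_setT ?mule1.
by rewrite EI EJ -EFinM -EFinB -EFinD; congr _%:E; ring.
Qed.

(** The interaction energy of a neutral charge made of unit charges at the [x i]
    and of a background of mass [n] distributed as [U], for the kernel
    [- \int (Phi s y - Phi s z)^2], is a sum of squares: the terms
    [Phi s y ^ 2], which depend on one variable only, cancel by neutrality. *)
Lemma neutral_energy_square (n : nat) (x : 'I_n -> Y) :
  let W y z := \int[m]_s sq s y z in
  let psi s := (\sum_(i < n) Phi (s, x i) - n%:R * I s)%R in
  \sum_(i < n) \sum_(j < n) W (x i) (x j) +
  (n%:R ^+ 2)%:E * (\int[U]_y \int[U]_z W y z) + 2%:E * \int[m]_s (psi s ^+ 2)%:E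
  = (2 * n%:R)%:E * \sum_(i < n) \int[U]_z W (x i) z.
Proof.
move=> W psi.
have mT i j : measurable_fun setT (fun s => sq s (x i) (x j)) by exact: msq.
have -> : \sum_(i < n) \sum_(j < n) W (x i) (x j) =
    \int[m]_s (\sum_(i < n) \sum_(j < n) sq s (x i) (x j)).
  rewrite ge0_integral_sum//; last 2 first.
  - by move=> i; exact: emeasurable_sum.
  - by move=> i s _; exact: sume_ge0.
  by apply: eq_bigr => i _; rewrite ge0_integral_sum.
have mU y : measurable_fun setT (fun s => \int[U]_z sq s y z).
  apply: (@measurable_fun_fubini_tonelli_F _ _ _ _ _ U (fun sz => sq sz.1 y sz.2)) => //.
  exact: msq.
have swap1 y : \int[U]_z W y z = \int[m]_s \int[U]_z sq s y z.
  have /= := @fubini_tonelli _ _ _ _ _ m U (fun sz => sq sz.1 y sz.2).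
  by move=> <-//; exact: msq.
have mUU : measurable_fun setT (fun sy => \int[U]_z sq sy.1 sy.2 z).
  apply: (@measurable_fun_fubini_tonelli_F _ _ _ _ _ U
    (fun w : (S * Y) * Y => sq w.1.1 w.1.2 w.2)) => //.
  by apply: msq => //; exact: measurableT_comp.
have mUUm : measurable_fun setT (fun s => \int[U]_y \int[U]_z sq s y z).
  apply: (@measurable_fun_fubini_tonelli_F _ _ _ _ _ U
    (fun sy => \int[U]_z sq sy.1 sy.2 z)) => // sy.
  by apply: integral_ge0.
have swap2 : \int[U]_y \int[U]_z W y z = \int[m]_s \int[U]_y \int[U]_z sq s y z.
  under eq_integral do rewrite swap1.
  have /= := @fubini_tonelli _ _ _ _ _ m U (fun sy => \int[U]_z sq sy.1 sy.2 z).
  by move=> <-// sy; exact: integral_ge0.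
rewrite swap2; under [in RHS]eq_bigr do rewrite swap1.
have mI : measurable_fun setT I.
  apply: (measurableT_comp (@fine_measurable R setT measurableT)).
  pose f := fun sy => (Phi sy)%:E.
  have mf : measurable_fun setT f by exact/measurable_EFinP.
  rewrite (_ : (fun s => _) = fun s =>
      \int[U]_y (f^\+ (s, y)) - \int[U]_y (f^\- (s, y))).
    by apply: emeasurable_funB;
      apply: (@measurable_fun_fubini_tonelli_F _ _ _ _ _ U) => //;
      [exact: measurable_funepos|exact: measurable_funeneg].
  by apply/funext => s /=; rewrite integralE; congr (_ - _);
    apply: eq_integral => y _; rewrite ?funeposE ?funenegE.
have mpsi : measurable_fun setT (fun s => (psi s ^+ 2)%:E).
  apply/measurable_EFinP; apply: measurable_funX; apply: measurable_funB.
    by apply: measurable_sum => i; apply: (measurableT_comp mPhi);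
      apply/measurable_fun_pair.
  exact: measurable_funM.
pose F1 s := \sum_(i < n) \sum_(j < n) sq s (x i) (x j).
pose F2 s := \int[U]_y \int[U]_z sq s y z.
pose F3 s := \sum_(i < n) \int[U]_z sq s (x i) z.
have F1_ge0 s : 0 <= F1 s by apply: sume_ge0 => i _; exact: sume_ge0.
have F2_ge0 s : 0 <= F2 s by do 2 (apply: integral_ge0 => ? _).
have F3_ge0 s : 0 <= F3 s by apply: sume_ge0 => i _; exact: integral_ge0.
have mF1 : measurable_fun setT F1.
  by apply: emeasurable_sum => i; exact: emeasurable_sum.
have mF3 : measurable_fun setT F3 by exact: emeasurable_sum.
have psi_ge0 s : 0 <= (psi s ^+ 2)%:E by rewrite lee_fin sqr_ge0.
have -> : \sum_(i < n) \int[m]_s \int[U]_z sq s (x i) z = \int[m]_s F3 s.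
  by rewrite ge0_integral_sum// => i s _; exact: integral_ge0.
rewrite -(ge0_integralZl_EFin m measurableT (fun s _ => F2_ge0 s) mUUm)//.
rewrite -(ge0_integralZl_EFin m measurableT (fun s _ => F3_ge0 s) mF3)//.
rewrite -(ge0_integralZl_EFin m measurableT (fun s _ => psi_ge0 s) mpsi)//.
have mF2 : measurable_fun setT (fun s => (n%:R ^+ 2)%:E * F2 s).
  exact: measurable_funeM.
have mp2 : measurable_fun setT (fun s => 2%:E * (psi s ^+ 2)%:E).
  exact: measurable_funeM.
have nF2_ge0 s : 0 <= (n%:R ^+ 2)%:E * F2 s by rewrite mule_ge0// lee_fin sqr_ge0.
have npsi_ge0 s : 0 <= 2%:E * (psi s ^+ 2)%:E by rewrite mule_ge0.
rewrite -[X in X + _](ge0_integralD m measurableT (fun s _ => F1_ge0 s) mF1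
  (fun s _ => nF2_ge0 s) mF2).
rewrite -(ge0_integralD m measurableT)//; last 2 first.
- by move=> s _; exact: adde_ge0.
- exact: emeasurable_funD.
apply: eq_integral => s _; rewrite /F1 /F2 /F3 int2_sq.
have -> : \sum_(i < n) \int[U]_z sq s (x i) z =
    (\sum_(i < n) (Phi (s, x i) ^+ 2 - 2 * Phi (s, x i) * I s + J s))%:E.
  by rewrite -sumEFin; apply: eq_bigr => i _; rewrite int_sq.
have -> : \sum_(i < n) \sum_(j < n) sq s (x i) (x j) =
    (\sum_(i < n) \sum_(j < n) (Phi (s, x i) - Phi (s, x j)) ^+ 2)%:E.
  by rewrite -sumEFin; apply: eq_bigr => i _; rewrite -sumEFin.
rewrite -!EFinM -!EFinD; congr _%:E; rewrite /psi.
exact: sum_sqr_dev.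
Qed.

End energy_square.

(** * Change of variables for the Lebesgue measure *)

Section affine.
Context {R : realType}.
Local Notation mu := (@lebesgue_measure R).

Let measurable_affine (t b : R) :
  measurable_fun [set: measurableTypeR R] (fun x => t * x + b : measurableTypeR R).
Proof.
by apply: (@measurable_funD _ R R).
Qed.

(** The image of the Lebesgue measure, scaled back, agrees with it on
    intervals, which determines it. *)
Lemma ge0_integral_affine (f : R -> \bar R) (t b : R) : 0 < t ->
  measurable_fun [set: R] f -> (forall x, (0 <= f x)%E) ->
  (\int[mu]_x f (t * x + b)%R = (t^-1)%:E * \int[mu]_x f x)%E.
Proof.
move=> t0 mf f0.
have t0' : 0 <= t by exact: ltW.
pose nu := pushforward mu (fun x => t * x + b : measurableTypeR R).
pose nuM : {measure set (measurableTypeR R) -> \bar R} :=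
  measure_function_pushforward__canonical__measure_function_Measure mu
    (measurable_affine t b).
have nuE A : measurable A -> mu A = mscale (NngNum t0') nuM A.
  move=> mA; apply: lebesgue_measure_unique => // _ [[p q]] _ <-.
  change (mu `]p, q]%classic =
    (t%:E * mu ((fun x : R => (t * x + b)%R) @^-1` `]p, q]%classic))%E).
  rewrite (_ : _ @^-1` _ = `]((p - b) / t), ((q - b) / t)]%classic); last first.
    apply/seteqP; split=> x /=; rewrite !in_itv/= ltr_pdivrMr// ler_pdivlMr//;
      by rewrite ltrBlDr lerBrDr (mulrC x).
  rewrite !lebesgue_measure_itv/= !lte_fin ltr_pM2r ?invr_gt0// ltrD2r.
  case: ifPn => _; last by rewrite mule0.
  by rewrite -!EFinB -EFinM; congr _%:E; field; rewrite gt_eqF.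
transitivity (\int[nuM]_x f x)%E.
  by rewrite (@ge0_integral_pushforward _ _ _ _ _ _ (measurable_affine t b) mu).
have := ge0_integral_mscale nuM measurableT (NngNum t0') mf (fun x _ => f0 x).
move=> /(congr1 (fun z => (t^-1)%:E * z)%E).
rewrite muleA -EFinM mulVf ?gt_eqF// mul1e => <-; congr (_ * _)%E.
by apply: eq_measure_integral => A mA _; exact/esym/nuE.
Qed.

Lemma ge0_integral_shift (f : R -> \bar R) (b : R) :
  measurable_fun [set: R] f -> (forall x, (0 <= f x)%E) ->
  (\int[mu]_x f (x + b)%R = \int[mu]_x f x)%E.
Proof.
move=> mf f0; rewrite -[RHS]mul1e -[in RHS]invr1 -(ge0_integral_affine b)//.
by under [RHS]eq_integral do rewrite mul1r.
Qed.

Lemma ge0_integral_opp (f : R -> \bar R) :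
  measurable_fun [set: R] f -> (forall x, (0 <= f x)%E) ->
  (\int[mu]_x f (- x)%R = \int[mu]_x f x)%E.
Proof.
move=> mf f0.
have mN : measurable_fun [set: measurableTypeR R] (-%R : _ -> measurableTypeR R).
  exact: (@oppr_measurable R setT).
transitivity (\int[measure_function_pushforward__canonical__measure_function_Measure
   mu mN]_x f x)%E.
  by rewrite (@ge0_integral_pushforward _ _ _ _ _ _ mN mu).
by apply: eq_measure_integral => A mA _; exact: lebesgue_measureN.
Qed.

(** Both tails are tails of the exponential distribution. *)
Lemma integral_expR_abs_lty (k : R) : 0 < k ->
  (\int[mu]_x (expR (- (k * `|x|)))%:E < +oo)%E.
Proof.
move=> k0.
have mf : measurable_fun setT (fun x : R => (expR (- (k * `|x|)))%:E).
  apply/measurable_EFinP; apply: measurableT_comp => //; apply: measurableT_comp => //.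
  by apply: measurable_funM => //; exact: normr_measurable.
have mp : measurable_fun setT (fun x => (exponential_pdf k x)%:E).
  by apply/measurable_EFinP; exact: measurable_exponential_pdf.
have mpN : measurable_fun setT (fun x : R => (exponential_pdf k (- x))%:E).
  by apply: (measurableT_comp mp); exact: oppr_measurable.
have p0 x : (0 <= (exponential_pdf k x)%:E)%E.
  by rewrite lee_fin exponential_pdf_ge0// ltW.
have : (\int[mu]_x ((k^-1)%:E * ((exponential_pdf k x)%:E +
    (exponential_pdf k (- x))%:E)) < +oo)%E.
  rewrite ge0_integralZl_EFin//; last 3 first.
  - by move=> x _; exact: adde_ge0.
  - exact: emeasurable_funD.
  - by rewrite invr_ge0 ltW.
  rewrite ge0_integralD// (ge0_integral_opp mp)// integral_exponential_pdf//.
  by rewrite -EFinD -EFinM ltry.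
apply: le_lt_trans; apply: ge0_le_integral => //.
- by apply: measurable_funeM; exact: emeasurable_funD.
move=> x _; rewrite -EFinD -EFinM lee_fin.
have aux y : 0 <= y -> expR (- (k * y)) <= k^-1 * exponential_pdf k y.
  move=> y0; rewrite exponential_pdfE//.
  change (expR (- (k * y)) <= k^-1 * (k * expR (- k * y))).
  by rewrite mulrA mulVf ?gt_eqF// mul1r mulNr.
have [x0|x0] := leP 0 x.
  rewrite ger0_norm// mulrDr (le_trans (aux _ x0))// lerDl mulr_ge0//.
    by rewrite invr_ge0 ltW.
  by have := p0 (- x).
rewrite ltr0_norm// mulrDr; apply: (le_trans (aux _ _)).
  by rewrite oppr_ge0 ltW.
rewrite lerDr; apply: mulr_ge0; first by rewrite invr_ge0 ltW.
by have := p0 x.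
Qed.

End affine.

(** * The discrepancy is controlled by the energy *)

Section background.
Context {R : realType} (n : nat) (n0 : (0 < n)%N).
Local Notation mu := (@lebesgue_measure R).
Local Notation U := (uniform_prob (@box_lt R n n0)).

Lemma measurable_box : measurable (@box R n).
Proof. exact: measurable_itv. Qed.

Lemma integral_background (f : R -> \bar R) :
  measurable_fun setT f -> (forall x, (0 <= f x)%E) ->
  (n%:R%:E * \int[U]_x f x = \int[mu]_(x in @box R n) f x)%E.
Proof.
move=> mf f0; rewrite integral_uniform// muleA -EFinM.
rewrite (_ : _ * _ = 1) ?mul1e//.
have n0' : (n%:R : R) != 0 by rewrite pnatr_eq0 -lt0n.
by rewrite opprK -splitr mulfV.
Qed.

(** The background mass of a ray is its length in the box; each truncation at
    an end of the box breaks only one of the two inequalities. *)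
Lemma background_ray_le (z : R) : - (n%:R / 2) <= z ->
  n%:R / 2 - z <= n%:R * fine (U `]z, +oo[%classic).
Proof.
move=> nz.
have -> : n%:R * fine (U `]z, +oo[%classic) =
    fine (\int[mu]_(x in @box R n) (\1_(`]z, +oo[%classic) x)%:E).
  rewrite -integral_background//; last exact/measurable_EFinP.
  rewrite fineM//; last by rewrite integral_indic// setIT fin_num_measure.
  by rewrite integral_indic// setIT.
rewrite integral_indic//; last exact: measurable_box.
rewrite (_ : _ `&` _ = `]z, (n%:R / 2)]%classic); last first.
  apply/seteqP; split => x; rewrite /box/= !in_itv/= ?andbT.
    by move=> [-> /andP[_ ->]].
  by move=> /andP[zx ->]; split=> //; rewrite (le_trans nz)// ltW.
rewrite [X in fine X]lebesgue_measure_itv/= lte_fin; case: ifPn => //=.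
by rewrite -leNgt subr_le0.
Qed.

Lemma background_ray_ge (z : R) : z <= n%:R / 2 ->
  n%:R * fine (U `]z, +oo[%classic) <= n%:R / 2 - z.
Proof.
move=> nz.
have -> : n%:R * fine (U `]z, +oo[%classic) =
    fine (\int[mu]_(x in @box R n) (\1_(`]z, +oo[%classic) x)%:E).
  rewrite -integral_background//; last exact/measurable_EFinP.
  rewrite fineM//; last by rewrite integral_indic// setIT fin_num_measure.
  by rewrite integral_indic// setIT.
rewrite integral_indic//; last exact: measurable_box.
have : (mu (`]z, +oo[ `&` @box R n)%classic <=
    mu `]z, (n%:R / 2)%R]%classic)%E.
  apply: le_measure; rewrite ?inE//; first by apply: measurableI => //; exact: measurable_box.
  by move=> x; rewrite /box/= !in_itv/= ?andbT => -[-> /andP[_ ->]].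
rewrite [X in (_ <= X)%E]lebesgue_measure_itv/= lte_fin.
case: ifPn => zn h.
  rewrite -lee_fin fineK; first by rewrite EFinB.
  by rewrite ge0_fin_numE// (le_lt_trans h)// -EFinB ltry.
have h0 : (mu (`]z, +oo[ `&` @box R n)%classic <= 0)%E by [].
move: h0; rewrite measure_le0 => /eqP h0.
by rewrite [X in fine X](_ : _ = 0%E) ?subr_ge0.
Qed.

End background.

Section riesz_energy.
Context {R : realType} (a : R) (a1 : 1 <= a).
Local Notation mu := (@lebesgue_measure R).

Let a0 : 0 <= a. Proof. exact: le_trans ler01 a1. Qed.

(** The Riesz energy for [s = - a], expanded into the interactions of the
    background with the points, of the points and of the background with
    itself; see [riesz_energy_points]. *)
Definition background_potential (n : nat) (y : R) : R :=
  (\int[mu]_(z in box n) (`|y - z| `^ a))%R.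
Definition background_energy (n : nat) : R :=
  (\int[mu]_(y in box n) background_potential n y)%R.
Definition point_energy (n : nat) (x : 'I_n -> R) : R :=
  (\sum_(i < n) background_potential n (x i) -
   2^-1 * (\sum_(i < n) \sum_(j < n) `|x i - x j| `^ a + background_energy n))%R.

Lemma measurable_dist_powR :
  measurable_fun setT (fun z : R * R => `|z.1 - z.2| `^ a).
Proof.
apply: (measurableT_comp (measurable_powR a)).
by apply: (measurableT_comp (@normr_measurable R setT)); apply: measurable_funB.
Qed.

Lemma measurable_dist_powR1 (y : R) :
  measurable_fun setT (fun z : R => `|y - z| `^ a).
Proof.
apply: (measurableT_comp (measurable_powR a)).
by apply: (measurableT_comp (@normr_measurable R setT)); apply: measurable_funB.
Qed.

Lemma box_normr (n : nat) (z : R) : box n z -> `|z| <= n%:R / 2.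
Proof. by rewrite /box/= in_itv/= => /andP[z1 z2]; rewrite ler_norml z1. Qed.

Lemma mu_box (n : nat) : mu (@box R n) = n%:R%:E.
Proof.
rewrite /box lebesgue_measure_itv/= lte_fin.
have n0 : 0 <= n%:R :> R by [].
case: ifPn => nn; first by rewrite -EFinB; congr _%:E; field.
by congr _%:E; move: nn n0; rewrite -leNgt; lra.
Qed.

Lemma dist_powR_le (n : nat) (y z : R) : box n z ->
  `|y - z| `^ a <= (`|y| + n%:R) `^ a.
Proof.
move=> /box_normr zn; apply: ge0_ler_powR; rewrite ?nnegrE//.
by rewrite (le_trans (ler_normB _ _))// lerD2l (le_trans zn)// ler_pdivrMr//
  ler_peMr// ler1n.
Qed.

Lemma bounded_integrable_box (n : nat) (f : R -> R) (K : R) :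
  measurable_fun setT f -> (forall z, box n z -> `|f z| <= K) ->
  mu.-integrable (@box R n) (EFin \o f).
Proof.
move=> mf fK; apply: measurable_bounded_integrable => //.
- exact: measurable_box.
- by rewrite [X in (X < _)%E]mu_box ltry.
- exact: measurable_funTS.
exists K; split; first exact: num_real.
by move=> M KM z /= zn; apply: le_trans (ltW KM); exact: fK.
Qed.

Lemma background_potentialE (n : nat) (y : R) :
  (\int[mu]_(z in @box R n) (`|y - z| `^ a)%:E = (background_potential n y)%:E)%E.
Proof.
rewrite /background_potential /Rintegral fineK//.
apply: integrable_fin_num; first exact: measurable_box.
apply: (@bounded_integrable_box n (fun z => `|y - z| `^ a) ((`|y| + n%:R) `^ a)).
  exact: measurable_dist_powR1.
by move=> z zn; rewrite ger0_norm ?powR_ge0// dist_powR_le.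
Qed.

Lemma background_potential_ge0 n y : 0 <= background_potential n y.
Proof. by apply: Rintegral_ge0 => // z _; exact: powR_ge0. Qed.

Lemma measurable_background_potential n :
  measurable_fun setT (background_potential n).
Proof.
apply: (measurableT_comp (@fine_measurable R setT measurableT)).
have mb := @measurable_box R n.
under eq_fun => y do rewrite integral_mkcond.
apply: (@measurable_fun_fubini_tonelli_F _ _ R (measurableTypeR R) _ mu
  (fun yz : R * measurableTypeR R =>
    ((fun z => (`|yz.1 - z| `^ a)%:E) \_ (box n)) yz.2)%E); last first.
  by move=> z; apply: erestrict_ge0 => ? _; rewrite lee_fin powR_ge0.
rewrite (_ : (fun _ => _) = (fun yz : R * R =>
   (`|yz.1 - yz.2| `^ a * \1_(box n) yz.2)%:E)); last first.
  apply/funext => -[y z] /=; rewrite patchE indicE.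
  by case: ifPn => _; rewrite ?mulr1 ?mulr0.
apply/measurable_EFinP; apply: measurable_funM.
  exact: measurable_dist_powR.
by apply: measurableT_comp => //; exact: measurable_indic.
Qed.

Lemma background_energyE (n : nat) :
  (\int[mu]_(y in @box R n) (background_potential n y)%:E =
    (background_energy n)%:E)%E.
Proof.
rewrite /background_energy /Rintegral fineK//.
apply: integrable_fin_num; first exact: measurable_box.
apply: (@bounded_integrable_box n (background_potential n)
  (n%:R * (n%:R + n%:R) `^ a)).
  exact: measurable_background_potential.
move=> y yn; rewrite ger0_norm ?background_potential_ge0// -lee_fin.
rewrite -background_potentialE.
apply: (@le_trans _ _ (\int[mu]_(z in box n) ((n%:R + n%:R) `^ a)%:E)%E).
  apply: ge0_le_integral => //.
  - exact: measurable_box.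
  - by apply/measurable_EFinP; apply: measurable_funTS; exact: measurable_dist_powR1.
  move=> z zn; rewrite lee_fin (le_trans (dist_powR_le _ zn))//.
  apply: ge0_ler_powR; rewrite ?nnegrE ?addr_ge0//.
  by rewrite lerD2r (le_trans (box_normr yn))// ler_pdivrMr// ler_peMr// ler1n.
rewrite integral_cst//; last exact: measurable_box.
by rewrite [X in (_ * X)%E]mu_box -EFinM mulrC.
Qed.

(** The energy is a mixture of squared linear statistics as soon as the kernel
    is. *)
Lemma point_energy_square (n : nat) (n0 : (0 < n)%N) dS (S : measurableType dS)
    (m : {sigma_finite_measure set S -> \bar R})
    (Phi : S * R -> R) (K : S -> R) (c : R) :
  measurable_fun setT Phi -> (forall s y, `|Phi (s, y)| <= K s) ->
  (forall y z, \int[m]_s ((Phi (s, y) - Phi (s, z)) ^+ 2)%:E =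
     (c * `|y - z| `^ a)%:E)%E ->
  forall x : 'I_n -> R,
  (\int[m]_s ((\sum_(i < n) Phi (s, x i) -
     n%:R * (\int[uniform_prob (box_lt R n0)]_y Phi (s, y))) ^+ 2)%:E =
   (c * point_energy x)%:E)%E.
Proof.
move=> mPhi PhiK Phic x.
have c0 : 0 <= c.
  have := Phic 1 0; rewrite subr0 normr1 powR1 mulr1 => H.
  rewrite -lee_fin -H; apply: integral_ge0 => s _.
  by rewrite lee_fin sqr_ge0.
have EU y : (n%:R%:E * \int[uniform_prob (box_lt R n0)]_z (c * `|y - z| `^ a)%:E =
   (c * background_potential n y)%:E)%E.
  rewrite integral_background; last 2 first.
  - apply/measurable_EFinP; apply: measurable_funM => //.
    exact: measurable_dist_powR1.
  - by move=> z; rewrite lee_fin mulr_ge0// powR_ge0.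
  under eq_integral do rewrite EFinM.
  rewrite ge0_integralZl_EFin//.
  - by rewrite background_potentialE.
  - exact: measurable_box.
  - by apply/measurable_EFinP; apply: measurable_funTS; exact: measurable_dist_powR1.
have EUi y : (\int[uniform_prob (box_lt R n0)]_z
      \int[m]_s ((Phi (s, y) - Phi (s, z)) ^+ 2)%:E =
   (n%:R^-1 * (c * background_potential n y))%:E)%E.
  under eq_integral do rewrite Phic.
  by rewrite EFinM -EU muleA -EFinM mulVf ?mul1e// pnatr_eq0 -lt0n.
have EUU : ((n%:R ^+ 2)%:E * \int[uniform_prob (box_lt R n0)]_y
   \int[uniform_prob (box_lt R n0)]_z
      \int[m]_s ((Phi (s, y) - Phi (s, z)) ^+ 2)%:E =
   (c * background_energy n)%:E)%E.
  under eq_integral do rewrite EUi EFinM.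
  rewrite ge0_integralZl_EFin//; last 2 first.
  - by move=> y _; rewrite lee_fin mulr_ge0// background_potential_ge0.
  - apply/measurable_EFinP; apply: measurable_funM => //.
    exact: measurable_background_potential.
  rewrite muleA -EFinM expr2 mulfK ?pnatr_eq0 -?lt0n//.
  rewrite integral_background; last 2 first.
  - apply/measurable_EFinP; apply: measurable_funM => //.
    exact: measurable_background_potential.
  - by move=> z; rewrite lee_fin mulr_ge0// background_potential_ge0.
  under eq_integral do rewrite EFinM.
  rewrite ge0_integralZl_EFin//.
  - by rewrite background_energyE.
  - exact: measurable_box.
  - by move=> z _; rewrite lee_fin background_potential_ge0.
  - by apply/measurable_EFinP; apply: measurable_funTS;
      exact: measurable_background_potential.
have E1 : (\sum_(i < n) \sum_(j < n)
     \int[m]_s ((Phi (s, x i) - Phi (s, x j)) ^+ 2)%:E =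
   (\sum_(i < n) \sum_(j < n) c * `|x i - x j| `^ a)%:E)%E.
  by rewrite -sumEFin; apply: eq_bigr => i _; rewrite -sumEFin; apply: eq_bigr.
have E2 : (\sum_(i < n) \int[uniform_prob (box_lt R n0)]_z
      \int[m]_s ((Phi (s, x i) - Phi (s, z)) ^+ 2)%:E =
   (\sum_(i < n) n%:R^-1 * (c * background_potential n (x i)))%:E)%E.
  by rewrite -sumEFin; apply: eq_bigr.
have := @neutral_energy_square _ _ S (measurableTypeR R) R m
  (uniform_prob (box_lt R n0)) Phi K mPhi PhiK n x.
cbv zeta; rewrite E1 EUU E2 -EFinM -EFinD.
set psi2 := (X in (_ + _ * X)%E) => H; rewrite -/psi2.
have psi2E : psi2 = (2^-1 * (2 * n%:R *
    (\sum_(i < n) n%:R^-1 * (c * background_potential n (x i))) -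
    (\sum_(i < n) \sum_(j < n) c * `|x i - x j| `^ a + c * background_energy n)))%:E.
  have psi20 : (0 <= psi2)%E.
    by apply: integral_ge0 => s _; rewrite lee_fin sqr_ge0.
  case: psi2 psi20 H => [r _||//].
    by rewrite -EFinM -EFinD => -[<-]; congr _%:E; field.
  by move=> _; rewrite gt0_muley ?lte_fin// addey.
rewrite psi2E; congr _%:E; rewrite /point_energy -mulr_sumr.
rewrite -(mulr_sumr _ _ _ c).
rewrite [X in _ * (_ - (X + _)) = _](_ : _ =
    c * \sum_(i < n) \sum_(j < n) `|x i - x j| `^ a).
  by field; rewrite pnatr_eq0 -lt0n.
by rewrite mulr_sumr; apply: eq_bigr => i _; rewrite mulr_sumr.
Qed.

End riesz_energy.

Section discrepancy_energy.
Context {R : realType}.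
Local Notation mu := (@lebesgue_measure R).

(** The subtracted term is the mass of the background to the left of [v], for
    [v] in the box. *)
Definition point_discr (n : nat) (x : 'I_n -> R) (v : R) : R :=
  \sum_(i < n) (x i <= v)%R%:R - (v + n%:R / 2).

Definition clamp (t : R) : R := Num.min 1 (Num.max 0 t).

Lemma clamp_ge0 t : 0 <= clamp t.
Proof. by rewrite /clamp le_min ler01 le_max lexx. Qed.

Lemma clamp_le1 t : clamp t <= 1.
Proof. by rewrite /clamp ge_min lexx. Qed.

Lemma clamp_eq0 t : t <= 0 -> clamp t = 0.
Proof. by move=> t0; rewrite /clamp max_l// min_r. Qed.

Lemma clamp_eq1 t : 1 <= t -> clamp t = 1.
Proof. by move=> t1; rewrite /clamp max_r ?(le_trans ler01)// min_l. Qed.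

Lemma clampE t : 0 <= t <= 1 -> clamp t = t.
Proof. by move=> /andP[t0 t1]; rewrite /clamp max_r// min_r. Qed.

Lemma clamp_lip s t : s <= t -> 0 <= clamp t - clamp s <= t - s.
Proof.
move=> st; have [t0|t0] := leP t 0.
  by rewrite !clamp_eq0// ?(le_trans st)// subrr lexx subr_ge0.
have [t1|t1] := leP 1 t.
  rewrite (clamp_eq1 t1); have [s1|s1] := leP 1 s.
    by rewrite clamp_eq1// subrr lexx subr_ge0.
  have [s0|s0] := leP s 0; first by rewrite clamp_eq0//; lra.
  by rewrite (@clampE s) ?(ltW s0) ?(ltW s1)//; lra.
rewrite (@clampE t) ?(ltW t0) ?(ltW t1)//.
have [s0|s0] := leP s 0; first by rewrite clamp_eq0//; lra.
rewrite (@clampE s); first by lra.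
by rewrite (ltW s0) (le_trans st) ?ltW.
Qed.

Lemma measurable_clamp : measurable_fun setT clamp.
Proof. by apply: measurable_minr => //; exact: measurable_maxr. Qed.

Section ramp.
Variables (n : nat) (n0 : (0 < n)%N) (x : 'I_n -> R).
Local Notation U := (uniform_prob (@box_lt R n n0)).

(** The linear statistic of the ramp rising from 0 to 1 on [[z, z + r]]. *)
Definition ramp_stat (r z : R) : R :=
  \sum_(i < n) clamp ((x i - z) / r) -
  n%:R * (\int[U]_y clamp ((y - z) / r)).

Lemma measurable_ramp (r z : R) : measurable_fun setT (fun y : R => clamp ((y - z) / r)).
Proof.
apply: (measurableT_comp measurable_clamp); apply: measurable_funM => //.
exact: measurable_funB.
Qed.

Lemma integrable_ramp (r z : R) :
  U.-integrable setT (fun y => (clamp ((y - z) / r))%:E).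
Proof.
apply: (@bounded_integrable _ (measurableTypeR R) R U
  (fun y => clamp ((y - z) / r)) 1).
  exact: measurable_ramp.
by move=> y; rewrite ger0_norm ?clamp_ge0// clamp_le1.
Qed.

Let integrable_ray (z : R) :
  U.-integrable setT (fun y => (\1_(`]z, +oo[%classic) y : R)%:E).
Proof.
apply: (@bounded_integrable _ (measurableTypeR R) R U
  (\1_(`]z, +oo[%classic)) 1).
  exact: measurable_indic.
by move=> y; rewrite indicE; case: (_ \in _); rewrite ?normr1 ?normr0.
Qed.

Let int_ray (z : R) : \int[U]_y (\1_(`]z, +oo[%classic) y : R) =
  fine (U `]z, +oo[%classic).
Proof. by rewrite /Rintegral integral_indic// setIT. Qed.

Lemma sum_gt (z : R) : \sum_(i < n) (x i <= z)%R%:R =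
  n%:R - \sum_(i < n) (z < x i)%R%:R :> R.
Proof.
apply/eqP; rewrite eq_sym subr_eq -big_split/=; apply/eqP.
rewrite (eq_bigr (fun=> 1)); first by rewrite sumr_const card_ord.
by move=> i _; rewrite ltNge; case: (x i <= z); rewrite ?addr0 ?add0r.
Qed.

(** The ramp lies between the indicators of two rays. *)
Lemma discr_le_ramp (r z : R) : 0 < r -> box n z ->
  - point_discr x z <= ramp_stat r (z - r) + r.
Proof.
move=> r0; rewrite /box/= in_itv/= => /andP[nz zn].
rewrite /point_discr sum_gt /ramp_stat.
have H1 : \sum_(i < n) (z < x i)%R%:R <= \sum_(i < n) clamp ((x i - (z - r)) / r).
  apply: ler_sum => i _; case: ltP => zx; last exact: clamp_ge0.
  by rewrite clamp_eq1// ler_pdivlMr//; lra.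
have H2 : n%:R * (\int[U]_y clamp ((y - (z - r)) / r)) <=
    n%:R / 2 - (z - r).
  apply: le_trans (@background_ray_ge R n n0 (z - r) _); last by lra.
  rewrite ler_wpM2l// -int_ray; apply: le_Rintegral => //.
  - exact: integrable_ramp.
  - exact: integrable_ray.
  move=> y _; rewrite indicE mem_setE/= in_itv/= andbT.
  case: ltP => yz; first exact: clamp_le1.
  by rewrite clamp_eq0// pmulr_lle0 ?invr_gt0// subr_le0.
by lra.
Qed.

Lemma ramp_le_discr (r z : R) : 0 < r -> box n z ->
  ramp_stat r z - r <= - point_discr x z.
Proof.
move=> r0; rewrite /box/= in_itv/= => /andP[nz zn].
rewrite /point_discr sum_gt /ramp_stat.
have H1 : \sum_(i < n) clamp ((x i - z) / r) <= \sum_(i < n) (z < x i)%R%:R.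
  apply: ler_sum => i _; case: ltP => zx; first exact: clamp_le1.
  by rewrite clamp_eq0// pmulr_lle0 ?invr_gt0// subr_le0.
have H2 : n%:R / 2 - (z + r) <= n%:R * (\int[U]_y clamp ((y - z) / r)).
  apply: le_trans (@background_ray_le R n n0 (z + r) _) _; first by lra.
  rewrite ler_wpM2l// -int_ray; apply: le_Rintegral => //.
  - exact: integrable_ray.
  - exact: integrable_ramp.
  move=> y _; rewrite indicE mem_setE/= in_itv/= andbT.
  case: ltP => yz; last exact: clamp_ge0.
  by rewrite clamp_eq1// ler_pdivlMr//; lra.
by lra.
Qed.

(** Evaluating the ramp on either side of [z] bounds the discrepancy from above
    and from below, with an error equal to its width. *)
Lemma discr_sqr_le_ramp (r z : R) : 0 < r <= 1 -> box n z ->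
  point_discr x z ^+ 2 <=
  2 * ramp_stat r z ^+ 2 + 2 * ramp_stat r (z - r) ^+ 2 + 2.
Proof.
move=> /andP[r0 r1] bz.
have := discr_le_ramp r0 bz; have := ramp_le_discr r0 bz.
move: (point_discr x z) (ramp_stat r z) (ramp_stat r (z - r)) => d p q h1 h2.
have p0 := sqr_ge0 (p + r); have q0 := sqr_ge0 (q - r).
have p1 := sqr_ge0 p; have q1 := sqr_ge0 q.
have r2 : r ^+ 2 <= 1 by rewrite exprn_ile1// ltW.
have [d0|d0] := leP 0 d.
  have : d ^+ 2 <= (r - p) ^+ 2 by rewrite ler_sqr ?nnegrE//; lra.
  by nra.
have : (- d) ^+ 2 <= (q + r) ^+ 2 by rewrite ler_sqr ?nnegrE//; lra.
by nra.
Qed.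

Lemma measurable_point_discr : measurable_fun setT (point_discr x).
Proof.
apply: measurable_funB; last exact: measurable_funD.
apply: measurable_sum => i.
rewrite (_ : (fun _ => _) = \1_(`[x i, +oo[%classic)).
  exact: measurable_indic.
by apply/funext => v; rewrite indicE mem_setE in_itv/= andbT.
Qed.

End ramp.

(** For the kernel [|y - z|] the statistics are the indicators of rays, and
    the energy is exactly the squared norm of the discrepancy. *)
Lemma discr_le_energy1 (n : nat) (n0 : (0 < n)%N) (x : 'I_n -> R) :
  (\int[mu]_(v in @box R n) (point_discr x v ^+ 2)%:E <= (point_energy 1 x)%:E)%E.
Proof.
pose Phi (zy : measurableTypeR R * R) : R := (zy.1 < zy.2)%R%:R.
have mPhi : measurable_fun setT Phi.
  rewrite (_ : Phi = \1_[set zy : measurableTypeR R * R | zy.1 < zy.2]); last first.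
    by apply/funext => zy; rewrite indicE mem_setE.
  apply: measurable_indic; rewrite -[X in measurable X]setTI.
  by apply: measurable_fun_ltr.
have Phi1 s y : `|Phi (s, y)| <= cst 1 s.
  by rewrite /Phi/=; case: (s < y); rewrite ?normr1 ?normr0.
have Phic (y z : R) : (\int[mu]_s ((Phi (s, y) - Phi (s, z)) ^+ 2)%:E =
     (1 * `|y - z| `^ 1)%:E)%E.
  wlog yz : y z / z <= y => [hw|].
    have [/hw//|/ltW yz] := leP z y; rewrite distrC -hw//.
    by apply: eq_integral => s _; congr _%:E; ring.
  rewrite (_ : (fun _ => _) = (fun s => (\1_(`[z, y[%classic) s)%:E)).
    rewrite integral_indic// setIT [LHS]lebesgue_measure_itv/= lte_fin.
    rewrite powRr1// mul1r ger0_norm ?subr_ge0//; case: ltP => // yz'.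
    by congr _%:E; apply/eqP; rewrite eq_sym subr_eq0 eq_le yz yz'.
  apply/funext => s; rewrite /Phi/= indicE mem_setE in_itv/=.
  congr _%:E; case: (ltP s y) => sy; case: (ltP s z) => sz /=;
    rewrite ?subrr ?subr0 ?expr0n ?expr1n//.
  by have := lt_le_trans sz (le_trans yz sy); rewrite ltxx.
have := @point_energy_square R 1 (lexx 1) n n0 _ (measurableTypeR R) mu Phi
  (cst 1) 1 mPhi Phi1 Phic x.
rewrite mul1r => <-.
pose psi z := \sum_(i < n) Phi (z, x i) -
     n%:R * (\int[uniform_prob (box_lt R n0)]_y Phi (z, y)).
have psiE z : box n z -> psi z = - point_discr x z.
  rewrite /box/= in_itv/= => /andP[nz zn].
  have -> : psi z = \sum_(i < n) (z < x i)%R%:R -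
      n%:R * fine (uniform_prob (box_lt R n0) `]z, +oo[%classic).
    congr (_ - _ * _); rewrite /Rintegral; congr fine.
    rewrite (eq_integral (fun y : measurableTypeR R =>
      (\1_(`]z, +oo[%classic) y)%:E)).
      by rewrite integral_indic// setIT.
    by move=> y _; rewrite indicE mem_setE in_itv/= andbT.
  have h1 := @background_ray_le R n n0 z nz.
  have h2 := @background_ray_ge R n n0 z zn.
  have -> : n%:R * fine (uniform_prob (box_lt R n0) `]z, +oo[%classic) =
    n%:R / 2 - z by apply/eqP; rewrite eq_le h1 h2.
  by rewrite /point_discr (sum_gt x); lra.
rewrite (eq_integral (fun z => (psi z ^+ 2)%:E)); last first.
  by move=> z; rewrite inE => /psiE ->; rewrite sqrrN.
have mpsi : measurable_fun setT psi.
  apply: measurable_funB.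
    apply: measurable_sum => i; apply: (measurableT_comp mPhi).
    exact/measurable_fun_pair.
  apply: measurable_funM => //.
  apply: (measurableT_comp (@fine_measurable R setT measurableT)).
  apply: (@measurable_fun_fubini_tonelli_F _ _ (measurableTypeR R)
    (measurableTypeR R) R (uniform_prob (box_lt R n0)) (fun zy => (Phi zy)%:E)).
    exact/measurable_EFinP.
  by move=> zy; rewrite lee_fin.
apply: ge0_subset_integral => //; first exact: measurable_box.
  by apply/measurable_EFinP; exact: measurable_funX.
by move=> z _; rewrite lee_fin sqr_ge0.
Qed.

Lemma sigma_finite_plane : sigma_finite setT (mu \x mu)%E.
Proof.
pose F k := `](- k%:R)%R, k%:R]%classic : set (measurableTypeR R).
have ndF m n : (m <= n)%N -> F m `<=` F n.
  move=> mn y; rewrite /F/= !in_itv/= => /andP[my ym].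
  rewrite (le_trans ym) ?ler_nat// andbT.
  by apply: le_lt_trans my; rewrite lerN2 ler_nat.
exists (fun k => F k `*` F k).
  apply/seteqP; split => // -[y z] _.
  have Fy : (\bigcup_k F k) y by rewrite /F bigcup_itvT.
  have Fz : (\bigcup_k F k) z by rewrite /F bigcup_itvT.
  have [k _ ky] := Fy; have [l _ lz] := Fz.
  by exists (maxn k l) => //; split => /=;
    [apply: ndF ky; exact: leq_maxl|apply: ndF lz; exact: leq_maxr].
move=> k; split; first by apply: measurableX; exact: measurable_itv.
have mF : measurable (F k) by exact: measurable_itv.
have Fy : (mu (F k) < +oo)%E.
  by rewrite /F lebesgue_measure_itv/=; case: ifPn => _; rewrite -?EFinB ltry.
by rewrite product_measure1E// lte_mul_pinfty// ge0_fin_numE.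
Qed.

(** The parameters of the ramps: the logarithm of the width, and the position. *)
Definition plane : {sigma_finite_measure set
    (measurableTypeR R * measurableTypeR R)%type -> \bar R} :=
  HB.pack (mu \x mu)%E
    (Measure_isSigmaFinite.Build _ _ _ (mu \x mu)%E sigma_finite_plane).

(** The two shifts of [q] have the same integral over the line. *)
Lemma integral_sqr_le (n : nat) (f q : R -> R) (r : R) :
  measurable_fun setT f -> measurable_fun setT q ->
  (forall z, box n z -> f z ^+ 2 <= 2 * q z ^+ 2 + 2 * q (z - r) ^+ 2 + 2) ->
  (\int[mu]_(z in @box R n) (f z ^+ 2)%:E <=
   4%:E * \int[mu]_z (q z ^+ 2)%:E + (2 * n%:R)%:E)%E.
Proof.
move=> mf mq fq.
have mb := @measurable_box R n.
have mq2 : measurable_fun setT (fun z => (q z ^+ 2)%:E).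
  by apply/measurable_EFinP; apply: measurable_funX.
have q0 z : (0 <= (q z ^+ 2)%:E)%E by rewrite lee_fin sqr_ge0.
have mqt : measurable_fun setT (fun z : R => (q (z - r) ^+ 2)%:E).
  by apply: (measurableT_comp mq2); exact: measurable_funB.
have qs : (\int[mu]_z (q (z - r) ^+ 2)%:E = \int[mu]_z (q z ^+ 2)%:E)%E.
  exact: (@ge0_integral_shift R (fun z => (q z ^+ 2)%:E) (- r)).
have m2q : measurable_fun setT (fun z => 2%:E * (q z ^+ 2)%:E)%E.
  exact: measurable_funeM.
have m2qt : measurable_fun setT (fun z : R => 2%:E * (q (z - r) ^+ 2)%:E)%E.
  exact: measurable_funeM.
have mQ : measurable_fun setT (fun z : R =>
    2%:E * (q z ^+ 2)%:E + 2%:E * (q (z - r) ^+ 2)%:E)%E.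
  exact: emeasurable_funD.
have Q0 z : (0 <= 2%:E * (q z ^+ 2)%:E + 2%:E * (q (z - r)%R ^+ 2)%:E)%E.
  by rewrite adde_ge0// mule_ge0.
apply: (@le_trans _ _ (\int[mu]_(z in @box R n)
  ((2%:E * (q z ^+ 2)%:E + 2%:E * (q (z - r)%R ^+ 2)%:E) + 2%:E))%E).
  apply: ge0_le_integral => //.
  - by move=> z _; rewrite lee_fin sqr_ge0.
  - by apply/measurable_EFinP; apply: measurable_funTS; exact: measurable_funX.
  - by apply: measurable_funTS; exact: emeasurable_funD.
rewrite (@ge0_integralD _ _ _ mu _ mb); first last.
- exact: measurable_cst.
- by move=> z _; rewrite lee_fin.
- exact: measurable_funTS.
- by move=> z _; exact: Q0.
rewrite integral_cst// [X in (_ + _ * X)%E]mu_box -EFinM.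
apply: leeD => //.
apply: (@le_trans _ _ (\int[mu]_z
  (2%:E * (q z ^+ 2)%:E + 2%:E * (q (z - r)%R ^+ 2)%:E))%E).
  by apply: ge0_subset_integral => // z _; exact: Q0.
rewrite (@ge0_integralD _ _ _ mu _ measurableT)//; last 2 first.
- by move=> z _; rewrite mule_ge0.
- by move=> z _; rewrite mule_ge0.
rewrite (ge0_integralZl_EFin mu measurableT (fun z _ => q0 z) mq2)//.
rewrite (ge0_integralZl_EFin mu measurableT (fun z _ => q0 (z - r)) mqt)//.
by rewrite qs -ge0_muleDl// -EFinD (_ : 2 + 2 = 4 :> R)//; ring.
Qed.

Section ramp_kernel.
Variable a : R.
Hypothesis a12 : 1 < a < 2.

Let a1 : 1 < a. Proof. by case/andP: a12. Qed.
Let a2 : a < 2. Proof. by case/andP: a12. Qed.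

(** The ramps at all scales [expR t] and positions [z], weighted so that the
    resulting kernel is homogeneous of degree [a]. *)
Let Phi (s : (measurableTypeR R * measurableTypeR R) * R) : R :=
  expR ((a - 1) / 2 * s.1.1) * clamp ((s.2 - s.1.2) / expR s.1.1).

Let g (t z y y' : R) : \bar R := ((Phi ((t, z), y) - Phi ((t, z), y')) ^+ 2)%:E.

Let g_ge0 t z y y' : (0 <= g t z y y')%E.
Proof. by rewrite lee_fin sqr_ge0. Qed.

Let mPhi : measurable_fun setT Phi.
Proof.
apply: measurable_funM.
  apply: measurableT_comp => //; apply: measurable_funM => //.
  by apply: measurableT_comp => //; exact: measurableT_comp.
apply: (measurableT_comp measurable_clamp); apply: measurable_funM.
  by apply: measurable_funB => //; apply: measurableT_comp => //; exact: measurableT_comp.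
rewrite (_ : (fun _ => _) = (fun s : (measurableTypeR R * measurableTypeR R) * R => expR (- s.1.1))).
  apply: measurableT_comp => //; apply: measurableT_comp => //.
  exact: measurableT_comp.
by apply/funext => s; rewrite expRN.
Qed.

Let mg2 d (T : measurableType d) (t z y y' : T -> R) :
  measurable_fun setT t -> measurable_fun setT z -> measurable_fun setT y ->
  measurable_fun setT y' ->
  measurable_fun setT (fun w => g (t w) (z w) (y w) (y' w)).
Proof.
move=> mt mz my my'; apply/measurable_EFinP; apply: measurable_funX.
by apply: measurable_funB; apply: (measurableT_comp mPhi);
  apply/measurable_fun_pair => //; apply/measurable_fun_pair.
Qed.

Let gE t z y y' : g t z y y' = (expR ((a - 1) * t) *
  (clamp ((y - z) / expR t) - clamp ((y' - z) / expR t)) ^+ 2)%:E.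
Proof.
rewrite /g /Phi/= -mulrBr exprMn; congr (_ * _)%:E.
by rewrite expr2 -expRD; congr expR; field.
Qed.

Let h (t y y' : R) : \bar R := (\int[mu]_z g t z y y')%E.
Let G (y y' : R) : \bar R := (\int[mu]_t h t y y')%E.

Let h_ge0 t y y' : (0 <= h t y y')%E.
Proof. by apply: integral_ge0 => z _; exact: g_ge0. Qed.

Let mh d (T : measurableType d) (t y y' : T -> R) :
  measurable_fun setT t -> measurable_fun setT y -> measurable_fun setT y' ->
  measurable_fun setT (fun w => h (t w) (y w) (y' w)).
Proof.
move=> mt my my'.
apply: (@measurable_fun_fubini_tonelli_F _ _ T (measurableTypeR R) R mu
  (fun wz => g (t wz.1) wz.2 (y wz.1) (y' wz.1))) => //.
by apply: mg2 => //; apply: measurableT_comp.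
Qed.

Let G_shift y y' b : G (y + b) (y' + b) = G y y'.
Proof.
apply: eq_integral => t _; rewrite /h.
rewrite -(@ge0_integral_shift R (fun z => g t z y y') (- b)); last 2 first.
- exact: mg2.
- by move=> z; exact: g_ge0.
by apply: eq_integral => z _; rewrite !gE; congr (_ * (clamp (_ / _) -
  clamp (_ / _)) ^+ 2)%:E; ring.
Qed.

(** Change of variables [z |-> u * z], with [u] absorbed by the scale. *)
Let h_scale t u : 0 < u ->
  h t u 0 = ((u `^ a)%:E * h (t - ln u) 1 0)%E.
Proof.
move=> u0; rewrite /h.
have mgt : measurable_fun setT (fun z => g t z u 0) by exact: mg2.
have := @ge0_integral_affine R (fun z => g t z u 0) u 0 u0 mgt
  (fun z => g_ge0 t z u 0).
move=> /(congr1 (fun w => u%:E * w)%E).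
rewrite muleA -EFinM mulfV ?gt_eqF// mul1e => <-.
have m1 : measurable_fun setT (fun z => g (t - ln u) z 1 0) by exact: mg2.
have m2 : measurable_fun setT (fun z => g t (u * z + 0) u 0).
  apply: mg2; [exact: measurable_cst| |exact: measurable_cst|exact: measurable_cst].
  by apply: measurable_funD => //; exact: measurable_funM.
rewrite -(ge0_integralZl_EFin mu measurableT (fun z _ => g_ge0 (t - ln u) z 1 0) m1
  (powR_ge0 u a)).
rewrite -(ge0_integralZl_EFin mu measurableT (fun z _ => g_ge0 t (u * z + 0) u 0) m2
  (ltW u0)).
apply: eq_integral => z _; rewrite !gE -!EFinM addr0; congr _%:E.
have ut : expR (t - ln u) = expR t / u by rewrite expRB lnK ?posrE.
have -> : (1 - z) / expR (t - ln u) = (u - u * z) / expR t.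
  by rewrite ut; field; rewrite !gt_eqF// expR_gt0.
have -> : (0 - z) / expR (t - ln u) = (0 - u * z) / expR t.
  by rewrite ut; field; rewrite !gt_eqF// expR_gt0.
have E : u * expR ((a - 1) * t) = u `^ a * expR ((a - 1) * (t - ln u)).
  rewrite /powR gt_eqF// -expRD.
  transitivity (expR (ln u) * expR ((a - 1) * t)); first by rewrite lnK ?posrE.
  by rewrite -expRD; congr expR; ring.
by rewrite !mulrA E.
Qed.

(** Together with [G_shift] this identifies the kernel up to a constant. *)
Let G_scale u : 0 < u -> G u 0 = ((u `^ a)%:E * G 1 0)%E.
Proof.
move=> u0; rewrite /G.
under eq_integral do rewrite h_scale//.
have m1 : measurable_fun setT (fun t : R => h (t - ln u) 1 0).
  by apply: mh => //; exact: measurable_funB.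
rewrite (ge0_integralZl_EFin mu measurableT (fun t _ => h_ge0 (t - ln u) 1 0) m1
  (powR_ge0 u a)).
have mh1 : measurable_fun setT (fun t : R => h t 1 0) by exact: mh.
by rewrite (ge0_integral_shift (- ln u) mh1 (fun t => h_ge0 t 1 0)).
Qed.

(** A ramp of width [expR t] sees a pair of points at distance 1 from positions
    within [Num.max 1 (expR t)], and its increment is at most
    [Num.min 1 (expR t)^-1].  Hence decay at rate [a - 1] as [t] tends to minus
    infinity and at rate [2 - a] as [t] tends to plus infinity. *)
Let G_lty : (G 1 0 < +oo)%E.
Proof.
pose k := Num.min (a - 1) (2 - a).
have k0 : 0 < k by rewrite /k lt_min !subr_gt0 a1 a2.
have := integral_expR_abs_lty k0.
have mE : measurable_fun setT (fun t : R => (expR (- (k * `|t|)))%:E).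
  apply/measurable_EFinP; apply: measurableT_comp => //; apply: measurableT_comp => //.
  by apply: measurable_funM => //; exact: normr_measurable.
move=> Ek; apply: (@le_lt_trans _ _ (2%:E * \int[mu]_t (expR (- (k * `|t|)))%:E)%E);
  last by rewrite lte_mul_pinfty// lee_fin.
rewrite -ge0_integralZl_EFin//.
apply: ge0_le_integral => //.
- exact: mh.
- exact: measurable_funeM.
move=> t _.
pose M := Num.max 1 (expR t).
have M0 : 0 < M by rewrite /M lt_max ltr01.
pose K := expR ((a - 1) * t) * Num.min 1 (expR t)^-1 ^+ 2.
have K0 : 0 <= K.
  by rewrite mulr_ge0 ?expR_ge0// exprn_ge0// le_min ler01 invr_ge0 expR_ge0.
have gK z : (g t z 1%R 0%R <= (K * \1_(`[- M, M]%classic) z)%:E)%E.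
  rewrite gE lee_fin /K -mulrA ler_wpM2l ?expR_ge0// indicE mem_setE in_itv/=.
  have et := expR_gt0 t.
  have [zM|Mz] := leP (- M) z; last first.
    rewrite !clamp_eq1 ?subrr ?expr0n ?mulr0//= ler_pdivlMr// mul1r.
      have : expR t <= M by rewrite /M le_max lexx orbT.
      by lra.
    have : expR t <= M by rewrite /M le_max lexx orbT.
    by lra.
  have [zM'|Mz] := leP z M; last first.
    rewrite !clamp_eq0 ?subrr ?expr0n ?mulr0//= pmulr_lle0 ?invr_gt0//.
      have : 1 <= M by rewrite /M le_max lexx.
      by lra.
    have : 1 <= M by rewrite /M le_max lexx.
    by lra.
  rewrite mulr1.
  have zz : (0 - z) / expR t <= (1 - z) / expR t.
    by rewrite ler_pM2r ?invr_gt0// lerD2r.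
  have /andP[c0 c1] := clamp_lip zz.
  rewrite lerXn2r ?nnegrE// ?le_min ?ler01 ?invr_ge0 ?expR_ge0//.
  apply/andP; split.
    by have := clamp_le1 ((1 - z) / expR t); have := clamp_ge0 ((0 - z) / expR t); lra.
  apply: (le_trans c1); rewrite -mulrBl.
  by rewrite (_ : 1 - z - (0 - z) = 1) ?mul1r//; ring.
apply: (@le_trans _ _ (\int[mu]_z (K * \1_(`[- M, M]%classic) z)%:E)%E).
  apply: ge0_le_integral => //.
  - exact: mg2.
  - by apply/measurable_EFinP; apply: measurable_funM => //; exact: measurable_indic.
under eq_integral do rewrite EFinM.
rewrite ge0_integralZl_EFin//; last exact/measurable_EFinP/measurable_indic.
rewrite integral_indic// setIT [X in (_ * X)%E]lebesgue_measure_itv/= lte_fin.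
rewrite gtrN// -EFinB -!EFinM lee_fin opprK.
rewrite (_ : K * (M + M) = 2 * (K * M)); last by ring.
rewrite ler_pM2l//.
have [t0|t0] := leP 0 t.
  have M_E : M = expR t by rewrite /M max_r// -expR0 ler_expR.
  have -> : K = expR ((a - 3) * t).
    rewrite /K min_r -?expRN -?expRM_natl -?expRD; first by congr expR; ring.
    by rewrite -expR0 ler_expR oppr_le0.
  rewrite M_E -expRD ler_expR ger0_norm//.
  have : k * t <= (2 - a) * t by rewrite ler_wpM2r// /k ge_min lexx orbT.
  by nra.
have M_E : M = 1 by rewrite /M max_l// -expR0 ler_expR ltW.
have -> : K = expR ((a - 1) * t).
  rewrite /K min_l ?expr1n ?mulr1// -expRN -expR0 ler_expR; lra.
rewrite M_E mulr1 ler_expR ltr0_norm//.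
have : k * (- t) <= (a - 1) * (- t).
  apply: ler_wpM2r; first by rewrite oppr_ge0 ltW.
  by rewrite /k ge_min lexx.
by nra.
Qed.

(** A ramp narrower than [2^-1] that starts between 0 and [2^-1] separates the
    points 0 and 1. *)
Let G_gt0 : (0 < G 1 0)%E.
Proof.
apply: (@lt_le_trans _ _ (\int[mu]_(t in `[(-2)%R, (-1)%R]) (expR (-2) * 2^-1)%:E)%E).
  rewrite integral_cst//= [X in (_ * X)%E]lebesgue_measure_itv/= lte_fin ifT; last by lra.
  by rewrite -EFinB -EFinM lte_fin mulr_gt0// ?mulr_gt0 ?expR_gt0 ?invr_gt0//; lra.
apply: (@le_trans _ _ (\int[mu]_(t in `[(-2)%R, (-1)%R]) h t 1 0)%E); last first.
  by apply: ge0_subset_integral => //; exact: mh.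
apply: ge0_le_integral => //.
- by apply: measurable_funTS; exact: mh.
move=> t /=; rewrite in_itv/= => /andP[t2 t1].
have et := expR_gt0 t.
have e1 : expR t <= 2^-1.
  rewrite (@le_trans _ _ (expR (- 1)))// ?ler_expR//.
  rewrite expRN lef_pV2 ?posrE ?expR_gt0//.
  by have := expR_ge1Dx (1 : R); lra.
apply: (@le_trans _ _ (\int[mu]_(z in `[0%R, 2^-1%R]) (expR (-2))%:E)%E).
  rewrite integral_cst//= [X in (_ * X)%E]lebesgue_measure_itv/= lte_fin ifT ?invr_gt0//.
  by rewrite oppr0 adde0 EFinM.
apply: (@le_trans _ _ (\int[mu]_(z in `[0%R, 2^-1%R]) g t z 1 0)%E); last first.
  by apply: ge0_subset_integral => //; exact: mg2.
apply: ge0_le_integral => //.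
- by apply: measurable_funTS; exact: mg2.
move=> z /=; rewrite in_itv/= => /andP[z0 z1].
rewrite gE clamp_eq1; last first.
  by rewrite ler_pdivlMr// mul1r; lra.
rewrite (@clamp_eq0 ((0 - z) / expR t)); last first.
  by rewrite pmulr_lle0 ?invr_gt0// sub0r oppr_le0.
rewrite subr0 expr1n mulr1 lee_fin ler_expR.
have a1' : 0 <= a - 1 by rewrite subr_ge0; exact: ltW a1.
apply: le_trans (ler_wpM2l a1' t2); have := a2; lra.
Qed.

(** The energy is an integral over all scales; those with [- 1 <= t <= 0] already
    bound the discrepancy, through ramps of width at most 1. *)
Lemma discr_le_energy2 : exists2 C : R, 0 < C &
  forall (n : nat) (n0 : (0 < n)%N) (x : 'I_n -> R),
  (\int[mu]_(v in @box R n) (point_discr x v ^+ 2)%:E <=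
   (C * point_energy a x + 2 * n%:R)%:E)%E.
Proof.
pose c := fine (G 1 0).
have G0 : (0 <= G 1 0)%E by apply: integral_ge0 => t _; exact: h_ge0.
have cE : G 1 0 = c%:E by rewrite fineK// ge0_fin_numE//; exact: G_lty.
have c0 : 0 < c by rewrite -lte_fin -cE; exact: G_gt0.
exists (4 * expR 1 * c) => [|n n0 x].
  by rewrite mulr_gt0// mulr_gt0// expR_gt0.
have PhiK s y : `|Phi (s, y)| <= expR ((a - 1) / 2 * s.1).
  rewrite /Phi/= normrM ger0_norm ?expR_ge0// ler_piMr ?expR_ge0//.
  by rewrite ger0_norm ?clamp_ge0// clamp_le1.
have Phic (y z : R) : (\int[mu \x mu]_s ((Phi (s, y) - Phi (s, z)) ^+ 2)%:E =
     (c * `|y - z| `^ a)%:E)%E.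
  have -> : (\int[mu \x mu]_s ((Phi (s, y) - Phi (s, z)) ^+ 2)%:E = G y z)%E.
    rewrite (@fubini_tonelli1 _ _ (measurableTypeR R) (measurableTypeR R) R mu mu
      (fun s => g s.1 s.2 y z)).
    - by [].
    - exact: mg2.
    - by move=> s; exact: g_ge0.
  wlog yz : y z / z <= y => [hw|].
    have [zy|/ltW zy] := leP z y; first exact: hw.
    rewrite distrC -(hw z y zy).
    apply: eq_integral => t _; apply: eq_integral => w _.
    by rewrite !gE; congr (_ * _)%:E; ring.
  rewrite -(G_shift y z (- z)) subrr ger0_norm ?subr_ge0//.
  have [->|yz'] := eqVneq y z.
    rewrite subrr powR0 ?mulr0; last by rewrite gt_eqF//; exact: lt_trans ltr01 a1.
    rewrite /G; under eq_integral do rewrite /h.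
    rewrite integral0_eq// => t _; rewrite /h integral0_eq// => w _.
    by rewrite gE subrr expr0n/= mulr0.
  by rewrite G_scale ?cE ?subr_gt0 1?lt_neqAle 1?eq_sym ?yz' ?yz// -EFinM mulrC.
have := @point_energy_square R a (ltW a1) n n0 _
  (measurableTypeR R * measurableTypeR R)%type plane Phi _ c mPhi PhiK Phic x.
pose psi (s : measurableTypeR R * measurableTypeR R) : R :=
  expR ((a - 1) / 2 * s.1) * ramp_stat n0 x (expR s.1) s.2.
rewrite (eq_integral (fun s => (psi s ^+ 2)%:E)); last first.
  move=> s _; congr (_ ^+ 2)%:E; rewrite /psi /ramp_stat mulrBr mulr_sumr.
  congr (_ - _); rewrite mulrCA; congr (_ * _).
  rewrite -RintegralZl//; exact: integrable_ramp.
have mramp : measurable_fun setT (fun s : measurableTypeR R * measurableTypeR R =>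
    ramp_stat n0 x (expR s.1) s.2).
  have mF : measurable_fun setT
      (fun s : (measurableTypeR R * measurableTypeR R) * measurableTypeR R =>
        clamp ((s.2 - s.1.2) / expR s.1.1)).
    apply: (measurableT_comp measurable_clamp); apply: measurable_funM.
      apply: measurable_funB => //; apply: measurableT_comp => //.
    rewrite (_ : (fun _ => _) = (fun s : (measurableTypeR R * measurableTypeR R)
      * measurableTypeR R => expR (- s.1.1))).
      apply: measurableT_comp => //; apply: measurableT_comp => //.
      exact: measurableT_comp.
    by apply/funext => s; rewrite expRN.
  have mI : measurable_fun setT (fun s : measurableTypeR R * measurableTypeR R =>
      \int[uniform_prob (box_lt R n0)]_y (clamp ((y - s.2) / expR s.1))%:E)%E.
    apply: (@measurable_fun_fubini_tonelli_F _ _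
      (measurableTypeR R * measurableTypeR R)%type (measurableTypeR R) R
      (uniform_prob (box_lt R n0))
      (fun s : (measurableTypeR R * measurableTypeR R) * measurableTypeR R =>
        (clamp ((s.2 - s.1.2) / expR s.1.1))%:E)).
      exact/measurable_EFinP.
    by move=> s; rewrite lee_fin clamp_ge0.
  apply: measurable_funB.
    apply: measurable_sum => i.
    apply: (measurableT_comp measurable_clamp); apply: measurable_funM.
      exact: measurable_funB.
    rewrite (_ : (fun _ => _) = (fun s : measurableTypeR R * measurableTypeR R =>
      expR (- s.1))).
      by apply: measurableT_comp => //; apply: measurableT_comp.
    by apply/funext => s; rewrite expRN.
  apply: measurable_funM => //.
  exact: (measurableT_comp (@fine_measurable R setT measurableT)).
move=> psiE.
have mpsi : measurable_fun setT (fun s => (psi s ^+ 2)%:E).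
  apply/measurable_EFinP; apply: measurable_funX; apply: measurable_funM => //.
  by apply: measurableT_comp => //; exact: measurable_funM.
have psi0 s : (0 <= (psi s ^+ 2)%:E)%E by rewrite lee_fin sqr_ge0.
move: psiE; rewrite (@fubini_tonelli1 _ _ (measurableTypeR R) (measurableTypeR R)
  R mu mu _ mpsi psi0) /fubini_F => psiE.
have mpt : measurable_fun setT (fun t => \int[mu]_z (psi (t, z) ^+ 2)%:E)%E.
  exact: (@measurable_fun_fubini_tonelli_F _ _ (measurableTypeR R) (measurableTypeR R)
  R mu _ mpsi psi0).
have pt0 t : (0 <= \int[mu]_z (psi (t, z) ^+ 2)%:E)%E by exact: integral_ge0.
have mb := @measurable_box R n.
have mD : measurable_fun (box n) (fun v => (point_discr x v ^+ 2)%:E).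
  apply/measurable_EFinP; apply: measurable_funTS; apply: measurable_funX.
  exact: measurable_point_discr.
pose I := (\int[mu]_(v in @box R n) (point_discr x v ^+ 2)%:E)%E.
have slice t : -1 <= t <= 0 ->
    (I <= (4 * expR 1)%:E * \int[mu]_z (psi (t, z) ^+ 2)%:E + (2 * n%:R)%:E)%E.
  move=> /andP[t1 t0].
  have et := expR_gt0 t.
  have e1 : expR t <= 1 by rewrite -expR0 ler_expR.
  pose q z := ramp_stat n0 x (expR t) z.
  have mq : measurable_fun setT (fun z => (q z ^+ 2)%:E).
    apply/measurable_EFinP; apply: measurable_funX.
    exact: (measurableT_comp mramp (pair1_measurable (t : measurableTypeR R))).
  have q0 z : (0 <= (q z ^+ 2)%:E)%E by rewrite lee_fin sqr_ge0.
  apply: (@le_trans _ _ (4%:E * \int[mu]_z (q z ^+ 2)%:E + (2 * n%:R)%:E)%E).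
    apply: (@integral_sqr_le n _ q (expR t)).
    - exact: measurable_point_discr.
    - exact: (measurableT_comp mramp (pair1_measurable (t : measurableTypeR R))).
    by move=> z bz; apply: (@discr_sqr_le_ramp n n0 x); rewrite ?et.
  apply: leeD; last exact: lexx.
  rewrite EFinM -muleA; apply: lee_wpmul2l; first by rewrite lee_fin.
  have mpsit : measurable_fun setT (fun z => (psi (t, z) ^+ 2)%:E).
    exact: (measurableT_comp mpsi (pair1_measurable (t : measurableTypeR R))).
  rewrite -(ge0_integralZl_EFin mu measurableT (fun z _ => psi0 (t, z)) mpsit);
    last exact: expR_ge0.
  apply: ge0_le_integral => //; first exact: measurable_funeM.
  move=> z _; rewrite -EFinM lee_fin /psi /= exprMn mulrA ler_peMl ?sqr_ge0//.
  rewrite -expRM_natl -expRD -[leLHS]expR0 ler_expR.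
  have h1 : -1 <= (a - 1) * t.
    have : (a - 1) * t >= t by rewrite -subr_ge0 (_ : _ - t = (2 - a) * (- t));
      [rewrite mulr_ge0 ?subr_ge0 ?oppr_ge0// ltW|ring].
    by lra.
  rewrite (_ : 2%:R * ((a - 1) / 2 * t) = (a - 1) * t); first by lra.
  by field.
have I0 : (0 <= I)%E by apply: integral_ge0 => z _; rewrite lee_fin sqr_ge0.
have mu10 : mu `[(-1)%R, 0%R]%classic = 1%E.
  by rewrite lebesgue_measure_itv/= lte_fin ltrN10 -EFinB sub0r opprK.
rewrite -/I; move: I slice I0 => I slice I0.
have I1 : (\int[mu]_(t in `[(-1)%R, 0%R]) I = I)%E.
  by rewrite integral_cst// [X in (_ * X)%E]mu10 mule1.
rewrite -I1.
apply: (@le_trans _ _ (\int[mu]_(t in `[(-1)%R, 0%R])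
  ((4 * expR 1)%:E * (\int[mu]_z (psi (t, z) ^+ 2)%:E) + (2 * n%:R)%:E))%E).
  apply: ge0_le_integral => //.
  - apply: measurable_funTS; apply: emeasurable_funD => //.
    exact: measurable_funeM.
have e0 : 0 <= 4 * expR 1 :> R by rewrite mulr_ge0 ?expR_ge0.
rewrite (@ge0_integralD _ _ _ mu)//; first last.
- by apply: measurable_funTS; exact: measurable_funeM.
- by move=> t _; rewrite mule_ge0// lee_fin.
rewrite integral_cst// [X in (_ + _ * X)%E]mu10 mule1 EFinD; apply: leeD => //.
apply: (@le_trans _ _ (\int[mu]_t
  ((4 * expR 1)%:E * (\int[mu]_z (psi (t, z) ^+ 2)%:E)))%E).
  apply: ge0_subset_integral => //; first exact: measurable_funeM.
  by move=> t _; rewrite mule_ge0// lee_fin.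
rewrite (ge0_integralZl_EFin mu measurableT (fun t _ => pt0 t) mpt)//.
by rewrite psiE -EFinM mulrA.
Qed.

End ramp_kernel.

End discrepancy_energy.

Section discrepancy_energy_both.
Context {R : realType}.

(** In both cases the energy dominates the squared norm of the discrepancy, up
    to a term proportional to the number of points. *)
Lemma discr_le_energy (a : R) : 1 <= a < 2 -> exists2 C : R, 0 < C &
  forall (n : nat) (n0 : (0 < n)%N) (x : 'I_n -> R),
  (\int[@lebesgue_measure R]_(v in @box R n) (point_discr x v ^+ 2)%:E <=
   (C * point_energy a x + 2 * n%:R)%:E)%E.
Proof.
move=> /andP[]; rewrite le_eqVlt => /predU1P[<- _|a1 a2].
  exists 1 => // n n0 x; apply: (le_trans (discr_le_energy1 n0 x)).
  by rewrite lee_fin mul1r lerDl.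
by apply: discr_le_energy2; rewrite a1.
Qed.

End discrepancy_energy_both.

(** * Energies of configurations *)

Section config_energy.
Context {R : realType}.
Local Notation mu := (@lebesgue_measure R).

Lemma measurable_config_signed_integral d (X : measurableType d)
    (xi : X -> config R) (D : set R) (f : X * R -> R) :
  measurable D -> measurable_fun setT xi -> measurable_fun setT f ->
  measurable_fun setT (fun t => \int[xi t]_(y in D) f (t, y)).
Proof.
move=> mD mxi mf.
apply: (measurableT_comp (@fine_measurable R setT measurableT)).
have mg : measurable_fun setT (fun z : X * R => (f z * \1_D z.2)%:E).
  apply/measurable_EFinP; apply: measurable_funM => //.
  by apply: measurableT_comp => //; exact: measurable_indic.
rewrite (_ : (fun t => _) = fun t =>
   (\int[xi t]_y (fun z => (f z * \1_D z.2)%:E)^\+%E (t, y) -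
    \int[xi t]_y (fun z => (f z * \1_D z.2)%:E)^\-%E (t, y))%E).
  apply: emeasurable_funB; apply: measurable_config_integral => //.
  - exact: measurable_funepos.
  - exact: measurable_funeneg.
apply/funext => t; rewrite integral_mkcond integralE.
by congr (_ - _)%E; apply: eq_integral => y _;
  rewrite ?funeposE ?funenegE patchE indicE; case: ifPn => _;
  rewrite ?mulr1 ?mulr0.
Qed.

Lemma measurable_lebesgue_signed_integral d (X : measurableType d)
    (D : set R) (f : X * R -> R) :
  measurable D -> measurable_fun setT f ->
  measurable_fun setT (fun t => \int[mu]_(y in D) f (t, y)).
Proof.
move=> mD mf.
apply: (measurableT_comp (@fine_measurable R setT measurableT)).
have mg : measurable_fun setT (fun z : X * measurableTypeR R => (f z * \1_D z.2)%:E).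
  apply/measurable_EFinP; apply: measurable_funM => //.
  by apply: measurableT_comp => //; exact: measurable_indic.
rewrite (_ : (fun t => _) = fun t =>
   (\int[mu]_y (fun z : X * measurableTypeR R => (f z * \1_D z.2)%:E)^\+%E (t, y) -
    \int[mu]_y (fun z : X * measurableTypeR R => (f z * \1_D z.2)%:E)^\-%E (t, y))%E).
  apply: emeasurable_funB.
  - apply: (@measurable_fun_fubini_tonelli_F _ _ X (measurableTypeR R) R mu) => //.
    exact: measurable_funepos.
  - apply: (@measurable_fun_fubini_tonelli_F _ _ X (measurableTypeR R) R mu) => //.
    exact: measurable_funeneg.
apply/funext => t; rewrite integral_mkcond integralE.
by congr (_ - _)%E; apply: eq_integral => y _;
  rewrite ?funeposE ?funenegE patchE indicE; case: ifPn => _;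
  rewrite ?mulr1 ?mulr0.
Qed.

Lemma measurable_riesz_kernel (s : R) : measurable_fun setT (riesz_kernel s).
Proof.
rewrite /riesz_kernel; apply: (measurableT_comp (@oppr_measurable R setT)).
apply: (measurableT_comp (measurable_powR (- s))).
exact: normr_measurable.
Qed.

Lemma measurable_riesz_energy (n : nat) (s : R) :
  measurable_fun setT (fun xi : config R => riesz_energy n s xi).
Proof.
have mb := @measurable_box R n.
apply: measurable_funM => //.
have mk : measurable_fun setT (fun z : (config R * R) * R =>
    riesz_kernel s (z.2 - z.1.2)).
  apply: (measurableT_comp (measurable_riesz_kernel s)); apply: measurable_funB => //.
  by apply: measurableT_comp => //; exact: measurableT_comp.
have mF : measurable_fun setT (fun z : config R * R =>
    centered_integral n z.1 (fun x => riesz_kernel s (x - z.2))).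
  apply: measurable_funB.
    exact: (@measurable_config_signed_integral _ (config R * R)%type fst (box n)
      (fun z => riesz_kernel s (z.2 - z.1.2))).
  exact: (@measurable_lebesgue_signed_integral _ (config R * R)%type (box n)
    (fun z => riesz_kernel s (z.2 - z.1.2))).
apply: measurable_funB.
  exact: (@measurable_config_signed_integral _ (config R) id (box n)
    (fun z => centered_integral n z.1 (fun x => riesz_kernel s (x - z.2)))).
exact: (@measurable_lebesgue_signed_integral _ (config R) (box n)
    (fun z => centered_integral n z.1 (fun x => riesz_kernel s (x - z.2)))).
Qed.

(** Discrepancy inside the box; the counting starts one unit to the left of the
    box so that a particle sitting at its left end is not missed. *)
Definition box_discr (n : nat) (xi : config R) (v : R) : R :=
  cnt xi (- (n%:R / 2) - 1) v - (v + n%:R / 2).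

Lemma measurable_box_discr2 (n : nat) :
  measurable_fun setT (fun z : config R * R => box_discr n z.1 z.2).
Proof.
apply: measurable_funB; last exact: measurable_funD.
exact: measurable_cnt2.
Qed.

Lemma measurable_box_discr_integral (n : nat) :
  measurable_fun setT (fun xi : config R =>
    \int[mu]_(v in box n) (box_discr n xi v ^+ 2)%:E)%E.
Proof.
have mb := @measurable_box R n.
under eq_fun => xi do rewrite integral_mkcond.
apply: (@measurable_fun_fubini_tonelli_F _ _ (config R) (measurableTypeR R) _ mu
  (fun w => ((fun v => (box_discr n w.1 v ^+ 2)%:E) \_ (box n)) w.2)).
  rewrite (_ : (fun _ => _) = fun w : config R * measurableTypeR R =>
    (box_discr n w.1 w.2 ^+ 2 * \1_(box n) w.2)%:E); last first.
    by apply/funext => w; rewrite patchE indicE; case: ifP; rewrite ?mulr1 ?mulr0.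
  apply/measurable_EFinP; apply: measurable_funM.
    by apply: measurable_funX; exact: measurable_box_discr2.
  by apply: measurableT_comp => //; exact: measurable_indic.
by move=> w; rewrite patchE; case: ifP => // _; rewrite lee_fin sqr_ge0.
Qed.

Section points.
Variables (n : nat) (x : 'I_n -> R) (xi : config R).
Hypothesis xiE : forall A, measurable A -> xi A = (\sum_(i < n) \d_(x i) A)%E.
Hypothesis xb : forall i, box n (x i).

Let m (k : nat) : {measure set R -> \bar R} :=
  if insub k is Some i then \d_(x (i : 'I_n)) else mzero.

Let mE (i : 'I_n) : m i = \d_(x i).
Proof. by rewrite /m valK. Qed.

Let xi_msum A : measurable A -> xi A = msum m n A.
Proof.
by move=> mA; rewrite xiE// /msum; apply: eq_bigr => i _; rewrite mE.
Qed.

Lemma ge0_config_integral_points (D : set R) (f : R -> \bar R) :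
  measurable D -> measurable_fun setT f -> (forall y, (0 <= f y)%E) ->
  (\int[xi]_(y in D) f y = \sum_(i < n) (\1_D (x i))%:E * f (x i))%E.
Proof.
move=> mD mf f0.
rewrite (eq_measure_integral (msum m n)); last by move=> A mA _; exact: xi_msum.
rewrite ge0_integral_measure_sum//; last exact: measurable_funTS.
apply: eq_bigr => i _; rewrite mE integral_dirac//; last exact: measurable_funTS.
Qed.

Lemma config_Rintegral_points (f : R -> R) : measurable_fun setT f ->
  \int[xi]_(y in box n) f y = \sum_(i < n) f (x i).
Proof.
move=> mf; rewrite /Rintegral integralE.
have mE' : measurable_fun setT (EFin \o f) by exact/measurable_EFinP.
have mb := @measurable_box R n.
have i1 i : \1_(box n) (x i) = 1 :> R by rewrite indicE mem_set.
rewrite !ge0_config_integral_points//; last 2 first.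
- exact: measurable_funeneg.
- exact: measurable_funepos.
under eq_bigr do rewrite i1 mul1e.
under [X in (_ - X)%E]eq_bigr do rewrite i1 mul1e.
have -> : (\sum_(i < n) (EFin \o f)^\+ (x i) = (\sum_(i < n) Num.max (f (x i)) 0)%:E)%E.
  by rewrite -sumEFin; apply: eq_bigr => i _; rewrite funeposE/= EFin_max.
have -> : (\sum_(i < n) (EFin \o f)^\- (x i) = (\sum_(i < n) Num.max (- f (x i)) 0)%:E)%E.
  by rewrite -sumEFin; apply: eq_bigr => i _; rewrite funenegE/= EFin_max.
rewrite -EFinB/= -sumrB; apply: eq_bigr => i _.
by case: (leP (f (x i)) 0) => fx; [rewrite max_l ?oppr_ge0//|rewrite max_r ?oppr_le0 ?ltW//];
  rewrite ?sub0r ?opprK ?subr0.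
Qed.

(** The two centred integrals expand into the terms of [point_energy], the
    kernel being continuous and zero on the diagonal. *)
Lemma riesz_energy_points (s : R) : s <= -1 ->
  riesz_energy n s xi = point_energy (- s) x.
Proof.
move=> s1; set a := - s; have a1 : 1 <= a by rewrite /a lerNr.
have mb := @measurable_box R n.
have mpow (y : R) : measurable_fun setT (fun z : R => `|z - y| `^ a).
  under eq_fun do rewrite distrC.
  exact: measurable_dist_powR1.
have ipow (y : R) : mu.-integrable (box n) (EFin \o (fun z : R => `|y - z| `^ a)).
  apply: (@bounded_integrable_box R n _ ((`|y| + n%:R) `^ a)).
    exact: measurable_dist_powR1.
  by move=> z zn; rewrite ger0_norm ?powR_ge0// dist_powR_le.
have inner (y : R) : centered_integral n xi (fun z => riesz_kernel s (z - y)) =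
    background_potential a n y - \sum_(i < n) `|x i - y| `^ a.
  rewrite /centered_integral config_Rintegral_points; last first.
    apply: (measurableT_comp (measurable_riesz_kernel s)).
    exact: (@measurable_funB _ R R setT id (cst y)).
  rewrite /riesz_kernel sumrN addrC; congr (_ - _).
  rewrite (@eq_Rintegral _ _ _ mu (box n) (fun z => -1 * `|y - z| `^ a)); last first.
    by move=> z _; rewrite mulN1r distrC.
  by rewrite RintegralZl// mulN1r opprK.
rewrite /riesz_energy.
have -> : (fun y => centered_integral n xi (fun z => riesz_kernel s (z - y))) =
   (fun y => background_potential a n y - \sum_(i < n) `|x i - y| `^ a).
  exact/funext.
have mbp := @measurable_background_potential R a n.
have msum : measurable_fun setT (fun y : R => \sum_(i < n) `|x i - y| `^ a).
  by apply: measurable_sum => i; exact: measurable_dist_powR1.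
rewrite /centered_integral config_Rintegral_points; last exact: measurable_funB.
have ibp : mu.-integrable (box n) (EFin \o background_potential a n).
  apply/integrableP; split; first exact/measurable_EFinP/measurable_funTS.
  rewrite (@eq_integral _ _ _ mu (box n) (fun y => (background_potential a n y)%:E)); last first.
    by move=> y _ /=; rewrite ger0_norm// background_potential_ge0.
  by rewrite background_energyE// ltry.
have isum : mu.-integrable (box n) (EFin \o (fun y : R => \sum_(i < n) `|x i - y| `^ a)).
  rewrite (_ : _ \o _ = fun y : R => (\sum_(i < n) (`|x i - y| `^ a)%:E)%E); last first.
    by apply/funext => y /=; rewrite sumEFin.
  by apply: integrable_sum => // i _; exact: ipow.
rewrite RintegralB//.
have -> : \int[mu]_(y in box n) (\sum_(i < n) `|x i - y| `^ a) =
    \sum_(i < n) background_potential a n (x i).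
  rewrite /Rintegral.
  under eq_integral do rewrite -sumEFin.
  rewrite ge0_integral_sum//; last first.
    by move=> i; apply/measurable_EFinP; apply: measurable_funTS;
      exact: measurable_dist_powR1.
  rewrite (eq_bigr (fun i => (background_potential a n (x i))%:E)).
    by rewrite sumEFin.
  by move=> i _; rewrite background_potentialE.
rewrite sumrB /point_energy -/(background_energy a n).
have -> : \sum_i \sum_(i0 < n) `|x i0 - x i| `^ a =
    \sum_(i < n) \sum_(j < n) `|x i - x j| `^ a by rewrite exchange_big.
by field.
Qed.

Lemma discr_points v : box n v -> box_discr n xi v = point_discr x v.
Proof.
rewrite /box/= in_itv/= => /andP[nv vn].
rewrite /box_discr /point_discr; congr (_ - _); rewrite /cnt xiE//.
rewrite (eq_bigr (fun i => ((x i <= v)%R%:R)%:E)); first by rewrite sumEFin.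
move=> i _; rewrite diracE mem_setE in_itv/=.
have := xb i; rewrite /box/= in_itv/= => /andP[nx _].
by rewrite (lt_le_trans _ nx)// ltrBlDr ltrDl.
Qed.

End points.
End config_energy.

(** * Restricted measures and densities *)

Section density.
Context d (T : measurableType d) {R : realType}.

Lemma ge0_integral_density (Q B : probability T R) (h g : T -> \bar R) :
  measurable_fun setT h -> (forall x, 0 <= h x)%E ->
  (forall A, measurable A -> Q A = \int[B]_(x in A) h x)%E ->
  measurable_fun setT g -> (forall x, 0 <= g x)%E ->
  (\int[Q]_x g x = \int[B]_x (g x * h x))%E.
Proof.
move=> mh h0 QE mg g0.
have QB : Q `<< B.
  apply/null_content_dominatesP => A mA BA0.
  rewrite QE//; apply: null_set_integral => //.
  exact: measurable_funTS.
rewrite -(Radon_Nikodym_SigmaFinite.change_of_variables QB g0 measurableT mg).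
have ih : B.-integrable setT h.
  apply/integrableP; split=> //.
  under eq_integral do rewrite gee0_abs//.
  by rewrite -QE// probability_setT ltry.
have mf := measurable_int B (Radon_Nikodym_SigmaFinite.f_integrable QB).
have hf : ae_eq B setT h (Radon_Nikodym_SigmaFinite.f Q B).
  apply: integral_ae_eq => // A _ mA.
  by rewrite -QE// -(Radon_Nikodym_SigmaFinite.f_integral QB).
apply: ge0_ae_eq_integral => //.
- exact: emeasurable_funM.
- exact: emeasurable_funM.
- by move=> x _; rewrite mule_ge0// Radon_Nikodym_SigmaFinite.f_ge0.
- by move=> x _; rewrite mule_ge0.
by apply: filterS hf => x /= /(_ I) ->.
Qed.

Lemma ge0_integral_mrestr (mu : {measure set T -> \bar R}) (E : set T)
    (mE : measurable E) (f : T -> \bar R) :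
  measurable_fun setT f -> (forall x, 0 <= f x)%E ->
  (\int[mrestr mu mE]_x f x = \int[mu]_(x in E) f x)%E.
Proof.
move=> mf f0.
rewrite -(setUv E) ge0_integral_setU//.
- rewrite [X in (_ + X)%E]null_set_integral ?adde0//.
  + apply: eq_measure_integral => A mA AE.
    by rewrite /= /mrestr/= setIidl.
  + exact: measurableC.
  + exact: measurable_funTS.
  + by rewrite /= /mrestr setICl measure0.
- exact: measurableC.
- exact: measurable_funTS.
- by rewrite disj_set2E setICr.
Qed.

End density.

(** * Unit cells *)

Section cells.
Context {R : realType}.
Local Notation mu := (@lebesgue_measure R).

Definition cell (n : nat) (k : nat) : set R :=
  `](- (n%:R / 2) + k%:R), (- (n%:R / 2) + k.+1%:R)]%classic.

Lemma measurable_cell n k : measurable (cell n k).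
Proof. exact: measurable_itv. Qed.

Lemma cell_box n k : (k < n)%N -> cell n k `<=` box n.
Proof.
move=> kn x; rewrite /cell /box /= !in_itv/= => /andP[xk kx].
have k0 : 0 <= k%:R :> R by [].
have kn' : k.+1%:R <= n%:R :> R by rewrite ler_nat.
by apply/andP; split; lra.
Qed.

Lemma cell_inj n k l x : cell n k x -> cell n l x -> k = l.
Proof.
rewrite /cell/= !in_itv/= => /andP[k1 k2] /andP[l1 l2].
have kl : (k < l.+1)%N by rewrite -(ltr_nat R); lra.
have lk : (l < k.+1)%N by rewrite -(ltr_nat R); lra.
by apply/eqP; rewrite eqn_leq -ltnS kl -ltnS lk.
Qed.

Lemma cell_dist n k x y : cell n k x -> cell n k y -> `|x - y| <= 1.
Proof.
rewrite /cell/= !in_itv/= -(natr1 k) => /andP[x1 x2] /andP[y1 y2].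
by rewrite ler_norml; apply/andP; split; lra.
Qed.

Lemma mu_cell n k : mu (cell n k) = 1%E.
Proof.
rewrite /cell [LHS]lebesgue_measure_itv/= lte_fin -(natr1 k).
rewrite ltrD2l ltrDl ltr01 -EFinB; congr _%:E; ring.
Qed.

Lemma box_cells n (f : R -> \bar R) : measurable_fun setT f ->
  (forall x, 0 <= f x)%E ->
  (\int[mu]_(x in box n) f x = \sum_(k < n) \int[mu]_(x in cell n k) f x)%E.
Proof.
move=> mf f0.
suff H m : (\int[mu]_(x in `](- (n%:R / 2))%R, (- (n%:R / 2) + m%:R)%R]) f x =
    \sum_(k < m) \int[mu]_(x in cell n k) f x)%E.
  rewrite -H /box -integral_itv_obnd_cbnd; last exact: measurable_funTS.
  by rewrite (_ : - (n%:R / 2) + n%:R = n%:R / 2)//; field.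
elim: m => [|m IH].
  by rewrite big_ord0 addr0 set_itv_ge ?integral_set0// bnd_simp ltxx.
rewrite big_ord_recr/= -IH -ge0_integral_setU//.
- congr (integral _ _ _); apply/esym.
  rewrite /cell -itv_bndbnd_setU// bnd_simp ?lerDl// lerD2l ler_nat//.
- exact: measurable_cell.
- exact: measurable_funTS.
- rewrite disj_set2E; apply/eqP/seteqP; split => // x [].
  rewrite /cell/= !in_itv/= => /andP[_ xm] /andP[mx _].
  by move: mx; rewrite ltNge xm.
Qed.

Lemma uniform_cell n (n0 : (0 < n)%N) (A : set R) : measurable A ->
  A `<=` box n -> uniform_prob (box_lt R n0) A = (n%:R^-1%:E * mu A)%E.
Proof.
move=> mA An.
have := integral_background n0 (f := fun x => (\1_A x)%:E).
rewrite integral_indic// integral_indic// ?setIT ?setIidl//; last exact: measurable_box.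
move=> <-//; last exact/measurable_EFinP.
rewrite muleA -EFinM mulVf ?mul1e//.
by rewrite pnatr_eq0 -lt0n.
Qed.

End cells.

(** * One particle in each cell *)

Section assignment.
Context {R : realType} (n : nat) (n0 : (0 < n)%N).
Local Notation leb := (@lebesgue_measure R).
Context d (Omega : measurableType d) (mu : probability Omega R).
Variable X : 'I_n -> {mfun Omega >-> R}.
Hypothesis indepX : independent mu (fun i => g_sigma_algebra_preimage (X i)).
Hypothesis unifX :
  forall i, same_law (distribution mu (X i)) (uniform_prob (box_lt R n0)).

(** The particles occupy all the cells, once each, in the order [sigma]. *)
Definition assignment (sigma : {perm 'I_n}) : set Omega :=
  [set w | forall i, cell n (sigma i) (X i w)].

Lemma independent_points (B : 'I_n -> set R) : (forall i, measurable (B i)) ->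
  mu [set w | forall i, B i (X i w)] =
    (\prod_(i < n) uniform_prob (box_lt R n0) (B i))%E.
Proof.
move=> mB.
have := indepX (enum_uniq 'I_n) (E := fun i => X i @^-1` B i).
rewrite (_ : \bigcap_(i in _) _ = [set w | forall i, B i (X i w)]).
  move=> ->; last by move=> i _; exists (B i) => //; rewrite setTI.
  rewrite big_enum/=; apply: eq_bigr => i _.
  by rewrite -(unifX i).
apply/seteqP; split => w h i; last by move=> _; exact: h.
by apply: h; rewrite /= mem_enum.
Qed.

Lemma measurable_points (B : 'I_n -> set R) : (forall i, measurable (B i)) ->
  measurable [set w | forall i, B i (X i w)].
Proof.
move=> mB.
rewrite (_ : [set w | _] = \bigcap_(i in [set: 'I_n]) (X i @^-1` B i)).
  apply: fin_bigcap_measurable => // i _.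
  by rewrite -[X in measurable X]setTI; exact: measurable_funP.
by apply/seteqP; split => w h i => [_|]; exact: h.
Qed.

Lemma measurable_assignment sigma : measurable (assignment sigma).
Proof. by apply: (@measurable_points (fun i => cell n (sigma i))) => i; exact: measurable_cell. Qed.

Lemma assignment_inj sigma tau w :
  assignment sigma w -> assignment tau w -> sigma = tau.
Proof.
move=> ws wt; apply/permP => i; apply/val_inj => /=.
exact: cell_inj (ws i) (wt i).
Qed.

Local Notation p := ((n%:R : R) ^- n).

(** By independence, conditionally on the assignment the particles are
    independent and uniform in their cells. *)
Lemma assignment_points sigma (B : 'I_n -> set R) :
  (forall i, measurable (B i)) ->
  mu (assignment sigma `&` [set w | forall i, B i (X i w)]) =
    (p%:E * \prod_(i < n) leb (cell n (sigma i) `&` B i))%E.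
Proof.
move=> mB.
rewrite (_ : _ `&` _ = [set w | forall i, (cell n (sigma i) `&` B i) (X i w)]).
  rewrite (@independent_points (fun i => cell n (sigma i) `&` B i)); last first.
    by move=> i; apply: measurableI => //; exact: measurable_cell.
  rewrite (eq_bigr (fun i => (n%:R^-1)%:E * leb (cell n (sigma i) `&` B i))%E).
    rewrite big_split/=; congr (_ * _)%E.
    by rewrite prodEFin prodr_const card_ord exprVn.
  move=> i _; apply: uniform_cell.
    by apply: measurableI => //; exact: measurable_cell.
  by move=> x [+ _]; apply: cell_box.
apply/seteqP; split => w; first by move=> [h1 h2] i; split; [exact: h1|exact: h2].
by move=> h; split => i; have [] := h i.
Qed.

Lemma assignment_prob sigma : mu (assignment sigma) = p%:E.
Proof.
rewrite -[X in mu X]setIT (_ : setT = [set w | forall i, setT (X i w)]); last first.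
  by apply/seteqP; split.
rewrite (@assignment_points sigma (fun=> setT))// big1 ?mule1// => i _.
by rewrite setIT mu_cell.
Qed.

Lemma assignment_integral1 sigma (i : 'I_n) (f : R -> \bar R) :
  measurable_fun setT f -> (forall x, 0 <= f x)%E ->
  (\int[mu]_(w in assignment sigma) f (X i w) =
   p%:E * \int[leb]_(x in cell n (sigma i)) f x)%E.
Proof.
move=> mf f0.
have mE := measurable_assignment sigma.
have mC := @measurable_cell R n (sigma i).
have p0 : 0 <= p by rewrite invr_ge0 exprn_ge0.
rewrite -ge0_integral_mrestr//; last exact: measurableT_comp.
have mX : measurable_fun setT (X i : Omega -> measurableTypeR R).
  exact: (measurable_funP (X i)).
rewrite -(@ge0_integral_pushforward _ _ Omega (measurableTypeR R) R _ mX (mrestr mu mE) setT f)//.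
rewrite -(ge0_integral_mrestr leb mC)//.
rewrite -(@ge0_integral_mscale _ _ R (mrestr leb mC) setT measurableT (NngNum p0) f)//.
apply: eq_measure_integral => A mA _ /=.
rewrite /mscale/= /pushforward /mrestr setIC.
have := @assignment_points sigma (fun j => if j == i then A else setT).
rewrite (_ : [set w | _] = X i @^-1` A); last first.
  apply/seteqP; split => w /=; first by move=> /(_ i); rewrite eqxx.
  by move=> wA j; case: eqP => // ->.
move=> ->; last by move=> j; case: ifP.
congr (_ * _)%E.
rewrite (bigD1 i)//= eqxx big1 ?mule1; first by rewrite setIC.
by move=> j /negPf ->; rewrite setIT mu_cell.
Qed.

Lemma assignment_integral2 sigma (i j : 'I_n) (f : R * R -> \bar R) :
  i != j -> measurable_fun setT f -> (forall x, 0 <= f x)%E ->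
  (\int[mu]_(w in assignment sigma) f (X i w, X j w) =
   p%:E * \int[leb]_(x in cell n (sigma i)) \int[leb]_(y in cell n (sigma j))
     f (x, y))%E.
Proof.
move=> ij mf f0.
have mE := measurable_assignment sigma.
have mC k : @measurable _ (measurableTypeR R) (cell n (sigma k)).
  exact: measurable_cell.
have p0 : 0 < p by rewrite invr_gt0 exprn_gt0 ?ltr0n.
have q0 : 0 <= p^-1 by rewrite invr_ge0 ltW.
have mXX : measurable_fun setT (fun w => (X i w, X j w) : measurableTypeR R * measurableTypeR R).
  apply: measurable_fun_pair.
    exact: (measurable_funP (X i)).
  exact: (measurable_funP (X j)).
have Coo k : (leb (cell n (sigma k)) < +oo)%E by rewrite mu_cell ltry.
pose l k : {finite_measure set (measurableTypeR R) -> \bar R} := @mfrestr _ (measurableTypeR R) R _ leb (mC k) (Coo k).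
have lE k (g : measurableTypeR R -> \bar R) : measurable_fun setT g ->
    (forall x, 0 <= g x)%E ->
    (\int[l k]_x g x = \int[leb]_(x in cell n (sigma k)) g x)%E.
  by move=> mg g0; exact: (ge0_integral_mrestr leb (mC k) mg g0).
pose m' := mscale (NngNum q0)
  (measure_function_pushforward__canonical__measure_function_Measure
     (mrestr mu mE) mXX).
have m'E A B : measurable A -> measurable B -> m' (A `*` B) = (l i A * l j B)%E.
  move=> mA mB; rewrite /m' /mscale/= /pushforward /mrestr setIC.
  have := @assignment_points sigma
    (fun k => if k == i then A else if k == j then B else setT).
  rewrite (_ : [set w | _] = (fun w => (X i w, X j w)) @^-1` (A `*` B)); last first.
    apply/seteqP; split => w /=.
      move=> h; split; first by have := h i; rewrite eqxx.
      by have := h j; rewrite eq_sym (negPf ij) eqxx.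
    by move=> [wA wB] k; case: eqP => [->//|_]; case: eqP => [->//|].
  move=> ->; last by move=> k; case: ifP => // _; case: ifP.
  rewrite muleA -EFinM mulVf ?gt_eqF// mul1e.
  rewrite (bigD1 i)//= eqxx (bigD1 j)/=; last by rewrite eq_sym.
  rewrite eq_sym (negPf ij) eqxx big1 ?mule1; last first.
    by move=> k /andP[/negPf -> /negPf ->]; rewrite setIT mu_cell.
  by rewrite /l/= /mfrestr /mrestr setIC (setIC B).
have H := @product_measure_unique _ _ _ _ R (l i) (l j) m' m'E.
have : (\int[m']_z f z = p^-1%:E *
    \int[mu]_(w in assignment sigma) f (X i w, X j w))%E.
  rewrite ge0_integral_mscale//; congr (_ * _)%E.
  rewrite ge0_integral_pushforward//=.
  by rewrite ge0_integral_mrestr//; exact: (measurableT_comp mf mXX).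
have -> : (\int[m']_z f z = \int[leb]_(x in cell n (sigma i))
    \int[leb]_(y in cell n (sigma j)) f (x, y))%E.
  rewrite -(@eq_measure_integral _ _ _ _ m' (l i \x l j)%E)//; last first.
    by move=> A mA _; exact: H.
  rewrite fubini_tonelli1//.
  have mF := @measurable_fun_fubini_tonelli_F _ _ (measurableTypeR R)
    (measurableTypeR R) R (l j) f mf f0.
  have F0 x : (0 <= fubini_F (l j) f x)%E by apply: integral_ge0.
  apply: (etrans (lE i _ mF F0)); apply: eq_integral => x _.
  apply: (lE j (fun y => f (x, y))) => //.
  exact: (measurableT_comp mf (pair1_measurable x)).
move=> ->; rewrite muleA -EFinM mulfV ?mul1e// gt_eqF//.
Qed.

End assignment.

(** * The partition function *)

Section cell_energy.
Context {R : realType} (a : R) (a1 : 1 <= a) (n : nat).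
Local Notation leb := (@lebesgue_measure R).

Definition cell_energy (k l : nat) : \bar R :=
  (\int[leb]_(y in cell n k) \int[leb]_(z in cell n l) (`|y - z| `^ a)%:E)%E.

Lemma cell_energy_ge0 k l : (0 <= cell_energy k l)%E.
Proof. by apply: integral_ge0 => y _; apply: integral_ge0 => z _. Qed.

Lemma background_potential_cells :
  (\sum_(k < n) \int[leb]_(y in cell n k) (background_potential a n y)%:E =
    (background_energy a n)%:E)%E.
Proof.
rewrite -background_energyE// box_cells//.
- by apply/measurable_EFinP; exact: measurable_background_potential.
- by move=> y; rewrite lee_fin background_potential_ge0.
Qed.

Lemma measurable_cell_potential l : measurable_fun setT
  (fun y : R => \int[leb]_(z in cell n l) (`|y - z| `^ a)%:E)%E.
Proof.
have mc := @measurable_cell R n l.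
under eq_fun => y do rewrite integral_mkcond.
apply: (@measurable_fun_fubini_tonelli_F _ _ R (measurableTypeR R) _ leb
  (fun w => ((fun z => (`|w.1 - z| `^ a)%:E) \_ (cell n l)) w.2)).
  rewrite (_ : (fun _ => _) = fun w : R * measurableTypeR R =>
    (`|w.1 - w.2| `^ a * \1_(cell n l) w.2)%:E); last first.
    by apply/funext => w; rewrite patchE indicE; case: ifP; rewrite ?mulr1 ?mulr0.
  apply/measurable_EFinP; apply: measurable_funM.
    exact: measurable_dist_powR.
  by apply: measurableT_comp => //; exact: measurable_indic.
by move=> w; rewrite patchE; case: ifP.
Qed.

Lemma background_energy_cells :
  (\sum_(k < n) \sum_(l < n) cell_energy k l = (background_energy a n)%:E)%E.
Proof.
rewrite -background_potential_cells; apply: eq_bigr => k _.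
have mE y : measurable_fun setT (fun z : R => (`|y - z| `^ a)%:E).
  by apply/measurable_EFinP; exact: measurable_dist_powR1.
rewrite /cell_energy -ge0_integral_sum//.
- apply: eq_integral => y _.
  by rewrite -background_potentialE// box_cells.
- exact: measurable_cell.
- by move=> l; exact: (measurable_funTS (measurable_cell_potential l)).
- by move=> l y _; apply: integral_ge0.
Qed.

(** Two points of a unit cell are within distance 1. *)
Lemma cell_energy_diag k : (cell_energy k k <= 1)%E.
Proof.
have mc := @measurable_cell R n k.
have le1 y : cell n k y -> (\int[leb]_(z in cell n k) (`|y - z| `^ a)%:E <= 1)%E.
  move=> yk.
  rewrite -(mu_cell n k) -[leRHS]mul1e -(integral_cst leb mc).
  apply: ge0_le_integral => //.
  - by apply/measurable_EFinP/measurable_funTS; exact: measurable_dist_powR1.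
  - move=> z zk; rewrite lee_fin /=.
    have d1 := cell_dist yk zk.
    have a0 : 0 <= a := le_trans ler01 a1.
    have -> : 1 = (1 : R) `^ a by rewrite powR1.
    by apply: ge0_ler_powR; rewrite ?nnegrE.
apply: (@le_trans _ _ (\int[leb]_(y in cell n k) cst 1 y)%E); last first.
  by rewrite integral_cst// mul1e [X in (X <= _)%E]mu_cell.
apply: ge0_le_integral => //.
- by move=> y _; exact: integral_ge0.
- exact: (measurable_funTS (measurable_cell_potential k)).
Qed.

End cell_energy.

(** The double sum over cells, seen from the particles that [sigma] puts there. *)
Lemma sum_perm_diag (V : nmodType) n (sigma : {perm 'I_n})
    (F : 'I_n -> 'I_n -> V) : \sum_k \sum_l F k l =
  \sum_i (\sum_(j < n | j != i) F (sigma i) (sigma j) + F (sigma i) (sigma i)).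
Proof.
rewrite (reindex_inj (@perm_inj _ sigma)); apply: eq_bigr => i _.
by rewrite (reindex_inj (@perm_inj _ sigma)) (bigD1 i)//= addrC.
Qed.

(** Integrates a tangent line to the exponential while keeping all integrands
    nonnegative. *)
Lemma integral_ge_linear d (T : measurableType d) {R : realType}
    (mu : {measure set T -> \bar R}) (E : set T) (B V S : T -> R)
    (p v s r k l : R) :
  measurable E -> mu E = p%:E -> (\int[mu]_(w in E) (V w)%:E = v%:E)%E ->
  (s%:E <= \int[mu]_(w in E) (S w)%:E)%E ->
  measurable_fun setT B -> measurable_fun setT V -> measurable_fun setT S ->
  (forall w, 0 <= B w) -> (forall w, 0 <= V w) -> (forall w, 0 <= S w) ->
  0 <= r -> 0 <= k -> 0 <= l ->
  (forall w, r + l * S w <= B w + k * V w) ->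
  ((r * p + l * s - k * v)%:E <= \int[mu]_(w in E) (B w)%:E)%E.
Proof.
move=> mE muE Vv Ss mB mV mS B0 V0 S0 r0 k0 l0 BVS.
have mEF (f : T -> R) : measurable_fun setT f -> measurable_fun E (EFin \o f).
  by move=> mf; apply/measurable_EFinP; exact: measurable_funTS.
have intZ (x : R) (f : T -> R) : 0 <= x -> measurable_fun setT f -> (forall w, 0 <= f w) ->
    (\int[mu]_(w in E) (x * f w)%:E = x%:E * \int[mu]_(w in E) (f w)%:E)%E.
  move=> x0 mf f0; under eq_integral do rewrite EFinM.
  have fE z : E z -> (0 <= (EFin \o f) z)%E by rewrite lee_fin.
  exact: (ge0_integralZl_EFin mu mE fE (mEF _ mf) x0).
have intD (f g : T -> R) : measurable_fun setT f -> measurable_fun setT g ->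
    (forall w, 0 <= f w) -> (forall w, 0 <= g w) ->
    (\int[mu]_(w in E) (f w + g w)%:E =
     \int[mu]_(w in E) (f w)%:E + \int[mu]_(w in E) (g w)%:E)%E.
  move=> mf mg f0 g0; under eq_integral do rewrite EFinD.
  have fE z : E z -> (0 <= (EFin \o f) z)%E by rewrite lee_fin.
  have gE z : E z -> (0 <= (EFin \o g) z)%E by rewrite lee_fin.
  exact: (ge0_integralD mu mE fE (mEF _ mf) gE (mEF _ mg)).
have mkV : measurable_fun setT (fun w => k * V w) by exact: measurable_funM.
have mlS : measurable_fun setT (fun w => l * S w) by exact: measurable_funM.
have kV0 w : 0 <= k * V w by rewrite mulr_ge0.
have lS0 w : 0 <= l * S w by rewrite mulr_ge0.
have : (\int[mu]_(w in E) (r + l * S w)%:E <= \int[mu]_(w in E) (B w + k * V w)%:E)%E.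
  apply: ge0_le_integral => //.
  - by move=> w _; rewrite lee_fin addr_ge0.
  - by apply: (mEF (fun w => r + l * S w)); exact: measurable_funD.
  - by apply: (mEF (fun w => B w + k * V w)); exact: measurable_funD.
  - by move=> w _; rewrite lee_fin.
rewrite (intD (cst r))// intZ// intD// intZ// Vv (integral_cst mu mE r%:E) muE => h.
rewrite EFinB leeBlDr// EFinD !EFinM.
by apply: le_trans h; rewrite leeD2l// lee_wpmul2l.
Qed.

Section partition_function.
Context {R : realType} (n : nat) (n0 : (0 < n)%N) (a beta : R).
Hypotheses (a1 : 1 <= a) (beta0 : 0 < beta).
Local Notation leb := (@lebesgue_measure R).
Context d (Omega : measurableType d) (mu : probability Omega R).
Variable X : 'I_n -> {mfun Omega >-> R}.
Hypothesis indepX : independent mu (fun i => g_sigma_algebra_preimage (X i)).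
Hypothesis unifX :
  forall i, same_law (distribution mu (X i)) (uniform_prob (box_lt R n0)).

Local Notation p := ((n%:R : R) ^- n).
Local Notation c := (beta * n%:R / 2).
Let e := background_energy a n.
Let V w := \sum_(i < n) background_potential a n (X i w).
Let S w := \sum_(i < n) \sum_(j < n) `|X i w - X j w| `^ a.
Let H w := point_energy a (fun i => X i w).

Let mX i : measurable_fun setT (X i). Proof. exact: measurable_funP. Qed.

Let mV : measurable_fun setT V.
Proof.
apply: measurable_sum => i.
exact: (measurableT_comp (@measurable_background_potential R a n) (mX i)).
Qed.

Let mXX i j : measurable_fun setT (fun w => `|X i w - X j w| `^ a).
Proof.
apply: (measurableT_comp (measurable_powR a)).
by apply: (measurableT_comp (@normr_measurable R setT)); exact: measurable_funB.
Qed.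

Let mS : measurable_fun setT S.
Proof.
by apply: measurable_sum => i; apply: measurable_sum => j; exact: mXX.
Qed.

Lemma measurable_point_energy : measurable_fun setT H.
Proof.
apply: measurable_funB => //; apply: measurable_funM => //.
by apply: measurable_funD => //; exact: mS.
Qed.

Let V0 w : 0 <= V w.
Proof. by apply: sumr_ge0 => i _; exact: background_potential_ge0. Qed.

Let S0 w : 0 <= S w.
Proof. by apply: sumr_ge0 => i _; apply: sumr_ge0 => j _; exact: powR_ge0. Qed.

Let mE := measurable_assignment X.

Let integral_V sigma :
  (\int[mu]_(w in assignment X sigma) (V w)%:E = (p * e)%:E)%E.
Proof.
rewrite /V; under eq_integral do rewrite -sumEFin.
have mb : measurable_fun setT (fun y : R => (background_potential a n y)%:E).
  by apply/measurable_EFinP; exact: measurable_background_potential.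
rewrite ge0_integral_sum//; last 2 first.
- move=> i; apply: measurable_funTS.
  exact: (measurableT_comp mb (mX i)).
- by move=> i w _; rewrite lee_fin background_potential_ge0.
rewrite EFinM -background_potential_cells// ge0_sume_distrr//; last first.
  move=> i _; apply: integral_ge0 => y _.
  by rewrite lee_fin background_potential_ge0.
rewrite [RHS](reindex_inj (@perm_inj _ sigma)); apply: eq_bigr => i _.
rewrite (assignment_integral1 indepX unifX sigma i mb)// => y.
by rewrite lee_fin background_potential_ge0.
Qed.

(** Distinct particles interact as their cells do, so that only the
    self-interaction of the [n] cells is missing from the background energy. *)
Let integral_S sigma :
  ((p * (e - n%:R))%:E <= \int[mu]_(w in assignment X sigma) (S w)%:E)%E.
Proof.
have a0 : a != 0 by rewrite gt_eqF// (lt_le_trans ltr01).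
have p0 : 0 <= p by rewrite invr_ge0 exprn_ge0.
have md : measurable_fun setT (fun z : R * R => (`|z.1 - z.2| `^ a)%:E).
  by apply/measurable_EFinP; exact: measurable_dist_powR.
have mXXE i j : measurable_fun setT (fun w => (`|X i w - X j w| `^ a)%:E).
  by apply/measurable_EFinP; exact: mXX.
have -> : (\int[mu]_(w in assignment X sigma) (S w)%:E = p%:E *
    \sum_(i < n) \sum_(j < n | j != i) cell_energy a n (sigma i) (sigma j))%E.
  rewrite /S; under eq_integral do rewrite -sumEFin.
  rewrite ge0_integral_sum//; last 2 first.
  - move=> i; apply/measurable_EFinP/measurable_funTS; apply: measurable_sum => j.
    exact: mXX.
  - by move=> i w _; rewrite lee_fin; apply: sumr_ge0 => j _; exact: powR_ge0.
  rewrite ge0_sume_distrr//; last first.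
    by move=> i _; apply: sume_ge0 => j _; exact: cell_energy_ge0.
  apply: eq_bigr => i _; under eq_integral do rewrite -sumEFin.
  rewrite ge0_integral_sum//; last by move=> j; exact: measurable_funTS.
  rewrite ge0_sume_distrr//; last by move=> j _; exact: cell_energy_ge0.
  rewrite (bigD1 i)//= integral0_eq ?add0e; last first.
    by move=> w _; rewrite subrr normr0 powR0.
  apply: eq_bigr => j ji.
  rewrite (assignment_integral2 indepX unifX sigma _ md)//.
  by rewrite eq_sym.
rewrite EFinM lee_wpmul2l// EFinB leeBlDr//.
rewrite /e -background_energy_cells//.
move: (cell_energy a n) (@cell_energy_diag R a a1 n) => F Fdiag.
rewrite (sum_perm_diag sigma (fun k l => F k l)).
rewrite (_ : (n%:R)%:E = \sum_(i < n) (1 : \bar R))%E; last first.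
  by rewrite sumEFin sumr_const card_ord.
rewrite -big_split/=; apply: lee_sum => i _.
by rewrite leeD2l// Fdiag.
Qed.

(** Jensen's inequality on the event that each cell contains exactly one
    particle: the mean energy there is at most [n / 2], because the cells carry
    the same mass as the background and only the self-interaction of the cells
    survives. *)
Lemma assignment_weight sigma : ((expR (- c) * p)%:E <=
  \int[mu]_(w in assignment X sigma) (expR (- (beta * H w)))%:E)%E.
Proof.
have p0 : 0 <= p by rewrite invr_ge0 exprn_ge0.
have c0 : 0 <= c by rewrite divr_ge0// mulr_ge0// ltW.
have e0 : 0 <= e by apply: Rintegral_ge0 => // y _; exact: background_potential_ge0.
have mb : measurable_fun setT (fun w => expR (- (beta * H w))).
  apply: (measurableT_comp (@measurable_expR R)).
  apply: (measurableT_comp (@oppr_measurable R setT)).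
  by apply: measurable_funM => //; exact: measurable_point_energy.
have -> : expR (- c) * p = expR (- c) * (1 + c + beta / 2 * e) * p +
   expR (- c) * (beta / 2) * (p * (e - n%:R)) - expR (- c) * beta * (p * e).
  by move: (expR _) ((n%:R ^+ n)^-1) => k q; field.
apply: (@integral_ge_linear _ _ _ mu _ _ V S p (p * e) (p * (e - n%:R))) => //.
- exact: assignment_prob.
- by rewrite mulr_ge0 ?expR_ge0// !addr_ge0// !mulr_ge0// ltW.
- by rewrite !mulr_ge0 ?expR_ge0// ltW.
- by rewrite !mulr_ge0 ?expR_ge0// ltW.
- move=> w.
  have -> : - (beta * H w) = - c + (c - beta * H w) by ring.
  rewrite expRD.
  apply: (@le_trans _ _ (expR (- c) * (1 + (c - beta * H w)) + expR (- c) * beta * V w)).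
    rewrite /H /point_energy -/(V w) -/(S w) -/e le_eqVlt; apply/orP; left; apply/eqP.
    by field.
  by rewrite lerD2r ler_wpM2l ?expR_ge0// expR_ge1Dx.
Qed.

(** The [n`!] assignments are disjoint and each has probability [n ^- n], which
    costs at most [expR (- n)]. *)
Lemma partition_function_ge : ((expR (- ((1 + beta / 2) * n%:R)))%:E <=
  \int[mu]_w (expR (- (beta * H w)))%:E)%E.
Proof.
have mb : measurable_fun setT (fun w => (expR (- (beta * H w)))%:E).
  apply/measurable_EFinP; apply: (measurableT_comp (@measurable_expR R)).
  apply: (measurableT_comp (@oppr_measurable R setT)).
  by apply: measurable_funM => //; exact: measurable_point_energy.
pose D := \big[setU/set0]_(sigma <- index_enum {perm 'I_n}) assignment X sigma.
have mD : measurable D.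
  by apply: bigsetU_measurable => sigma _; exact: mE.
apply: (@le_trans _ _ (\int[mu]_(w in D) (expR (- (beta * H w)))%:E)%E); last first.
  apply: ge0_subset_integral => //.
rewrite ge0_integral_bigsetU//; last 3 first.
- exact: index_enum_uniq.
- move=> sigma tau _ _ [w [ws wt]]; exact: assignment_inj ws wt.
- exact: measurable_funTS.
apply: (@le_trans _ _ (\sum_(sigma : {perm 'I_n}) (expR (- c) * p)%:E)%E); last first.
  by apply: lee_sum => sigma _; exact: assignment_weight.
rewrite sumEFin lee_fin sumr_const card_Sn -[leRHS]mulr_natl.
rewrite (_ : - _ = - c + - n%:R); last by field.
rewrite expRD mulrCA ler_wpM2l ?expR_ge0//.
rewrite expRN -[leRHS]invrK lef_pV2 ?posrE ?expR_gt0//; last first.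
  by rewrite invr_gt0 mulr_gt0// ?ltr0n ?fact_gt0// invr_gt0 exprn_gt0// ltr0n.
rewrite invfM invrK mulrC.
have := expR_ge1Dxn n.-1 (ler0n R n).
by rewrite prednK//; apply: le_trans; rewrite lerDr.
Qed.

End partition_function.

(** * The finite gas has small discrepancy *)

Section finite_gas.
Context {R : realType}.
Local Notation leb := (@lebesgue_measure R).

(** Since the energy dominates the integrated square [y] of the discrepancy, a
    configuration has Boltzmann weight at most [expR (- l * y)] up to constants,
    while the partition function is at least exponentially small in [n]; so
    only [y] of order [n] matters. *)
Lemma finite_riesz_discr (s beta : R) : -2 < s <= -1 -> 0 < beta ->
  exists2 C : R, 0 < C &
  forall (n : nat) (n0 : (0 < n)%N) (Q : probability (config R) R),
    is_finite_riesz_law n0 s beta Q ->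
    Q [set g | g (~` box n) = 0%E] = 1%E /\
    (\int[Q]_g \int[leb]_(v in box n) (box_discr n g v ^+ 2)%:E <=
      (C * n%:R)%:E)%E.
Proof.
move=> /andP[s2 s1] beta0.
have a12 : 1 <= - s < 2 by rewrite lerNr s1 ltrNl s2.
have a1 : 1 <= - s by case/andP: a12.
have [C C0 hC] := discr_le_energy a12.
pose l := beta / C; have l0 : 0 < l by rewrite divr_gt0.
exists (2 + (1 + beta / 2) / l + l^-1).
  by rewrite !addr_gt0 ?divr_gt0 ?invr_gt0 ?addr_gt0 ?divr_gt0.
move=> n n0 Q [Bin [binQ QE]].
case: binQ => d [T [mu [X [xi [indepX unifX xiE BinE]]]]].
have mb := @measurable_box R n.
have mbolt : measurable_fun setT (fun g => boltzmann n s beta g).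
  apply/measurable_EFinP; apply: (measurableT_comp (@measurable_expR R)).
  apply: (measurableT_comp (@oppr_measurable R setT)).
  by apply: measurable_funM => //; exact: measurable_riesz_energy.
have bolt0 g : (0 <= boltzmann n s beta g)%E by rewrite lee_fin expR_ge0.
have intBin (f : config R -> \bar R) : measurable_fun setT f ->
    (forall g, 0 <= f g)%E -> (\int[Bin]_g f g = \int[mu]_w f (xi w))%E.
  move=> mf f0; rewrite -(ge0_integral_distribution xi mf f0).
  by apply: eq_measure_integral => A mA _; apply/esym; exact: BinE.
(* almost surely all the particles are in the box *)
pose O0 := [set w | forall i, box n (X i w)].
have mO0 : measurable O0 by exact: (measurable_points X (B := fun=> box n)).
have muO0 : mu O0 = 1%E.
  rewrite (independent_points indepX unifX (B := fun=> box n))//.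
  rewrite big1// => i _; rewrite uniform_cell// mu_box -EFinM mulVf//.
  by rewrite pnatr_eq0 -lt0n.
have muO0c : mu (~` O0) = 0%E by rewrite probability_setC// muO0 subee.
have aeO0 : {ae mu, forall w, O0 w}.
  exists (~` O0); split => //; exact: measurableC.
have energyE w : O0 w -> riesz_energy n s (xi w) = point_energy (- s) (fun i => X i w).
  by move=> Ow; apply: riesz_energy_points => //; exact: xiE.
pose Z := (\int[Bin]_g boltzmann n s beta g)%E.
have Z_ge : ((expR (- ((1 + beta / 2) * n%:R)))%:E <= Z)%E.
  rewrite /Z intBin//.
  apply: le_trans (partition_function_ge a1 beta0 indepX unifX) _.
  apply: ae_ge0_le_integral => //.
  - apply/measurable_EFinP; apply: (measurableT_comp (@measurable_expR R)).
    apply: (measurableT_comp (@oppr_measurable R setT)).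
    by apply: measurable_funM => //; exact: measurable_point_energy.
  - exact: (measurableT_comp mbolt).
  - apply: filterS aeO0 => w Ow _; rewrite /boltzmann energyE//.
have [z Zz] : exists z, Z = z%:E.
  have := QE _ measurableT; rewrite probability_setT -/Z.
  move: Z_ge; case: (Z) => [z _ _|_|//]; first by exists z.
  by rewrite invey mule0 => /eqP; rewrite onee_eq0.
have z_ge : expR (- ((1 + beta / 2) * n%:R)) <= z by rewrite -lee_fin -Zz.
have z0 : 0 < z := lt_le_trans (expR_gt0 _) z_ge.
pose h g := (boltzmann n s beta g * (z^-1)%:E)%E.
have mh : measurable_fun setT h by exact: emeasurable_funM.
have mhxi : measurable_fun setT (fun w => h (xi w)).
  exact: (measurableT_comp mh (measurable_funP xi)).
have h0 g : (0 <= h g)%E by rewrite mule_ge0// lee_fin invr_ge0 ltW.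
have QEh A : measurable A -> (Q A = \int[Bin]_(g in A) h g)%E.
  move=> mA; rewrite QE// -/Z Zz /h ge0_integralZr//.
  - by rewrite inver gt_eqF.
  - exact: measurable_funTS.
  - by rewrite lee_fin invr_ge0 ltW.
have int_h : (\int[Bin]_g h g = 1)%E by rewrite -QEh// probability_setT.
split.
  pose A := [set g : config R | g (~` box n) = 0%E].
  have mA : measurable A.
    have := measurable_config_ev (measurableC mb) measurableT
      (emeasurable_set1 (0%E : \bar R)).
    by rewrite setTI.
  have BinA : Bin (~` A) = 0%E.
    rewrite -BinE; last exact: measurableC.
    apply: (@subset_measure0 _ _ _ mu _ (~` O0)) => //.
    - rewrite -[X in measurable X]setTI; apply: measurable_funP => //.
      exact: measurableC.
    - exact: measurableC.
    - move=> w nA Ow; apply: nA; rewrite /A/= xiE; last exact: measurableC.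
      by apply: big1 => i _; rewrite diracE memNset// => /(_ (Ow i)).
  have : Q (~` A) = 0%E.
    rewrite QEh; last exact: measurableC.
    exact: (null_set_integral (measurableC mA) (measurable_funTS mh) BinA).
  rewrite probability_setC// => /eqP; rewrite sube_eq ?fin_num_measure//.
  by rewrite add0e => /eqP <-.
pose D2 g := (\int[leb]_(v in box n) (box_discr n g v ^+ 2)%:E)%E.
have mD2 : measurable_fun setT D2 by exact: measurable_box_discr_integral.
have D20 g : (0 <= D2 g)%E by apply: integral_ge0 => v _; rewrite lee_fin sqr_ge0.
rewrite (ge0_integral_density mh h0 QEh mD2 D20) intBin; last 2 first.
- exact: (emeasurable_funM mD2 mh).
- by move=> g; exact: mule_ge0 (D20 g) (h0 g).
(* beyond the level t the Boltzmann weight beats the partition function *)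
pose t := 2 * n%:R + (1 + beta / 2) * n%:R / l.
have t0 : 0 <= t by rewrite addr_ge0 ?mulr_ge0 ?invr_ge0 ?addr_ge0 ?divr_ge0// ltW.
apply: (@le_trans _ _ (\int[mu]_w (t%:E * h (xi w) + (l^-1)%:E))%E).
  apply: ae_ge0_le_integral => //.
  - by move=> w _; rewrite mule_ge0.
  - apply: emeasurable_funM; [exact: (measurableT_comp mD2)|exact: mhxi].
  - by move=> w _; rewrite adde_ge0// ?mule_ge0// lee_fin invr_ge0 ltW.
  - exact: (emeasurable_funD (emeasurable_funM (measurable_cst _) mhxi)
      (measurable_cst _)).
  apply: filterS aeO0 => w Ow _.
  set H := point_energy (- s) (fun i => X i w).
  have D2le : (D2 (xi w) <= (C * H + 2 * n%:R)%:E)%E.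
    apply: le_trans (hC n n0 (fun i => X i w)).
    rewrite le_eqVlt; apply/orP; left; apply/eqP.
    apply: eq_integral => v; rewrite inE => vb.
    by rewrite (discr_points (xiE w)).
  rewrite /h /boltzmann energyE// -/H.
  set y := C * H + 2 * n%:R in D2le *.
  have hz : 0 <= expR (- (beta * H)) / z by rewrite divr_ge0 ?expR_ge0 ?ltW.
  apply: le_trans (lee_wpmul2r _ D2le) _; first by rewrite -EFinM lee_fin.
  rewrite -!EFinM -EFinD lee_fin.
  (* the excess over t is paid for by the Boltzmann factor *)
  have yt : y <= t + l^-1 * expR (l * (y - t)).
    have := expR_ge1Dx (l * (y - t)) => /(ler_wpM2l (ltW (_ : 0 < l^-1))).
    rewrite invr_gt0 => /(_ l0).
    rewrite mulrDr mulr1 mulrA mulVf ?gt_eqF// mul1r => yt.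
    apply: le_trans (lerD (lexx t) yt); rewrite addrC -addrA subrK lerDr.
    by rewrite invr_ge0 ltW.
  apply: le_trans (ler_wpM2r hz yt) _.
  rewrite mulrDl lerD2l -mulrA; apply: ler_piMr; first by rewrite invr_ge0 ltW.
  rewrite mulrA -expRD ler_pdivrMr// mul1r; apply: le_trans z_ge.
  rewrite ler_expR le_eqVlt; apply/orP; left; apply/eqP.
  have C00 : C != 0 by rewrite gt_eqF.
  have b00 : beta != 0 by rewrite gt_eqF.
  by rewrite /y /t /l; field; rewrite C00.
rewrite ge0_integralD//; last 3 first.
- by move=> w _; rewrite mule_ge0.
- exact: (emeasurable_funM (measurable_cst _) mhxi).
- by move=> w _; rewrite lee_fin invr_ge0 ltW.
rewrite (ge0_integralZl_EFin mu measurableT (fun w _ => h0 (xi w)) mhxi t0).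
rewrite -intBin// int_h mule1 (integral_cst mu measurableT (l^-1)%:E).
rewrite [X in (_ + _ * X)%E](probability_setT mu) mule1 -EFinD lee_fin.
have n1 : 1 <= n%:R :> R by rewrite ler1n.
have l00 : l != 0 by rewrite gt_eqF.
rewrite [leRHS]mulrDl; apply: lerD.
  by rewrite /t le_eqVlt; apply/orP; left; apply/eqP; field.
by rewrite ler_peMr// invr_ge0 ltW.
Qed.

End finite_gas.

(** * Local limits of stationarized gases *)

Lemma int_neq0 (k : int) : k != 0 -> 1 <= k \/ k <= -1.
Proof.
have [k0 _|k0 _|->] // := ltgtP k 0; [right|left; by rewrite -gtz0_ge1].
by rewrite -ltzD1 addNr.
Qed.

Lemma ae_probability1 d (T : measurableType d) {R : realType}
    (mu : probability T R) (A : set T) :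
  measurable A -> mu A = 1%E -> {ae mu, forall w, A w}.
Proof.
move=> mA A1; exists (~` A); split => //; first exact: measurableC.
by rewrite probability_setC// A1 subee.
Qed.

Lemma probability_integral_cst d (T : measurableType d) {R : realType}
    (mu : probability T R) (c : R) : (\int[mu]_x c%:E = c%:E)%E.
Proof.
by rewrite (integral_cst mu measurableT c%:E) [X in (_ * X)%E](probability_setT mu) mule1.
Qed.

Lemma probability_integral_le d (T : measurableType d) {R : realType}
    (mu : probability T R) (f : T -> \bar R) (c : R) :
  measurable_fun setT f -> (forall x, 0 <= f x <= c%:E)%E ->
  (\int[mu]_x f x <= c%:E)%E.
Proof.
move=> mf fc; rewrite -(probability_integral_cst mu c).
apply: ge0_le_integral => //.
- by move=> x _; case/andP: (fc x).
- by move=> x _; case/andP: (fc x).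
Qed.

Lemma integral_independent_pair d d1 d2 (T : measurableType d)
    (T1 : measurableType d1) (T2 : measurableType d2) {R : realType}
    (mu : probability T R) (m1 : probability T1 R) (m2 : probability T2 R)
    (X : T -> T1) (Y : T -> T2) (f : T1 * T2 -> \bar R) :
  measurable_fun setT X -> measurable_fun setT Y ->
  (forall A B, measurable A -> measurable B ->
    mu (X @^-1` A `&` Y @^-1` B) = (m1 A * m2 B)%E) ->
  measurable_fun setT f -> (forall z, 0 <= f z)%E ->
  (\int[mu]_w f (X w, Y w) = \int[m1]_x \int[m2]_y f (x, y))%E.
Proof.
move=> mX mY muXY mf f0.
have mXY : measurable_fun setT (fun w => (X w, Y w)) by exact: measurable_fun_pair.
pose m' := measure_function_pushforward__canonical__measure_function_Measure mu mXY.
have m'E A B : measurable A -> measurable B -> m' (A `*` B) = (m1 A * m2 B)%E.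
  exact: muXY.
rewrite -(@fubini_tonelli1 _ _ T1 T2 R m1 m2 f mf f0).
rewrite (@eq_measure_integral _ _ _ setT m'); last first.
  by move=> A mA _; exact: (product_measure_unique m'E).
by rewrite ge0_integral_pushforward.
Qed.

Section stationarized.
Context {R : realType} (n : nat) (n0 : (0 < n)%N).
Local Notation leb := (@lebesgue_measure R).
Local Notation unif := (uniform_prob (box_lt R n0)).
Variables (Q P : probability (config R) R).
Hypothesis statP : is_stationarized (box_lt R n0) Q P.
Hypothesis suppQ : Q [set g | g (~` box n) = 0%E] = 1%E.

Definition local_on (K : R) T (F : config R -> T) := forall xi eta : config R,
  (forall A, measurable A -> A `<=` `[(- K), K]%classic -> xi A = eta A) ->
  F xi = F eta.

(** Only the tile containing the origin matters, up to the probability that the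
    origin is within [K] of the boundary of that tile. *)
Lemma stationarized_local (F : config R -> R) (K M : R) :
  measurable_fun setT F -> (forall g, 0 <= F g <= M) -> 0 <= K -> K *+ 2 < n%:R ->
  local_on K F ->
  let I := (\int[unif]_u \int[Q]_g (F (translate u g))%:E)%E in
  (\int[P]_g (F g)%:E <= I + (M * (K *+ 2 / n%:R))%:E)%E /\
  (I <= \int[P]_g (F g)%:E + (M * (K *+ 2 / n%:R))%:E)%E.
Proof.
move=> mF FM K0 Kn locF I.
case: statP => d [T [mu [U [xi [zeta [indep Uunif xiQ zetaE zetaP]]]]]].
have mb := @measurable_box R n.
have F0 g : 0 <= F g by case/andP: (FM g).
have FleM g : F g <= M by case/andP: (FM g).
have M0 : 0 <= M by apply: le_trans (FleM point).
have mFE : measurable_fun setT (fun g => (F g)%:E) by exact/measurable_EFinP.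
have mxi0 : measurable_fun setT (xi 0) by exact: measurable_funP.
have mU : measurable_fun setT (U : T -> measurableTypeR R) by exact: (measurable_funP U).
have n0R : 0 < n%:R :> R by rewrite ltr0n.
have nn : n%:R / 2 - - (n%:R / 2) = n%:R :> R by field.
have xi0Q B : measurable B -> mu (xi 0 @^-1` B) = Q B.
  move=> mB; rewrite -[LHS]/(distribution mu (xi 0) B) xiQ//.
  rewrite mul0r /translate_law /pushforward; congr (Q _).
  by apply/seteqP; split => g /=; rewrite translate0.
have mtr : measurable_fun setT (fun z : measurableTypeR R * config R => F (translate z.1 z.2)).
  apply: (measurableT_comp mF).
  exact: (@measurable_translate2 R _ (measurableTypeR R * config R)%type fst snd).
have mG : measurable_fun setT (fun w => F (translate (U w) (xi 0 w))).
  apply: (measurableT_comp mF); exact: measurable_translate2.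
have IE : (I = \int[mu]_w (F (translate (U w) (xi 0 w)))%:E)%E.
  apply/esym.
  apply: (@integral_independent_pair _ _ _ T (measurableTypeR R) (config R) R mu unif Q U (xi 0)
    (fun z => (F (translate z.1 z.2))%:E)) => //.
  - move=> A B mA mB.
    have := indep [:: None; Some 0] (fun o => if o is Some _ then xi 0 @^-1` B else U @^-1` A).
    rewrite (_ : \bigcap_(i in _) _ = U @^-1` A `&` xi 0 @^-1` B); last first.
      apply/seteqP; split => w /=; last first.
        by move=> [wA wB] [k|] //= ; rewrite !inE.
      by move=> h; split; [apply: (h None)|apply: (h (Some 0))]; rewrite /= !inE eqxx// orbT.
    move=> -> //.
    + rewrite big_cons big_seq1; congr (_ * _)%E; last exact: xi0Q.
      exact: Uunif.
    + move=> [k|]; last first.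
        by move=> _; exists A => //; rewrite setTI.
      by rewrite !inE/= => /eqP[->]; exists B => //; rewrite setTI.
  - exact/measurable_EFinP.
  - by move=> z; rewrite lee_fin.
pose Bad := U @^-1` (~` `](- (n%:R / 2) + K), (n%:R / 2 - K)[%classic).
have mBad : measurable Bad.
  rewrite -[Bad]setTI; apply: (measurable_funP U) => //.
  by apply: measurableC.
have muBad : mu Bad = (K *+ 2 / n%:R)%:E.
  rewrite [LHS](Uunif (~` _)); last exact: measurableC.
  have -> : unif (~` `](- (n%:R / 2) + K), (n%:R / 2 - K)[%classic) =
      (1 - (n%:R^-1)%:E * leb `](- (n%:R / 2) + K)%R, (n%:R / 2 - K)%R[%classic)%E.
    rewrite -(uniform_cell n0)//; first exact: (@probability_setC _ _ _ unif).
    by move=> x; rewrite /box/= !in_itv/= => /andP[x1 x2]; apply/andP; split; lra.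
  rewrite [X in (_ * X)%E]lebesgue_measure_itv/= lte_fin ifT; last by lra.
  change ((1 - n%:R^-1 * (n%:R / 2 - K + - (- (n%:R / 2) + K)))%:E =
    (K *+ 2 / n%:R)%:E); congr _%:E; rewrite mulr2n; field.
  by rewrite gt_eqF.
pose tile (k : int) : set R := (fun y => y + - (k%:~R * n%:R)) @^-1` box n.
have mtile k : measurable (tile k).
  by rewrite -[X in measurable X]setTI; apply: measurable_funD.
have suppk k : {ae mu, forall w, xi k w (~` tile k) = 0%E}.
  pose E := [set g : config R | g (~` tile k) = 0%E].
  have mE : measurable E.
    have := measurable_config_ev (measurableC (mtile k)) measurableT
      (emeasurable_set1 (0%E : \bar R)).
    by rewrite setTI.
  apply: (@ae_probability1 _ T R mu (xi k @^-1` E)).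
    by rewrite -[X in measurable X]setTI; exact: (measurable_funP (xi k)).
  rewrite -[LHS]/(distribution mu (xi k) E) xiQ// -suppQ.
  rewrite /translate_law /pushforward; congr (Q _).
  apply/seteqP; split => g; rewrite /E/= /translate_measure /pushforward nn;
    by rewrite (_ : _ @^-1` _ = ~` box n)//; apply/seteqP; split => y;
      rewrite /tile/= addrK.
have supp : {ae mu, forall w, forall k, xi k w (~` tile k) = 0%E}.
  have p1 := ae_foralln (fun k : nat => suppk (Posz k)).
  have p2 := ae_foralln (fun k : nat => suppk (Negz k)).
  by apply: filterS2 p1 p2 => w h1 h2 [k|k].
have good : {ae mu, forall w, ~ Bad w -> F (zeta w) = F (translate (U w) (xi 0 w))}.
  apply: filterS2 supp zetaE => w sw zw /contrapT; rewrite /= in_itv/= => /andP[U1 U2].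
  apply: locF => A mA AK.
  rewrite zw// (esumID [set 0%Z])// setTI esum_set1// esum1 ?adde0// => k [_ /eqP k0].
  apply: (@subset_measure0 _ _ _ (config_measure (xi k w))
    ((fun y => y + U w) @^-1` A) (~` tile k)); last exact: sw.
  - by rewrite -[X in measurable X]setTI; exact: measurable_shift.
  - exact: measurableC.
  move=> y /= /AK; rewrite /tile/box/= !in_itv/= => /andP[y1 y2] /andP[y3 y4].
  have [k1|k1] := int_neq0 k0.
    have : 1 * n%:R <= k%:~R * n%:R :> R by rewrite ler_wpM2r// -[1]/(1%:~R) ler_int.
    lra.
  have : k%:~R * n%:R <= (-1) * n%:R :> R by rewrite ler_wpM2r// -[-1]/((-1)%:~R) ler_int.
  lra.
have intP : (\int[P]_g (F g)%:E = \int[mu]_w (F (zeta w))%:E)%E.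
  rewrite -(ge0_integral_distribution zeta mFE)//.
  by apply: eq_measure_integral => A mA _; apply/esym; exact: zetaP.
have mz : measurable_fun setT (fun w => F (zeta w)) by exact: measurableT_comp.
have key (f g : T -> R) : measurable_fun setT f -> measurable_fun setT g ->
    (forall w, 0 <= f w <= M) -> (forall w, 0 <= g w <= M) ->
    {ae mu, forall w, ~ Bad w -> f w = g w} ->
    (\int[mu]_w (f w)%:E <= \int[mu]_w (g w)%:E + (M * (K *+ 2 / n%:R))%:E)%E.
  move=> mf mg fM gM fg.
  have -> : ((M * (K *+ 2 / n%:R))%:E = \int[mu]_w (M%:E * (\1_Bad w)%:E))%E.
    rewrite (ge0_integralZl_EFin mu measurableT _ _ M0)//; last first.
      by apply/measurable_EFinP; exact: measurable_indic.
    rewrite integral_indic// setIT EFinM; congr (_ * _)%E; exact/esym/muBad.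
  rewrite -ge0_integralD//.
  - apply: ae_ge0_le_integral => //.
    + by move=> w _; rewrite lee_fin; case/andP: (fM w).
    + exact/measurable_EFinP.
    + move=> w _; rewrite adde_ge0//; first by rewrite lee_fin; case/andP: (gM w).
      by rewrite mule_ge0// lee_fin.
    + apply: emeasurable_funD; first exact/measurable_EFinP.
      apply: emeasurable_funM => //; apply/measurable_EFinP; exact: measurable_indic.
    + apply: filterS fg => w fgw _; rewrite indicE.
      have [wB|/negP wB] := boolP (w \in Bad).
        rewrite mule1 -EFinD lee_fin; have /andP[_ fw] := fM w; have /andP[gw _] := gM w.
        by rewrite (le_trans fw)// lerDr.
      by rewrite mule0 adde0 fgw// => wB'; apply: wB; rewrite inE.
  - by move=> w _; rewrite lee_fin; case/andP: (gM w).
  - exact/measurable_EFinP.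
  - by move=> w _; rewrite mule_ge0// lee_fin.
  - apply: emeasurable_funM => //; apply/measurable_EFinP; exact: measurable_indic.
rewrite IE intP; split; apply: key => //.
by apply: filterS good => w h /h ->.
Qed.

End stationarized.

Section box_shift.
Context {R : realType}.
Local Notation leb := (@lebesgue_measure R).

Lemma integral_indic_mul d (T : measurableType d) (mu : {measure set T -> \bar R})
    (A : set T) (f : T -> \bar R) :
  (\int[mu]_x ((\1_A x)%:E * f x) = \int[mu]_(x in A) f x)%E.
Proof.
rewrite [RHS]integral_mkcond; apply: eq_integral => x _.
by rewrite patchE indicE; case: ifP; rewrite ?mul1e ?mul0e.
Qed.

(** A box and its translate differ by a set of measure [`|x|] on either side. *)
Lemma box_shift (n : nat) (x M : R) (G : R -> \bar R) :
  measurable_fun setT G -> (forall u, 0 <= G u <= M%:E)%E ->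
  (\int[leb]_(u in box n) G (u + x)%R <=
   \int[leb]_(u in box n) G u + (M * `|x|)%:E)%E.
Proof.
move=> mG GM.
have G0 u : (0 <= G u)%E by case/andP: (GM u).
have GleM u : (G u <= M%:E)%E by case/andP: (GM u).
have M0 : 0 <= M by rewrite -lee_fin (le_trans (G0 0)).
have mb := @measurable_box R n.
have m1 : measurable_fun setT (fun u : R => (\1_(@box R n) u : R)%:E).
  by apply/measurable_EFinP; exact: measurable_indic.
have mg : measurable_fun setT (fun u : R => ((\1_(@box R n) (u - x))%:E * G u)%E).
  apply: emeasurable_funM => //.
  exact: (measurableT_comp m1 (@measurable_shift R (- x))).
pose D : set R := if 0 <= x then `](n%:R / 2), (n%:R / 2 + x)]%classic
  else `[(- (n%:R / 2) + x), (- (n%:R / 2))[%classic.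
have mD : measurable D by rewrite /D; case: ifP => _; exact: measurable_itv.
have muD : leb D = `|x|%:E.
  rewrite /D; case: ifPn => x0.
    rewrite [LHS]lebesgue_measure_itv/= lte_fin ltrDl lt0r x0 andbT.
    rewrite ger0_norm//; case: ifPn => [_|]; last by rewrite negbK => /eqP ->.
    by rewrite -EFinB; congr _%:E; ring.
  rewrite -ltNge in x0.
  rewrite [LHS]lebesgue_measure_itv/= lte_fin gtrDl x0 ltr0_norm//.
  by rewrite -EFinB; congr _%:E; ring.
have -> : (\int[leb]_(u in box n) G (u + x)%R =
    \int[leb]_u ((\1_(@box R n) (u - x))%:E * G u))%E.
  rewrite -(ge0_integral_shift x mg); last first.
    by move=> u; rewrite mule_ge0// lee_fin.
  by rewrite -integral_indic_mul; apply: eq_integral => u _; rewrite addrK.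
rewrite -[X in (_ <= X + _)%E](integral_indic_mul leb).
have -> : ((M * `|x|)%:E = \int[leb]_u (M%:E * (\1_D u)%:E))%E.
  rewrite (ge0_integralZl_EFin leb measurableT _ _ M0)//; last first.
    by apply/measurable_EFinP; exact: measurable_indic.
  by rewrite integral_indic// setIT EFinM; congr (_ * _)%E; exact/esym/muD.
rewrite -ge0_integralD//.
- apply: ge0_le_integral => //.
  + by move=> u _; rewrite mule_ge0// lee_fin.
  + apply: emeasurable_funD; first exact: emeasurable_funM.
    by apply: emeasurable_funM => //; apply/measurable_EFinP; exact: measurable_indic.
  + move=> u _; rewrite !indicE.
    have [ub|ub] := boolP (u \in box n).
      rewrite mul1e; apply: (@le_trans _ _ (G u)).
        by rewrite -[leRHS]mul1e lee_wpmul2r// lee_fin lern1; case: (_ \in _).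
      by rewrite leeDl// mule_ge0// lee_fin.
    rewrite mul0e add0e.
    have [uxb|uxb] := boolP ((u - x) \in box n); last first.
      by rewrite mul0e mule_ge0// lee_fin.
    suff -> : u \in D by rewrite mul1e mule1.
    move: ub => /negP; move: uxb; rewrite !inE /D /box/= !in_itv/= => /andP[u1 u2] ub.
    case: ifPn => x0; rewrite /= in_itv/=.
      rewrite -lerBlDr u2 andbT ltNge; apply/negP => u3; apply: ub.
      by rewrite u3 andbT; lra.
    rewrite -ltNge in x0; rewrite -lerBrDr u1/= ltNge; apply/negP => u3.
    by apply: ub; rewrite u3/=; lra.
- by move=> u _; rewrite mule_ge0// lee_fin.
- exact: emeasurable_funM.
- by move=> u _; rewrite mule_ge0// lee_fin.
- by apply: emeasurable_funM => //; apply/measurable_EFinP; exact: measurable_indic.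
Qed.

End box_shift.

Lemma uniform_integral {R : realType} (n : nat) (n0 : (0 < n)%N) (f : R -> \bar R) :
  measurable_fun setT f -> (forall x, (0 <= f x)%E) ->
  (\int[uniform_prob (box_lt R n0)]_x f x =
   (n%:R^-1)%:E * \int[lebesgue_measure]_(x in @box R n) f x)%E.
Proof.
move=> mf f0; rewrite -(integral_background n0)// muleA -EFinM mulVf ?mul1e//.
by rewrite pnatr_eq0 -lt0n.
Qed.

(** Adds up the errors of three comparisons of extended reals. *)
Lemma lee_chain3 {R : realType} (a b i j : \bar R) (p q t r : R) :
  (b <= j + p%:E)%E -> (j <= i + q%:E)%E -> (i <= a + t%:E)%E ->
  p + q + t = r -> (b <= a + r%:E)%E.
Proof.
move=> bj ji ia <-; apply: (le_trans bj).
apply: (le_trans (leeD2r _ (le_trans ji (leeD2r _ ia)))).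
rewrite -!addeA leeD2l// -!EFinD lee_fin le_eqVlt; apply/orP; left; apply/eqP; ring.
Qed.

(** Reflection and translation preserve the Lebesgue measure. *)
Lemma integral_reflect_le {R : realType} (n : nat) (W : R -> \bar R) (x : R) :
  measurable_fun setT W -> (forall v, 0 <= W v)%E ->
  (\int[lebesgue_measure]_(u in box n) W (x - u)%R <=
   \int[lebesgue_measure]_v W v)%E.
Proof.
move=> mW W0.
have mN : measurable_fun setT (fun u : R => W (x - u)).
  by apply: (measurableT_comp mW); exact: measurable_funB.
apply: (@le_trans _ _ (\int[lebesgue_measure]_u W (x - u)%R)%E).
  by apply: ge0_subset_integral => //; exact: measurable_box.
rewrite -(ge0_integral_shift x mW)//.
rewrite -(@ge0_integral_opp R (fun v => W (v + x)%R))//; last first.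
  exact: (measurableT_comp mW (@measurable_shift R x)).
by under eq_integral do rewrite addrC.
Qed.

(** To be used when [G] is the truncated mean squared error of the count in a
    window of length [x] seen from the position [u], and [W] the mean squared
    discrepancy at a point of the box.  The error of the count is the difference
    of the discrepancies at the ends of the window, unless the window leaves the
    box, which has probability [x / n]. *)
Lemma uniform_window_le {R : realType} (n : nat) (n0 : (0 < n)%N)
    (G W : R -> \bar R) (x M C : R) :
  measurable_fun setT G -> (forall u, 0 <= G u <= M%:E)%E ->
  measurable_fun setT W -> (forall v, 0 <= W v)%E -> 0 < x ->
  (forall u, box n u -> x - n%:R / 2 <= u ->
    (G u <= 2%:E * W (x - u)%R + 2%:E * W (- u)%R)%E) ->
  (\int[lebesgue_measure]_v W v <= (C * n%:R)%:E)%E ->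
  (\int[uniform_prob (box_lt R n0)]_u G u <= (4 * C + M * x / n%:R)%:E)%E.
Proof.
move=> mG GM mW W0 x0 GW intW.
have mb := @measurable_box R n.
have G0 u : (0 <= G u)%E by case/andP: (GM u).
have M0 : 0 <= M by rewrite -lee_fin (le_trans (G0 0))//; case/andP: (GM 0).
have n0R : 0 < n%:R :> R by rewrite ltr0n.
pose B : set R := `[(- (n%:R / 2)), (- (n%:R / 2) + x)]%classic.
have mB : measurable B by exact: measurable_itv.
have muB : lebesgue_measure B = x%:E.
  rewrite [LHS]lebesgue_measure_itv/= lte_fin ltrDl x0.
  by rewrite -EFinB; congr _%:E; ring.
have mBE : measurable_fun setT (fun u : R => (\1_B u : R)%:E).
  by apply/measurable_EFinP; exact: measurable_indic.
have mW1 : measurable_fun setT (fun u : R => W (x - u)).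
  by apply: (measurableT_comp mW); exact: measurable_funB.
have mW2 : measurable_fun setT (fun u : R => W (- u)).
  by apply: (measurableT_comp mW); exact: measurable_funN.
have W20 v : (0 <= 2%:E * W v)%E by rewrite mule_ge0.
have MB0 u : (0 <= M%:E * (\1_B u : R)%:E)%E by rewrite mule_ge0// lee_fin.
have int2 (f : R -> \bar R) : measurable_fun setT f -> (forall u, 0 <= f u)%E ->
    (\int[lebesgue_measure]_(u in box n) f u <= (C * n%:R)%:E)%E ->
    (\int[lebesgue_measure]_(u in box n) (2%:E * f u) <= (2 * (C * n%:R))%:E)%E.
  move=> mf f0 h; rewrite EFinM.
  rewrite (ge0_integralZl_EFin lebesgue_measure mb (fun u _ => f0 u) (measurable_funTS mf))//.
  exact: lee_wpmul2l.
rewrite uniform_integral//.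
apply: (@le_trans _ _ ((n%:R^-1)%:E * (M * x + (2 * (C * n%:R) + 2 * (C * n%:R)))%:E)%E); last first.
  rewrite -EFinM lee_fin le_eqVlt; apply/orP; left; apply/eqP; field.
  by rewrite gt_eqF.
rewrite lee_wpmul2l ?lee_fin ?invr_ge0//.
apply: (@le_trans _ _ (\int[lebesgue_measure]_(u in box n)
   (M%:E * (\1_B u)%:E + (2%:E * W (x - u)%R + 2%:E * W (- u)%R)))%E).
  apply: ge0_le_integral => //.
  - exact: measurable_funTS.
  - apply: measurable_funTS; apply: emeasurable_funD; first exact: emeasurable_funM.
    by apply: emeasurable_funD; exact: emeasurable_funM.
  - move=> u ub; have [xu|xu] := leP (x - n%:R / 2) u.
      by rewrite (le_trans (GW u ub xu))// leeDr.
    have /andP[_ GuM] := GM u; rewrite (le_trans GuM)//.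
    rewrite indicE mem_set ?mule1 ?leeDl ?adde_ge0//.
    move: ub; rewrite /box/B/= !in_itv/= => /andP[-> _]/=; rewrite ltW//.
    by rewrite addrC.
rewrite ge0_integralD//; last 3 first.
- by apply: measurable_funTS; exact: emeasurable_funM.
- by move=> u _; rewrite adde_ge0.
- by apply: measurable_funTS; apply: emeasurable_funD; exact: emeasurable_funM.
rewrite ge0_integralD//; last 2 first.
- by apply: measurable_funTS; exact: emeasurable_funM.
- by apply: measurable_funTS; exact: emeasurable_funM.
rewrite [leRHS]EFinD leeD//; last first.
  rewrite [leRHS]EFinD; apply: leeD; apply: int2 => //.
    exact: le_trans (integral_reflect_le n x mW W0) intW.
  have := le_trans (integral_reflect_le n 0 mW W0) intW.
  by under eq_integral do rewrite sub0r.
rewrite (ge0_integralZl_EFin lebesgue_measure mb _ (measurable_funTS mBE) M0)//.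
rewrite EFinM lee_wpmul2l// integral_indic//.
rewrite -[leRHS]muB; apply: le_measure; rewrite ?inE//.
exact: measurableI.
Qed.

Section local_events.
Context {R : realType}.

Lemma local_on_le (K K' : R) T (F : config R -> T) :
  K <= K' -> local_on K F -> local_on K' F.
Proof.
move=> KK' locF xi eta h; apply: locF => A mA AK; apply: h => // x /AK.
by rewrite /= !in_itv/= => /andP[x1 x2]; apply/andP; split; lra.
Qed.

Lemma local_on_translate (K x : R) T (F : config R -> T) :
  local_on K F -> local_on (K + `|x|) (fun xi => F (translate x xi)).
Proof.
move=> locF xi eta h; apply: locF => A mA AK.
rewrite /= /translate_measure /pushforward; apply: h.
  by rewrite -[X in measurable X]setTI; exact: measurable_shift.
move=> y /= /AK; rewrite /= !in_itv/= => /andP[y1 y2].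
have := ler_norm x; have := ler_norm (- x); rewrite normrN => x1 x2.
by apply/andP; split; lra.
Qed.

Lemma local_on_cnt (a b K : R) : - K <= a -> b <= K ->
  local_on K (fun xi => cnt xi a b).
Proof.
move=> Ka bK xi eta h; rewrite /cnt h// => x /=.
rewrite !in_itv/= => /andP[x1 x2].
by rewrite (le_trans Ka (ltW x1)) (le_trans x2 bK).
Qed.

Definition local_event (A : set (config R)) :=
  measurable A /\ exists2 K : R, 0 <= K & local_on K A.

Lemma local_event_setI : setI_closed local_event.
Proof.
move=> A B [mA [K K0 AK]] [mB [L L0 BL]]; split; first exact: measurableI.
exists (Num.max K L); first by rewrite le_max K0.
have KM : K <= Num.max K L by rewrite le_max lexx.
have LM : L <= Num.max K L by rewrite le_max lexx orbT.
move=> xi eta h; rewrite /setI/=.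
by rewrite (local_on_le KM AK h) (local_on_le LM BL h).
Qed.

(** Counts in bounded sets are local and determine all counts by exhaustion. *)
Lemma measurable_local_event : @measurable _ (config R) = <<s local_event >>.
Proof.
apply/seteqP; split; last first.
  by apply: smallest_sub => [|A []//]; exact: sigma_algebra_measurable.
apply: smallest_sub; first exact: smallest_sigma_algebra.
move=> _ [A mA [B mB <-]].
pose T := g_sigma_algebraType local_event.
suff : measurable_fun setT (config_ev A : T -> \bar R).
  by move=> /(_ measurableT B mB).
pose D (k : nat) := `](- k%:R), k%:R]%classic : set R.
have mD k : measurable (D k) by exact: measurable_itv.
apply: (@emeasurable_fun_cvg _ T R setT (fun k => config_ev (A `&` D k))).
  move=> k _ C mC; rewrite setTI; apply: sub_sigma_algebra; split.
    have := measurable_config_ev (measurableI _ _ mA (mD k)) measurableT mC.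
    by rewrite setTI.
  exists k%:R => // xi eta h; rewrite /preimage /config_ev/= h//.
    exact: measurableI.
  by move=> x [_]; rewrite /D/= !in_itv/= => /andP[/ltW -> ->].
move=> xi _; rewrite /config_ev.
rewrite [X in _ --> xi X](_ : A = \bigcup_k (A `&` D k)); last first.
  by rewrite -setI_bigcupr bigcup_itvT setIT.
apply: nondecreasing_cvg_mu.
- by move=> k; exact: measurableI.
- by apply: bigcupT_measurable => k; exact: measurableI.
- move=> m n mn; apply/subsetPset; apply: setIS => y; rewrite /D/= !in_itv/=.
  move=> /andP[my ym]; rewrite (le_trans ym) ?ler_nat// andbT.
  by apply: le_lt_trans my; rewrite lerN2 ler_nat.
Qed.

End local_events.

(** * Stationarity and bounded variance of the limit *)

Section local_limit.
Context {R : realType}.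
Local Notation leb := (@lebesgue_measure R).
Variables (P_ : nat -> probability (config R) R) (P : probability (config R) R).
Variables (phi : nat -> nat) (C : R).
Hypothesis C0 : 0 < C.
Hypothesis phi_mono : {homo phi : m n / (m < n)%N}.
Hypothesis P_cvg : local_cvg (P_ \o phi) P.
Hypothesis finite_gas : forall n (n0 : (0 < n)%N),
  exists Q : probability (config R) R,
  [/\ is_stationarized (box_lt R n0) Q (P_ n),
      Q [set g | g (~` box n) = 0%E] = 1%E &
      (\int[Q]_g \int[leb]_(v in box n) (box_discr n g v ^+ 2)%:E <=
       (C * n%:R)%:E)%E].

(** Bounded local functionals are tame, so an inequality whose error vanishes
    in the limit survives. *)
Lemma local_limit_le (F F' : config R -> R) (K M c : R) (N : nat) :
  measurable_fun setT F -> (forall g, 0 <= F g <= M) -> local_on K F ->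
  measurable_fun setT F' -> (forall g, 0 <= F' g <= M) -> local_on K F' ->
  (forall n, (N <= n)%N ->
    \int[P_ n]_g (F g)%:E <= \int[P_ n]_g (F' g)%:E + (c / n%:R)%:E)%E ->
  (\int[P]_g (F g)%:E <= \int[P]_g (F' g)%:E)%E.
Proof.
move=> mF FM lF mF' F'M lF' h.
have phi_ge k : (k <= phi k)%N.
  by elim: k => // k IH; apply: leq_ltn_trans IH _; exact: phi_mono.
have cv (G : config R -> R) : measurable_fun setT G -> (forall g, 0 <= G g <= M) -> local_on K G ->
    (\int[P_ (phi k)]_g (G g)%:E)%E @[k --> \oo] --> (\int[P]_g (G g)%:E)%E.
  move=> mG GM lG; have := P_cvg mG; rewrite unlock; apply.
  have M0 : 0 <= M by have /andP[] := GM point; exact: le_trans.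
  exists (- K), K; split; first exact: lG.
  exists (M + 1); first by rewrite ltr_wpDl.
  move=> xi; have /andP[G0 GxiM] := GM xi; rewrite ger0_norm//.
  rewrite (le_trans GxiM)//.
  have n0 : 0 <= number_in `[(- K), K]%classic xi by rewrite /number_in fine_ge0.
  by apply: (@le_trans _ _ ((M + 1) * 1)); [rewrite mulr1 lerDl|rewrite ler_wpM2l ?addr_ge0// lerDl].
have c0 : (c / (phi k)%:R)%:E @[k --> \oo] --> (0 : R)%:E.
  apply: cvg_EFin; first by near=> k.
  rewrite /comp/= -[X in _ --> X](mulr0 c); apply: cvgM; first exact: cvg_cst.
  have pos : \forall k \near \oo, (0 : R) < (phi k)%:R.
    near=> k; rewrite ltr0n (leq_trans _ (phi_ge k))//.
    by near: k; exact: nbhs_infty_gt.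
  have [_] := @gtr0_cvgV0 R nat \oo _ (fun k => (phi k)%:R : R) pos; apply.
  apply: (cvg_comp phi (fun n => n%:R : R)); last exact: cvgr_idn.
  apply/cvgnyPge => A; near=> k; rewrite (leq_trans _ (phi_ge k))//.
  by near: k; exact: nbhs_infty_ge.
have fin (G : config R -> R) : (forall g, 0 <= G g <= M) -> measurable_fun setT G ->
    (\int[P]_g (G g)%:E)%E \is a fin_num.
  move=> GM mG; rewrite ge0_fin_numE; last first.
    by apply: integral_ge0 => g _; rewrite lee_fin; case/andP: (GM g).
  apply: (@le_lt_trans _ _ M%:E); last exact: ltry.
  by apply: probability_integral_le => //; exact/measurable_EFinP.
have cF := cv F mF FM lF.
have cF' : (\int[P_ (phi k)]_g (F' g)%:E + (c / (phi k)%:R)%:E)%E @[k --> \oo] -->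
    (\int[P]_g (F' g)%:E)%E.
  rewrite -[X in _ --> X]adde0; apply: cvgeD => //.
    by rewrite fin_num_adde_defl.
  exact: cv.
rewrite -(cvg_lim _ cF)// -(cvg_lim _ cF')//; apply: lee_lim.
- by apply/cvg_ex; eexists; exact: cF.
- by apply/cvg_ex; eexists; exact: cF'.
near=> k; apply: h; rewrite (leq_trans _ (phi_ge k))//.
by near: k; exact: nbhs_infty_ge.
Unshelve. all: by end_near.
Qed.

(** The stationarized laws see a uniform translate of the finite gas up to a
    boundary error, and a uniform translate is almost invariant. *)
Lemma local_limit_translate_le (A : set (config R)) (x : R) : local_event A ->
  (P (translate x @^-1` A) <= P A)%E.
Proof.
move=> [mA [K K0 lA]].
have mtA : measurable (translate x @^-1` A).
  by rewrite -[X in measurable X]setTI; exact: measurable_translate.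
pose F (g : config R) : R := \1_A g.
pose F' (g : config R) : R := \1_A (translate x g).
have F01 g : 0 <= F g <= 1 by rewrite /F indicE; case: (_ \in _); rewrite ?lexx ler01.
have mF : measurable_fun setT F by exact: measurable_indic.
have mF' : measurable_fun setT F' by exact: (measurableT_comp mF (measurable_translate x)).
have lF : local_on K F.
  move=> xi eta h; rewrite /F !indicE; congr (_%:R).
  by congr nat_of_bool; apply/idP/idP; rewrite !inE (lA xi eta h).
pose L := K + `|x|.
have KL : K <= L by rewrite lerDl.
have lF' : local_on L F' by exact: (local_on_translate (x := x) lF).
have : (\int[P]_g (F' g)%:E <= \int[P]_g (F g)%:E)%E.
  apply: (@local_limit_le F' F L 1 (L *+ 2 + `|x| + L *+ 2) (Num.truncn (L *+ 2)).+1) => //.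
  - by move=> g; exact: F01.
  - exact: (local_on_le KL).
  move=> n Ln.
  have Ln' : L *+ 2 < n%:R by rewrite (lt_le_trans (truncnS_gt _))// ler_nat.
  have n0 : (0 < n)%N by exact: leq_trans Ln.
  have n0R : 0 < n%:R :> R by rewrite ltr0n.
  have L0 : 0 <= L by rewrite addr_ge0.
  have [Q [stQ suppQ _]] := finite_gas n0.
  have [+ _] := stationarized_local stQ suppQ mF' (fun g => F01 _) L0 Ln' lF'.
  have [_ +] := stationarized_local stQ suppQ mF F01 L0 Ln' (local_on_le KL lF).
  set I := (X in (X <= _)%E -> _); set I' := (X in _ -> (_ <= X + _)%E -> _).
  move=> h1 h2.
  have h3 : (I' <= I + (`|x| / n%:R)%:E)%E; last first.
    apply: (lee_chain3 h2 h3 h1).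
    by rewrite !mul1r !mulrDl.
  pose G u := (\int[Q]_g (F (translate u g))%:E)%E.
  have mG : measurable_fun setT G.
    apply: (@measurable_fun_fubini_tonelli_F _ _ R (config R) R Q
      (fun z => (F (translate z.1 z.2))%:E)).
      apply/measurable_EFinP; apply: (measurableT_comp mF).
      exact: (@measurable_translate2 R _ (R * config R)%type fst snd).
    by move=> z; rewrite lee_fin; case/andP: (F01 (translate z.1 z.2)).
  have GM u : (0 <= G u <= 1%:E)%E.
    apply/andP; split.
      by apply: integral_ge0 => g _; rewrite lee_fin; case/andP: (F01 (translate u g)).
    apply: probability_integral_le => [|g]; last exact: (F01 (translate u g)).
    by apply/measurable_EFinP; apply: (measurableT_comp mF); exact: measurable_translate.
  have G0 u : (0 <= G u)%E by case/andP: (GM u).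
  have mGx : measurable_fun setT (fun u : R => G (u + x)).
    exact: (measurableT_comp mG (@measurable_shift R x)).
  have -> : (I' = (n%:R^-1)%:E * \int[leb]_(u in box n) G (u + x)%R)%E.
    rewrite -(uniform_integral n0)//.
    apply: eq_integral => u _; apply: eq_integral => g _.
    by rewrite /F' translateD.
  have -> : (I = (n%:R^-1)%:E * \int[leb]_(u in box n) G u)%E.
    by rewrite -(uniform_integral n0).
  rewrite mulrC EFinM -muleDr//; last first.
    by rewrite ge0_adde_def// inE ?lee_fin// integral_ge0.
  rewrite lee_wpmul2l ?lee_fin ?invr_ge0//.
  by have := box_shift n x mG GM; rewrite mul1r.
by rewrite !integral_indic// ?setIT.
Qed.

Lemma local_limit_stationary : stationary P.
Proof.
move=> x A mA.
pose m := measure_function_pushforward__canonical__measure_function_Measure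
  P (measurable_translate x).
rewrite -[LHS]/(m A).
apply: (@measure_unique _ R (config R) local_event (fun=> setT)) => //.
- exact: measurable_local_event.
- exact: local_event_setI.
- by move=> _; split=> //; exists 0.
- by apply/seteqP; split => // g _; exists 0%N.
- move=> B lB; rewrite /m/= /pushforward; apply/eqP; rewrite eq_le.
  rewrite local_limit_translate_le//=.
  have lB' : local_event (translate x @^-1` B).
    have [mB [K K0 hB]] := lB; split.
      by rewrite -[X in measurable X]setTI; exact: measurable_translate.
    by exists (K + `|x|); [rewrite addr_ge0|exact: (local_on_translate (x := x) hB)].
  apply: le_trans (local_limit_translate_le (- x) lB').
  rewrite le_eqVlt; apply/orP; left; apply/eqP; congr (P _).
  by apply/seteqP; split => g; rewrite /preimage/= translateD addNr translate0.
- by move=> _; rewrite /m/= /pushforward preimage_setT probability_setT ltry.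
Qed.

Let discr_window (n : nat) (Q : probability (config R) R) (v : R) : \bar R :=
  (\int[Q]_g ((\1_(@box R n) v)%:E * (box_discr n g v ^+ 2)%:E))%E.

Let measurable_window_integrand n : measurable_fun setT
  (fun z : R * config R => ((\1_(@box R n) z.1 : R)%:E * (box_discr n z.2 z.1 ^+ 2)%:E)%E).
Proof.
have mb := @measurable_box R n.
apply: emeasurable_funM; apply/measurable_EFinP.
  by apply: measurableT_comp => //; exact: measurable_indic.
apply: measurable_funX.
apply: measurable_funB; last exact: measurable_funD.
exact: measurable_cnt2.
Qed.

Let window_ge0 n (v : R) (g : config R) :
  (0 <= (\1_(@box R n) v)%:E * (box_discr n g v ^+ 2)%:E)%E.
Proof. by rewrite -EFinM lee_fin mulr_ge0// sqr_ge0. Qed.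

Let measurable_discr_window n Q : measurable_fun setT (discr_window n Q).
Proof.
apply: (@measurable_fun_fubini_tonelli_F _ _ R (config R) R Q
  (fun z => ((\1_(@box R n) z.1)%:E * (box_discr n z.2 z.1 ^+ 2)%:E)%E)).
- exact: measurable_window_integrand.
- by move=> z; exact: window_ge0.
Qed.

Let discr_window_ge0 n Q v : (0 <= discr_window n Q v)%E.
Proof. by apply: integral_ge0 => g _; exact: window_ge0. Qed.

Let integral_discr_window n (Q : probability (config R) R) :
  (\int[leb]_v discr_window n Q v =
   \int[Q]_g \int[leb]_(v in box n) (box_discr n g v ^+ 2)%:E)%E.
Proof.
rewrite /discr_window.
rewrite (@fubini_tonelli _ _ (measurableTypeR R) (config R) R leb Q
  (fun z => ((\1_(@box R n) z.1)%:E * (box_discr n z.2 z.1 ^+ 2)%:E)%E)).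
- by apply: eq_integral => g _; rewrite integral_indic_mul.
- exact: measurable_window_integrand.
- by move=> z; exact: window_ge0.
Qed.

Let box_discr_window n (x u : R) (g : config R) : 0 < x -> box n u ->
  x - n%:R / 2 <= u ->
  (((cnt g (- u) (x - u) - x) ^+ 2)%:E <=
   2%:E * ((\1_(@box R n) (x - u))%:E * (box_discr n g (x - u) ^+ 2)%:E) +
   2%:E * ((\1_(@box R n) (- u))%:E * (box_discr n g (- u) ^+ 2)%:E))%E.
Proof.
move=> x0; rewrite /box/= in_itv/= => /andP[u1 u2] xu.
rewrite !indicE !mem_set; last 2 first.
- by rewrite /box/= in_itv/=; apply/andP; split; lra.
- by rewrite /box/= in_itv/=; apply/andP; split; lra.
rewrite !mul1e -!EFinM -EFinD lee_fin.
have -> : cnt g (- u) (x - u) - x = box_discr n g (x - u) - box_discr n g (- u).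
  rewrite /box_discr (@cntD _ g (- (n%:R / 2) - 1) (- u) (x - u)); [ring|lra|lra].
set p := box_discr _ _ _; set q := box_discr _ _ _.
have := sqr_ge0 (p + q); rewrite -subr_ge0 => h.
rewrite -subr_ge0 (_ : _ - _ = (p + q) ^+ 2) ?sqr_ge0//; ring.
Qed.

(** The truncation makes the squared error a bounded functional. *)
Lemma local_limit_truncated_variance (x M : R) : 0 < x -> 0 <= M ->
  (\int[P]_g (Num.min ((cnt g 0 x - x) ^+ 2) M)%:E <= (4 * C)%:E)%E.
Proof.
move=> x0 M0.
pose F (g : config R) : R := Num.min ((cnt g 0 x - x) ^+ 2) M.
pose M' := Num.max M (4 * C).
have mcnt : measurable_fun setT (fun g : config R => cnt g 0 x) by exact: measurable_cnt2.
have mF : measurable_fun setT F.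
  apply: measurable_minr => //; apply: measurable_funX.
  by apply: measurable_funB.
have F0 g : 0 <= F g by rewrite /F le_min sqr_ge0.
have FleM g : F g <= M by rewrite /F ge_min lexx orbT.
have FM g : 0 <= F g <= M'.
  by rewrite F0/= (le_trans (FleM g))// /M' le_max lexx.
have C4 : 0 <= 4 * C by rewrite mulr_ge0// ltW.
rewrite -[leRHS](probability_integral_cst P).
apply: (@local_limit_le F (cst (4 * C)) x M' (M' * (x *+ 2) + M * x)
  (Num.truncn (x *+ 2)).+1) => //.
- move=> xi eta h; rewrite /F.
  by have := local_on_cnt (K := x) (a := 0) (b := x) _ (lexx x) h => /= ->//; rewrite oppr_le0 ltW.
- by move=> g; rewrite C4/= /M' le_max lexx orbT.
move=> n xn; rewrite probability_integral_cst.
have n0 : (0 < n)%N by exact: leq_trans xn.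
have xn' : x *+ 2 < n%:R by rewrite (lt_le_trans (truncnS_gt _))// ler_nat.
have n0R : 0 < n%:R :> R by rewrite ltr0n.
have [Q [stQ suppQ varQ]] := finite_gas n0.
have lF : local_on x F.
  move=> xi eta h; rewrite /F.
  by have := local_on_cnt (K := x) (a := 0) (b := x) _ (lexx x) h => /= ->//; rewrite oppr_le0 ltW.
have [h _] := stationarized_local stQ suppQ mF FM (ltW x0) xn' lF.
apply: (le_trans h); rewrite {h}.
have mFt : measurable_fun setT (fun z : R * config R => (F (translate z.1 z.2))%:E).
  apply/measurable_EFinP; apply: (measurableT_comp mF).
  exact: (@measurable_translate2 R _ (R * config R)%type fst snd).
have Ft0 (z : R * config R) : (0 <= (F (translate z.1 z.2))%:E)%E by rewrite lee_fin.
have : (\int[uniform_prob (box_lt R n0)]_u \int[Q]_g (F (translate u g))%:E <=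
    (4 * C + M * x / n%:R)%:E)%E.
  apply: (@uniform_window_le R n n0 _ (discr_window n Q)) => //.
  - exact: (@measurable_fun_fubini_tonelli_F _ _ R (config R) R Q _ mFt Ft0).
  - move=> u; apply/andP; split; first by apply: integral_ge0 => g _; rewrite lee_fin.
    apply: probability_integral_le => [|g]; last by rewrite !lee_fin F0 FleM.
    by apply/measurable_EFinP; apply: (measurableT_comp mF); exact: measurable_translate.
  - move=> u ub xu; rewrite /discr_window.
    have mw v : measurable_fun setT (fun g : config R =>
        ((\1_(@box R n) v : R)%:E * (box_discr n g v ^+ 2)%:E)%E).
      exact: (measurableT_comp (measurable_window_integrand n) (pair1_measurable v)).
    rewrite -(ge0_integralZl_EFin Q measurableT (fun g _ => window_ge0 n (x - u) g) (mw _))//.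
    rewrite -(ge0_integralZl_EFin Q measurableT (fun g _ => window_ge0 n (- u) g) (mw _))//.
    have w20 v g : (0 <= 2%:E * ((\1_(@box R n) v)%:E * (box_discr n g v ^+ 2)%:E))%E.
      by rewrite mule_ge0// window_ge0.
    have m2 v : measurable_fun setT (fun g : config R =>
        (2%:E * ((\1_(@box R n) v : R)%:E * (box_discr n g v ^+ 2)%:E))%E).
      by apply: emeasurable_funM => //; exact: mw.
    rewrite -(ge0_integralD Q measurableT (fun g _ => w20 (x - u) g) (m2 _) (fun g _ => w20 (- u) g) (m2 _)).
    apply: ge0_le_integral => //.
    + by move=> g _; rewrite lee_fin.
    + by apply/measurable_EFinP; apply: (measurableT_comp mF); exact: measurable_translate.
    + exact: emeasurable_funD.
    + move=> g _; apply: le_trans (box_discr_window g x0 ub xu).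
      rewrite lee_fin /F cnt_translate sub0r ge_min lexx//.
  - by rewrite integral_discr_window.
move=> h; apply: (le_trans (leeD2r _ h)).
rewrite -!EFinD lee_fin le_eqVlt; apply/orP; left; apply/eqP; field.
by rewrite gt_eqF.
Qed.

Lemma local_limit_variance (x : R) : 0 < x ->
  (\int[P]_g ((cnt g 0 x - x) ^+ 2)%:E <= (4 * C)%:E)%E.
Proof.
move=> x0.
have mcnt : measurable_fun setT (fun g : config R => cnt g 0 x) by exact: measurable_cnt2.
have msq : measurable_fun setT (fun g : config R => (cnt g 0 x - x) ^+ 2).
  by apply: measurable_funX; exact: measurable_funB.
pose F (k : nat) (g : config R) : \bar R := (Num.min ((cnt g 0 x - x) ^+ 2) k%:R)%:E.
have limF g : limn (F ^~ g) = ((cnt g 0 x - x) ^+ 2)%:E.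
  apply: lim_near_cst => //; near=> k.
  rewrite /F min_l//; have := truncnS_gt ((cnt g 0 x - x) ^+ 2) => /ltW h.
  apply: (le_trans h); rewrite ler_nat.
  by near: k; exact: nbhs_infty_ge.
under eq_integral do rewrite -limF.
rewrite monotone_convergence//; last 3 first.
- by move=> k; apply/measurable_EFinP; exact: measurable_minr.
- by move=> k g _; rewrite /F lee_fin le_min sqr_ge0/=.
- move=> g _ k l kl; rewrite lee_fin le_min !ge_min lexx/=.
  by rewrite ler_nat kl orbT.
apply: lime_le.
  apply: ereal_nondecreasing_is_cvgn => k l kl; apply: ge0_le_integral => //.
  - by move=> g _; rewrite /F lee_fin le_min sqr_ge0/=.
  - by apply/measurable_EFinP; exact: measurable_minr.
  - by apply/measurable_EFinP; exact: measurable_minr.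
  - move=> g _; rewrite lee_fin le_min !ge_min lexx/=.
    by rewrite ler_nat kl orbT.
by apply: nearW => k; exact: local_limit_truncated_variance.
Unshelve. all: by end_near.
Qed.

End local_limit.

(** All that the rest of the proof retains of the Riesz gas. *)
Lemma riesz_gas_stationary_variance {R : realType} (s beta : R)
    (P : probability (config R) R) : -2 < s <= -1 -> 0 < beta ->
  is_riesz_gas s beta P ->
  stationary P /\ exists2 C : R, 0 < C & forall x, 0 < x ->
    (\int[P]_g ((cnt g 0 x - x) ^+ 2)%:E <= C%:E)%E.
Proof.
move=> hs hbeta [P_ [stP [phi phi_mono cvgP]]].
have [C C0 hC] := finite_riesz_discr hs hbeta.
have gas n (n0 : (0 < n)%N) : exists Q : probability (config R) R,
    [/\ is_stationarized (box_lt R n0) Q (P_ n),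
      Q [set g | g (~` box n) = 0%E] = 1%E &
      (\int[Q]_g \int[lebesgue_measure]_(v in box n) (box_discr n g v ^+ 2)%:E <=
       (C * n%:R)%:E)%E].
  have [Q [finQ statQ]] := stP n n0.
  by have [? ?] := hC n n0 Q finQ; exists Q.
split; first exact: (local_limit_stationary phi_mono cvgP gas).
exists (4 * C); first by rewrite mulr_gt0.
exact: (local_limit_variance C0 phi_mono cvgP gas).
Qed.

(** * Mean squares *)

Section mean_square.
Context d (T : measurableType d) {R : realType} (P : probability T R).
Implicit Types f g h : T -> R.

Definition msq f : \bar R := (\int[P]_w (f w ^+ 2)%:E)%E.

Lemma msq_ge0 f : (0 <= msq f)%E.
Proof. by apply: integral_ge0 => w _; rewrite lee_fin sqr_ge0. Qed.

Lemma measurable_sqr f : measurable_fun setT f ->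
  measurable_fun setT (fun w => (f w ^+ 2)%:E).
Proof. by move=> mf; apply/measurable_EFinP; exact: measurable_funX. Qed.

Lemma eq_msq f g : f =1 g -> msq f = msq g.
Proof. by move=> fg; apply: eq_integral => w _; rewrite fg. Qed.

Lemma msq_lin f g (a b : R) : measurable_fun setT f -> measurable_fun setT g ->
  0 <= a -> 0 <= b ->
  (\int[P]_w (a * f w ^+ 2 + b * g w ^+ 2)%:E = a%:E * msq f + b%:E * msq g)%E.
Proof.
move=> mf mg a0 b0.
have sq0 (k : T -> R) w : (0 <= (k w ^+ 2)%:E)%E by rewrite lee_fin sqr_ge0.
rewrite /msq -(ge0_integralZl_EFin P measurableT (fun w _ => sq0 f w) (measurable_sqr mf) a0).
rewrite -(ge0_integralZl_EFin P measurableT (fun w _ => sq0 g w) (measurable_sqr mg) b0).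
rewrite -ge0_integralD//.
- by move=> w _; rewrite mule_ge0.
- by apply: emeasurable_funM => //; exact: measurable_sqr.
- by move=> w _; rewrite mule_ge0.
- by apply: emeasurable_funM => //; exact: measurable_sqr.
Qed.

Lemma msq_le_lin f g h (a b : R) : measurable_fun setT f ->
  measurable_fun setT g -> measurable_fun setT h -> 0 <= a -> 0 <= b ->
  (forall w, f w ^+ 2 <= a * g w ^+ 2 + b * h w ^+ 2) ->
  (msq f <= a%:E * msq g + b%:E * msq h)%E.
Proof.
move=> mf mg mh a0 b0 fgh; rewrite -msq_lin//.
apply: ge0_le_integral => //.
- by move=> w _; rewrite lee_fin sqr_ge0.
- exact: measurable_sqr.
- apply/measurable_EFinP; apply: measurable_funD; apply: measurable_funM => //;
    exact: measurable_funX.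
- by move=> w _; rewrite lee_fin.
Qed.

Lemma msqB_le f g (a b : R) : measurable_fun setT f -> measurable_fun setT g ->
  (msq f <= a%:E)%E -> (msq g <= b%:E)%E ->
  (msq (fun w => f w - g w)%R <= (2 * a + 2 * b)%:E)%E.
Proof.
move=> mf mg fa gb.
apply: (@le_trans _ _ (2%:E * msq f + 2%:E * msq g)%E).
  apply: msq_le_lin => //; first exact: measurable_funB.
  move=> w; have := sqr_ge0 (f w + g w); rewrite -subr_ge0 => h.
  rewrite -subr_ge0 (_ : _ - _ = (f w + g w) ^+ 2) ?sqr_ge0//; ring.
by rewrite [leRHS]EFinD [(2 * a)%:E]EFinM [(2 * b)%:E]EFinM leeD// lee_wpmul2l.
Qed.

(** Mean-square smallness at a geometric rate forces almost sure smallness at a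
    geometric rate. *)
Lemma ae_geometric (f : nat -> T -> R) (c : R) :
  (forall n, measurable_fun setT (f n)) ->
  (forall n, msq (f n) <= (c * 8^-1 ^+ n)%:E)%E ->
  {ae P, forall w, exists K : R, forall n, `|f n w| <= K * 2^-1 ^+ n}.
Proof.
move=> mf fc.
pose h n w := (4 ^+ n * f n w ^+ 2)%:E.
have h0 n w : (0 <= h n w)%E by rewrite lee_fin mulr_ge0 ?sqr_ge0// exprn_ge0.
have mh n : measurable_fun setT (h n).
  by apply/measurable_EFinP; apply: measurable_funM => //; exact: measurable_funX.
pose s w := (\sum_(0 <= n <oo) h n w)%E.
have ms : measurable_fun setT s by apply: ge0_emeasurable_sum => //.
have s0 w : (0 <= s w)%E by apply: nneseries_ge0.
have int_s : (\int[P]_w s w <= (c * 2)%:E)%E.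
  rewrite integral_nneseries//.
  apply: (@le_trans _ _ (\sum_(0 <= n <oo) (c * 2^-1 ^+ n)%:E)%E).
    apply: lee_nneseries => [n _ _|n _]; first exact: integral_ge0.
    rewrite /h; under eq_integral do rewrite EFinM.
    have sq0 w : [set: T] w -> (0 <= (f n w ^+ 2)%:E)%E by rewrite lee_fin sqr_ge0.
    rewrite (ge0_integralZl_EFin P measurableT sq0 (measurable_sqr (mf n)) (exprn_ge0 n (ler0n R 4))).
    apply: le_trans (lee_wpmul2l _ (fc n)) _; first by rewrite lee_fin exprn_ge0.
    rewrite -EFinM lee_fin mulrCA -exprMn le_eqVlt; apply/orP; left; apply/eqP.
    by congr (_ * _ ^+ _); field.
  have c0 : 0 <= c by rewrite -lee_fin -(mulr1 c) -(expr0 8^-1) (le_trans (msq_ge0 (f 0%N))).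
  apply: lime_le; first by apply: is_cvg_nneseries => n _ _; rewrite lee_fin mulr_ge0// exprn_ge0.
  apply: nearW => N; rewrite sumEFin lee_fin.
  have -> : \sum_(0 <= n < N) c * 2^-1 ^+ n = c * 2 - c * 2 * 2^-1 ^+ N.
    elim: N => [|N IH]; first by rewrite big_nil expr0 mulr1 subrr.
    by rewrite big_nat_recr//= IH exprS; field.
  by rewrite lerBlDr lerDl !mulr_ge0// exprn_ge0.
have : P.-integrable setT s.
  apply/integrableP; split=> //; under eq_integral do rewrite gee0_abs//.
  by rewrite (le_lt_trans int_s)// ltry.
move=> /(integrable_ae measurableT); apply: filterS => w /(_ I) sfin.
exists (fine (s w) + 1) => n.
have s_n : 4 ^+ n * f n w ^+ 2 <= fine (s w).
  rewrite -lee_fin fineK//.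
  have := @nneseries_lim_ge R (fun n => h n w) xpredT 0%N n.+1 (fun n _ _ => h0 n w).
  apply: le_trans; rewrite big_nat_recr//= leeDr// sume_ge0//.
have S0 : 0 <= fine (s w) by rewrite fine_ge0.
rewrite -(@ler_pXn2r _ 2)// ?nnegrE ?mulr_ge0 ?addr_ge0 ?exprn_ge0//.
rewrite exprMn real_normK ?num_real//.
rewrite -(@ler_pM2l _ (4 ^+ n)) ?exprn_gt0//; apply: (le_trans s_n).
rewrite mulrCA -exprM mulnC exprM -exprMn.
rewrite (_ : 4 * _ = 1); last by field.
rewrite expr1n mulr1 -subr_ge0.
rewrite (_ : _ - _ = fine (s w) ^+ 2 + fine (s w) + 1); last by ring.
by rewrite !addr_ge0// sqr_ge0.
Qed.

End mean_square.

(** * Averages of the discrepancy *)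

(** Averages of values of a function with dyadic weights, as iterated
    midpoints: the parallelogram identity only takes midpoints. *)
Inductive average (R : Type) := Leaf of R | Mid of average R & average R.

Section average.
Context {R : realType}.
Implicit Types (p q : average R) (D : R -> R).

Fixpoint average_eval p D : R :=
  match p with
  | Leaf x => D x
  | Mid p q => 2^-1 * average_eval p D + 2^-1 * average_eval q D
  end.

Fixpoint average_shift (u : R) p : average R :=
  match p with
  | Leaf x => Leaf (x + u)
  | Mid p q => Mid (average_shift u p) (average_shift u q)
  end.

Fixpoint average_within (a b : R) p : Prop :=
  match p with
  | Leaf x => a <= x <= b
  | Mid p q => average_within a b p /\ average_within a b q
  end.

Lemma average_within_bounds p : exists K, 0 < K /\ average_within (- K) K p.
Proof.
have mono K L q : K <= L -> average_within (- K) K q -> average_within (- L) L q.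
  move=> KL; elim: q => [x /= /andP[x1 x2]|q1 IH1 q2 IH2 /= [h1 h2]].
    by apply/andP; split; lra.
  by split; [exact: IH1|exact: IH2].
elim: p => [x|p [K [K0 pK]] q [L [L0 qL]]].
  exists (`|x| + 1); split; first by rewrite ltr_wpDl.
  by have := ler_norm x; have := ler_norm (- x); rewrite normrN /=; move=> ? ?;
    apply/andP; split; lra.
exists (K + L); split; first by rewrite addr_gt0.
by split; [apply: mono pK; lra|apply: mono qL; lra].
Qed.

Lemma average_within_shift u a b p :
  average_within a b p -> average_within (a + u) (b + u) (average_shift u p).
Proof.
elim: p => [x /= /andP[x1 x2]|p IHp q IHq /= [h1 h2]]; last by split; auto.
by rewrite !lerD2r x1.
Qed.

Lemma average_eval_ext p D D' a b : average_within a b p ->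
  (forall x, a <= x <= b -> D x = D' x) -> average_eval p D = average_eval p D'.
Proof.
move=> + DD'; elim: p => [x /= xab|p IHp q IHq /= [h1 h2]]; first exact: DD'.
by rewrite IHp// IHq.
Qed.

Lemma average_eval_le p D D' : (forall x, D x <= D' x) ->
  average_eval p D <= average_eval p D'.
Proof.
move=> DD'; elim: p => [x //=|p IHp q IHq /=].
by rewrite lerD// ler_wpM2l.
Qed.

Lemma average_eval_affine p D (c : R) :
  average_eval p (fun x => D x + c) = average_eval p D + c.
Proof. by elim: p => [//|p IHp q IHq /=]; rewrite IHp IHq; field. Qed.

Lemma average_eval_shift u p D :
  average_eval (average_shift u p) D = average_eval p (fun x => D (x + u)).
Proof. by elim: p => [//|p IHp q IHq /=]; rewrite IHp IHq. Qed.

Definition average_discr p (xi : config R) : R := average_eval p (discr xi).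

Lemma measurable_average_discr p : measurable_fun setT (average_discr p).
Proof.
elim: p => [x|p IHp q IHq]; first exact: measurable_discr.
by apply: measurable_funD; exact: measurable_funM.
Qed.

Lemma average_discr_shift u p (xi : config R) :
  average_discr (average_shift u p) xi =
  average_discr p (translate (- u) xi) + discr xi u.
Proof.
rewrite /average_discr average_eval_shift -average_eval_affine.
congr average_eval; apply/funext => x.
by rewrite discr_translate !opprK subrK.
Qed.

End average.

Section averages.
Context {R : realType} (P : probability (config R) R) (C : R).
Hypothesis statP : stationary P.
Hypothesis varP : forall x, 0 < x ->
  (\int[P]_g ((cnt g 0 x - x) ^+ 2)%:E <= C%:E)%E.

Lemma stationary_integral (u : R) (f : config R -> \bar R) :
  measurable_fun setT f -> (forall g, 0 <= f g)%E ->
  (\int[P]_g f (translate u g) = \int[P]_g f g)%E.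
Proof.
move=> mf f0.
rewrite -(@ge0_integral_pushforward _ _ _ _ R _ (measurable_translate u) P setT f)//.
pose m := measure_function_pushforward__canonical__measure_function_Measure
  P (measurable_translate u).
by apply: (@eq_measure_integral _ _ _ setT P m) => A mA _; exact: (statP u mA).
Qed.

Lemma stationary_msq (u : R) (f : config R -> R) : measurable_fun setT f ->
  msq P (fun g => f (translate u g)) = msq P f.
Proof.
move=> mf; rewrite /msq.
rewrite (@stationary_integral u (fun g => (f g ^+ 2)%:E))//.
- exact: measurable_sqr.
- by move=> g; rewrite lee_fin sqr_ge0.
Qed.

Lemma msq_discr (x : R) : (msq P (fun g => discr g x) <= C%:E)%E.
Proof.
have C0 : (0 <= C%:E)%E by apply: le_trans (varP ltr01); exact: (msq_ge0 P (fun g => cnt g 0 1 - 1)).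
have [x0|x0|->] := ltgtP x 0.
- have x0' : 0 < - x by rewrite oppr_gt0.
  have mf : measurable_fun setT (fun g : config R => cnt g 0 (- x) - - x).
    by apply: measurable_funB => //; exact: measurable_cnt2.
  apply: le_trans (varP x0'); rewrite -[leRHS](stationary_msq (- x) mf).
  rewrite le_eqVlt; apply/orP; left; apply/eqP.
  apply: eq_integral => g _; rewrite cnt_translate.
  rewrite /discr /counting (@cnt_eq0 _ _ 0 x) ?ltW// sub0r !opprK addNr.
  by rewrite add0r -sqrrN; congr (_ ^+ 2)%:E; ring.
- rewrite (_ : msq _ _ = msq P (fun g => cnt g 0 x - x)); first exact: varP.
  by apply: eq_msq => g; rewrite /discr /counting (@cnt_eq0 _ _ x 0) ?ltW// subr0.
- rewrite (_ : msq _ _ = 0%E)//.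
  by rewrite /msq integral0_eq// => g _; rewrite /discr counting0 subrr expr0n.
Qed.

(** Convexity of the square. *)
Lemma msq_average p : (msq P (average_discr p) <= C%:E)%E.
Proof.
elim: p => [x|p IHp q IHq]; first exact: msq_discr.
apply: (@le_trans _ _ ((2^-1)%:E * msq P (average_discr p) +
    (2^-1)%:E * msq P (average_discr q))%E).
  apply: msq_le_lin => //; try exact: measurable_average_discr.
  move=> g; rewrite {1}/average_discr/= -/(average_discr p g) -/(average_discr q g).
  set a := average_discr p g; set b := average_discr q g.
  have := sqr_ge0 (a - b) => h; rewrite -subr_ge0.
  rewrite (_ : 2^-1 * a ^+ 2 + _ - _ = 4^-1 * (a - b) ^+ 2); last by field.
  by rewrite mulr_ge0// invr_ge0.
rewrite (_ : C%:E = ((2^-1)%:E * C%:E + (2^-1)%:E * C%:E)%E).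
  by rewrite leeD// lee_wpmul2l.
by rewrite -!EFinM -EFinD; congr _%:E; field.
Qed.

Let dist p x : \bar R := msq P (fun g => average_discr p g - discr g x).

Let measurable_dist p x :
  measurable_fun setT (fun g : config R => average_discr p g - discr g x).
Proof.
by apply: measurable_funB; [exact: measurable_average_discr|exact: measurable_discr].
Qed.

Lemma average_discr_dist p x : (dist p x <= (4 * C)%:E)%E.
Proof.
have := msqB_le (measurable_average_discr p) (measurable_discr x)
  (msq_average p) (msq_discr x).
by rewrite (_ : 2 * C + 2 * C = 4 * C)//; ring.
Qed.

Let dist_fin p x : dist p x \is a fin_num.
Proof.
by rewrite ge0_fin_numE ?msq_ge0// (le_lt_trans (average_discr_dist p x))// ltry.
Qed.

(** The radius of the set of discrepancies seen from an average.  Minimising it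
    picks out a Chebyshev centre, which is where the phase of the configuration
    will be read. *)
Definition radius p : R := sup (range (fun x => fine (dist p x))).

Let has_sup_dist p : has_sup (range (fun x => fine (dist p x))).
Proof.
split; first by exists (fine (dist p 0)); exists 0.
exists (4 * C) => _ [x _ <-]; rewrite -lee_fin fineK//.
exact: average_discr_dist.
Qed.

Lemma dist_le_radius p x : (dist p x <= (radius p)%:E)%E.
Proof.
rewrite -(fineK (dist_fin p x)) lee_fin; by apply: sup_upper_bound => //; exists x.
Qed.

Lemma radius_le p (c : R) : (forall x, dist p x <= c%:E)%E -> radius p <= c.
Proof.
move=> h; apply: ge_sup; first by have [] := has_sup_dist p.
by move=> _ [x _ <-]; rewrite -lee_fin fineK.
Qed.

(** Shifting an average amounts to translating the configuration. *)
Lemma radius_shift u p : radius (average_shift u p) = radius p.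
Proof.
have E x : dist (average_shift u p) x = dist p (x - u).
  rewrite -[RHS](stationary_msq (- u) (measurable_dist p (x - u))).
  apply: eq_msq => g; rewrite average_discr_shift discr_translate opprK subrK.
  ring.
rewrite /radius; congr sup; apply/seteqP; split => _ [x _ <-].
  by exists (x - u) => //; rewrite E.
by exists (x + u) => //; rewrite E addrK.
Qed.

Definition min_radius : R := inf (range radius).

Let radius_ge0 p : 0 <= radius p.
Proof. by rewrite -lee_fin (le_trans _ (dist_le_radius p 0))// msq_ge0. Qed.

Let has_inf_radius : has_inf (range radius).
Proof.
split; first by exists (radius (Leaf 0)); exists (Leaf 0).
by exists 0 => _ [p _ <-]; exact: radius_ge0.
Qed.

Lemma min_radius_le p : min_radius <= radius p.
Proof. by apply: inf_lbound; [case: has_inf_radius|exists p]. Qed.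

(** Parallelogram identity: two averages of nearly minimal radius are close,
    since their midpoint is an average too. *)
Lemma average_discr_close p q :
  (msq P (fun g => average_discr p g - average_discr q g)%R <=
   (2 * (radius p + radius q - 2 * min_radius))%:E)%E.
Proof.
have mA p' := @measurable_average_discr R p'.
have mpq : measurable_fun setT (fun g : config R => average_discr p g - average_discr q g).
  exact: measurable_funB.
set k := msq P _.
have kfin : k \is a fin_num.
  rewrite ge0_fin_numE ?msq_ge0//.
  by rewrite (le_lt_trans (msqB_le (mA p) (mA q) (msq_average p) (msq_average q)))// ltry.
have par x : (1%:E * dist (Mid p q) x + (4^-1)%:E * k =
    (2^-1)%:E * dist p x + (2^-1)%:E * dist q x)%E.
  rewrite /dist /k -!msq_lin//.
  apply: eq_integral => g _; congr _%:E.
  rewrite {1}/average_discr/= -/(average_discr p g) -/(average_discr q g).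
  by field.
have : radius (Mid p q) <= 2^-1 * radius p + 2^-1 * radius q - 4^-1 * fine k.
  apply: radius_le => x.
  have : (1%:E * dist (Mid p q) x + (4^-1)%:E * k <=
      (2^-1 * radius p + 2^-1 * radius q)%:E)%E.
    by rewrite par EFinD !EFinM leeD// lee_wpmul2l// dist_le_radius.
  rewrite -(fineK kfin) -(fineK (dist_fin (Mid p q) x)) -!EFinM -EFinD !lee_fin mul1r/=.
  by rewrite lerBrDr.
have := min_radius_le (Mid p q).
rewrite -(fineK kfin) lee_fin/=; move: (fine k) => z h1 h2.
have : 4^-1 * z <= 2^-1 * radius p + 2^-1 * radius q - min_radius by lra.
lra.
Qed.

(** The rate [8^-1] is what [ae_geometric] asks for. *)
Lemma minimizing_averages : exists p_ : nat -> average R,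
  forall n, radius (p_ n) <= min_radius + 8^-1 ^+ n.
Proof.
have h (n : nat) : exists p, radius p <= min_radius + 8^-1 ^+ n.
  have e0 : 0 < (8^-1 : R) ^+ n by rewrite exprn_gt0.
  have [_ [p _ <-] h] := inf_adherent e0 has_inf_radius.
  by exists p; exact: ltW.
by exists (fun n => sval (cid (h n))) => n; case: (cid (h n)).
Qed.

End averages.

(** * The phase *)

Section sequences.
Context {R : realType}.

Lemma geometric_cvg0 (x : nat -> R) (K : R) :
  (forall n, `|x n| <= K * 2^-1 ^+ n) -> x @ \oo --> 0.
Proof.
move=> xK; apply/norm_cvg0P.
have half : `|2^-1 : R| < 1 by rewrite ger0_norm// invf_lt1// ltr1n.
apply: (@squeeze_cvgr _ _ _ _ (cst 0) (geometric K 2^-1)).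
- by apply: nearW => n; rewrite normr_ge0/=; exact: xK.
- exact: cvg_cst.
- exact: cvg_geometric.
Qed.

Lemma geometric_increments_cvg (x : nat -> R) (K : R) :
  (forall n, `|x n.+1 - x n| <= K * 2^-1 ^+ n) -> cvgn x.
Proof.
move=> xK.
have half : `|2^-1 : R| < 1 by rewrite ger0_norm// invf_lt1// ltr1n.
have K0 : 0 <= K by have := xK 0%N; rewrite expr0 mulr1; exact: le_trans.
have : cvgn (series (fun n => x n.+1 - x n)).
  apply: normed_cvg; apply: (@series_le_cvg _ _ (geometric K 2^-1)) => //.
  - by move=> n; exact: normr_ge0.
  - by move=> n; rewrite /= mulr_ge0// exprn_ge0.
  - exact: is_cvg_geometric_series.
have E : (fun n => series (fun n => x n.+1 - x n) n + x 0%N) = x.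
  by apply/funext => n; rewrite /series/= telescope_sumr// subrK.
move=> h; rewrite -E; apply: is_cvgD => //; exact: is_cvg_cst.
Qed.

Lemma measurable_cvg0 d (T : measurableType d) (f : nat -> T -> R) :
  (forall n, measurable_fun setT (f n)) ->
  measurable [set w | f ^~ w @ \oo --> 0].
Proof.
move=> mf.
have mF : measurable_fun setT (fun w => limn_esup (fun n => `|f n w|%:E)).
  apply: measurable_fun_limn_esup => n; apply/measurable_EFinP.
  exact: (measurableT_comp (@normr_measurable R setT)).
have := mF measurableT _ (emeasurable_set1 (0%E : \bar R)); rewrite setTI.
congr measurable; apply/seteqP; split => w /=.
  move=> h; apply/norm_cvg0P.
  have : (fun n => `|f n w|%:E) @ \oo --> 0%:E.
    by apply: limn_esup_le_cvg => [|n]; [rewrite h|rewrite lee_fin].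
  by move=> /fine_cvgP[].
move=> h0; have h : (fun n => `|f n w|) @ \oo --> 0.
  by apply/(norm_cvg0P (fun n => f n w)).
have : (fun n => `|f n w|%:E) @ \oo --> 0%:E by apply: cvg_EFin => //; exact: nearW.
by move=> /cvg_limn_einf_sup[].
Qed.

Lemma ae_forall_rat d (T : measurableType d) (mu : {measure set T -> \bar R})
    (Pr : rat -> T -> Prop) :
  (forall q, {ae mu, forall w, Pr q w}) -> {ae mu, forall w, forall q, Pr q w}.
Proof.
move=> h.
have : {ae mu, forall w, forall n : nat,
    if unpickle n is Some q then Pr q w else True}.
  apply: ae_foralln => n; case: unpickle => [q|]; first exact: h.
  exact: aeW.
by apply: filterS => w hw q; have := hw (pickle q); rewrite pickleK.
Qed.

Lemma measurable_forall_rat d (T : measurableType d) (A : rat -> set T) :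
  (forall q, measurable (A q)) -> measurable [set w | forall q, A q w].
Proof.
move=> mA.
rewrite (_ : [set w | _] = \bigcap_n
    (if unpickle n is Some q then A q else setT)).
  by apply: bigcapT_measurable => n; case: unpickle.
apply/seteqP; split => w; first by move=> h n _; case: unpickle => [q|//]; exact: h.
by move=> h q; have := h (pickle q) I; rewrite pickleK.
Qed.

End sequences.

Section phase.
Context {R : realType} (P : probability (config R) R) (C : R).
Hypothesis statP : stationary P.
Hypothesis varP : forall x, 0 < x ->
  (\int[P]_g ((cnt g 0 x - x) ^+ 2)%:E <= C%:E)%E.
Variable p_ : nat -> average R.
Hypothesis minp : forall n, radius P (p_ n) <= min_radius P + 8^-1 ^+ n.
Implicit Types g : config R.

Let A n g : R := average_discr (p_ n) g.
Let Ash (u : R) n g : R := average_discr (average_shift u (p_ n)) g.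

Let mA n : measurable_fun setT (A n). Proof. exact: measurable_average_discr. Qed.

Let mAsh u n : measurable_fun setT (Ash u n).
Proof. exact: measurable_average_discr. Qed.

(** Shifted averages have the same radius, so they are minimizing as well and
    [average_discr_close] applies at every [n]. *)
Lemma ae_average_shift (u v : nat -> R) : {ae P, forall g,
  (fun n => Ash (u n) n g - Ash (v n) n g) @ \oo --> 0}.
Proof.
have : {ae P, forall g, exists K, forall n,
    `|Ash (u n) n g - Ash (v n) n g| <= K * 2^-1 ^+ n}.
  apply: (@ae_geometric _ _ _ P (fun n g => Ash (u n) n g - Ash (v n) n g) 4).
    by move=> n; exact: measurable_funB.
  move=> n; apply: le_trans (average_discr_close statP varP _ _) _.
  rewrite lee_fin !(radius_shift statP).
  by have := minp n; lra.
by apply: filterS => g [K hK]; exact: geometric_cvg0 hK.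
Qed.

(** The superior limit makes the phase measurable without reference to
    convergence. *)
Definition phase g : R := fine (limn_esup (fun n => (A n g)%:E)).

Lemma measurable_phase : measurable_fun setT phase.
Proof.
apply: (measurableT_comp (@fine_measurable R setT measurableT)).
by apply: measurable_fun_limn_esup => n; exact/measurable_EFinP.
Qed.

Lemma phaseE g (y : R) : A ^~ g @ \oo --> y -> phase g = y.
Proof.
move=> Ay; rewrite /phase.
have : (fun n => (A n g)%:E) @ \oo --> y%:E by apply: cvg_EFin => //; exact: nearW.
by move=> /cvg_limn_einf_sup[_ ->].
Qed.

Lemma ae_phase : {ae P, forall g, A ^~ g @ \oo --> phase g}.
Proof.
have : {ae P, forall g, exists K, forall n,
    `|A n.+1 g - A n g| <= K * 2^-1 ^+ n}.
  apply: (@ae_geometric _ _ _ P (fun n g => A n.+1 g - A n g) 4).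
    by move=> n; exact: measurable_funB.
  move=> n; apply: le_trans (average_discr_close statP varP _ _) _.
  rewrite lee_fin; have := minp n; have := minp n.+1.
  have : (8^-1 : R) ^+ n.+1 <= 8^-1 ^+ n.
    by rewrite exprS ler_piMl ?exprn_ge0// invf_le1// ler1n.
  by lra.
apply: filterS => g [K hK].
have /cvg_ex[y Ay] := geometric_increments_cvg hK.
by rewrite (phaseE Ay).
Qed.

(** Convergence is only asked along rational shifts, so that this is a
    measurable set; [phased_shift] recovers the real ones. *)
Definition phased : set (config R) := [set g |
  (fun n => A n g - phase g) @ \oo --> 0 /\
  forall q : rat, (fun n => Ash (ratr q) n g - A n g) @ \oo --> 0].

Lemma measurable_phased : measurable phased.
Proof.
apply: measurableI.
  apply: (measurable_cvg0 (f := fun n g => A n g - phase g)) => n.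
  by apply: measurable_funB => //; exact: measurable_phase.
apply: (measurable_forall_rat (A := fun q =>
  [set g | (fun n => Ash (ratr q) n g - A n g) @ \oo --> 0])) => q.
apply: (measurable_cvg0 (f := fun n g => Ash (ratr q) n g - A n g)) => n.
exact: measurable_funB.
Qed.

Let A_shift0 n g : A n g = Ash 0 n g.
Proof.
rewrite /A /Ash /average_discr average_eval_shift; congr average_eval.
by apply/funext => x; rewrite addr0.
Qed.

Lemma ae_phased : {ae P, forall g, phased g}.
Proof.
have h1 := ae_phase.
have h2 : {ae P, forall g, forall q : rat,
    (fun n => Ash (ratr q) n g - A n g) @ \oo --> 0}.
  apply: ae_forall_rat => q.
  have := ae_average_shift (fun=> ratr q) (fun=> 0).
  by apply: filterS => g; under eq_fun do rewrite -A_shift0.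
apply: filterS2 h1 h2 => g h1 h2; split => //.
rewrite -[X in _ --> X](subrr (phase g)).
by apply: cvgB => //; exact: cvg_cst.
Qed.

Lemma phased_prob : P phased = 1%E.
Proof.
have [N [mN PN0 sub]] := ae_phased.
have : P (~` phased) = 0%E.
  apply: (subset_measure0 (measurableC measurable_phased) mN) => //.
rewrite probability_setC; last exact: measurable_phased.
have mph := measurable_phased.
move=> /eqP; rewrite sube_eq ?fin_num_measure//.
by rewrite add0e => /eqP <-.
Qed.

Lemma average_shift_mono (u v : R) n g : u <= v -> Ash u n g <= Ash v n g + (v - u).
Proof.
move=> uv; rewrite /Ash /average_discr !average_eval_shift -average_eval_affine.
apply: average_eval_le => x; rewrite /discr.
have := @counting_mono R g (x + u) (x + v); rewrite lerD2l => /(_ uv).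
lra.
Qed.

(** Monotonicity of the counting function passes from rational to real shifts. *)
Lemma phased_shift g (u : R) : phased g ->
  (fun n => Ash u n g - A n g) @ \oo --> 0.
Proof.
move=> [_ h]; apply/cvgrPdist_le => e e0.
have e2 : u < u + e / 2 by rewrite ltrDl divr_gt0.
have e2' : u - e / 2 < u by rewrite ltrBlDr ltrDl divr_gt0.
have [q2 /[!in_itv]/= /andP[uq2 q2e]] := rat_in_itvoo e2.
have [q1 /[!in_itv]/= /andP[q1e q1u]] := rat_in_itvoo e2'.
have /cvgrPdist_le/(_ (e / 2)) h1 := h q1.
have /cvgrPdist_le/(_ (e / 2)) h2 := h q2.
have e20 : 0 < e / 2 by rewrite divr_gt0.
near=> n.
have := average_shift_mono n g (ltW uq2).
have := average_shift_mono n g (ltW q1u).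
have : `|0 - (Ash (ratr q1) n g - A n g)| <= e / 2 by near: n; exact: h1.
have : `|0 - (Ash (ratr q2) n g - A n g)| <= e / 2 by near: n; exact: h2.
rewrite !sub0r !normrN !ler_norml => /andP[a1 a2] /andP[b1 b2] c1 c2.
by apply/andP; split; lra.
Unshelve. all: by end_near.
Qed.

Lemma phased_cvg g : phased g -> A ^~ g @ \oo --> phase g.
Proof.
move=> [h _]; rewrite (_ : A ^~ g = fun n => A n g - phase g + phase g).
  by rewrite -[X in _ --> X]add0r; apply: cvgD => //; exact: cvg_cst.
by apply/funext => n; rewrite subrK.
Qed.

Let A_translate u n g : A n (translate u g) = Ash (- u) n g - discr g (- u).
Proof. by rewrite /Ash average_discr_shift opprK addrK. Qed.

Let Ash_translate u v n g :
  Ash v n (translate u g) = Ash (v - u) n g - discr g (- u).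
Proof.
have -> : Ash (v - u) n g = average_discr (average_shift (- u) (average_shift v (p_ n))) g.
  rewrite /Ash /average_discr !average_eval_shift; congr average_eval.
  by apply/funext => x; congr discr; ring.
by rewrite average_discr_shift opprK addrK.
Qed.

(** Translating the configuration moves the averages, which does not affect the
    limit, and changes the origin of the counting function. *)
Lemma phase_translate u g : phased g ->
  phase (translate u g) = phase g - discr g (- u).
Proof.
move=> pg; apply: phaseE.
rewrite (_ : A ^~ _ = fun n => (Ash (- u) n g - A n g) + A n g - discr g (- u)).
  apply: cvgB; last exact: cvg_cst.
  rewrite -[X in _ --> X]add0r; apply: cvgD; first exact: phased_shift.
  exact: phased_cvg.
by apply/funext => n; rewrite A_translate; ring.
Qed.

Lemma phased_translate u g : phased g -> phased (translate u g).
Proof.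
move=> pg; split.
  rewrite (_ : (fun n => _) = fun n => (Ash (- u) n g - A n g) + (A n g - phase g)).
    rewrite -[X in _ --> X]addr0; apply: cvgD; first exact: phased_shift.
    by case: pg.
  by apply/funext => n; rewrite A_translate phase_translate//; ring.
move=> q.
rewrite (_ : (fun n => _) = fun n => (Ash (ratr q - u) n g - A n g) - (Ash (- u) n g - A n g)).
  by rewrite -[X in _ --> X](subrr 0); apply: cvgB; exact: phased_shift.
by apply/funext => n; rewrite A_translate Ash_translate; ring.
Qed.

(** Fatou, from [average_discr_dist]. *)
Lemma msq_discr_phase (x : R) :
  (msq P (fun g => discr g x - phase g)%R <= (4 * C)%:E)%E.
Proof.
have mD n : measurable_fun setT (fun g => ((discr g x - A n g) ^+ 2)%:E).
  by apply: measurable_sqr; apply: measurable_funB => //; exact: measurable_discr.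
apply: (@le_trans _ _ (limn_einf (fun n => \int[P]_g ((discr g x - A n g) ^+ 2)%:E))%E).
  apply: le_trans (fatou P measurableT mD _); last first.
    by move=> n g _; rewrite lee_fin sqr_ge0.
  rewrite /msq le_eqVlt; apply/orP; left; apply/eqP; apply: ge0_ae_eq_integral => //.
  - apply: measurable_sqr; apply: measurable_funB; first exact: measurable_discr.
    exact: measurable_phase.
  - apply: measurableT_comp => //.
    by apply: measurable_fun_limn_esup => n; exact: measurableT_comp.
  - by move=> g _; rewrite lee_fin sqr_ge0.
  - move=> g _; rewrite limn_einf_lim; apply: lime_ge; first exact: is_cvg_einfs.
    apply: nearW => n; apply: le_ereal_inf_tmp => _ [m _ <-].
    by rewrite lee_fin sqr_ge0.
  - apply: filterS ae_phase => g Ag _.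
    have : (fun n => ((discr g x - A n g) ^+ 2)%:E) @ \oo --> ((discr g x - phase g) ^+ 2)%:E.
      apply: cvg_EFin; first exact: nearW.
      rewrite /comp/= !expr2.
      have : (fun n => discr g x - A n g) @ \oo --> discr g x - phase g.
        by apply: cvgB => //; exact: cvg_cst.
      by move=> h; apply: cvgM.
    by move=> /cvg_limn_einf_sup[-> _].
rewrite limn_einf_lim; apply: lime_le; first exact: is_cvg_einfs.
apply: nearW => n; apply: (@le_trans _ _ (\int[P]_g ((discr g x - A n g) ^+ 2)%:E)%E).
  by apply: ereal_inf_lbound; exists n => /=.
apply: le_trans (average_discr_dist statP varP (p_ n) x).
rewrite le_eqVlt; apply/orP; left; apply/eqP; apply: eq_integral => g _.
by rewrite -sqrrN opprB.
Qed.

End phase.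

(** * Intensity and hyperuniformity *)

Section intensity.
Context {R : realType} (P : probability (config R) R).

Definition intensity (A : set (measurableTypeR R)) : \bar R :=
  (\int[P]_g g A)%E.

Let intensity0 : intensity set0 = 0%E.
Proof. by rewrite /intensity integral0_eq. Qed.

Let intensity_ge0 A : (0 <= intensity A)%E.
Proof. exact: integral_ge0. Qed.

Let intensity_sigma_additive : semi_sigma_additive intensity.
Proof.
move=> U mU tU mUU; rewrite [X in _ --> X](_ : _ =
  \int[P]_g (\sum_(n <oo) g (U n))%E)%E; last first.
  apply: eq_integral => g _; apply/esym/cvg_lim => //.
  exact: (@measure_semi_sigma_additive _ _ _ (config_measure g)).
apply/cvg_closeP; split.
  by apply: is_cvg_nneseries => n _ _; exact: integral_ge0.
rewrite closeE// integral_nneseries// => n.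
exact: (measurable_config_ev (mU n)).
Qed.

HB.instance Definition _ := isMeasure.Build _ _ R
  intensity intensity0 intensity_ge0 intensity_sigma_additive.

Variable C : R.
Hypothesis statP : stationary P.
Hypothesis varP : forall x, 0 < x ->
  (\int[P]_g ((cnt g 0 x - x) ^+ 2)%:E <= C%:E)%E.

Let mcnt a b : measurable_fun setT (fun g : config R => cnt g a b).
Proof. exact: measurable_cnt2. Qed.

Let mcntE a b : measurable_fun setT (fun g : config R => (cnt g a b)%:E).
Proof. exact/measurable_EFinP. Qed.

Let cnt0 a b (g : config R) : (0 <= (cnt g a b)%:E)%E.
Proof. by rewrite lee_fin cnt_ge0. Qed.

Let mean (a b : R) : \bar R := (\int[P]_g (cnt g a b)%:E)%E.

Let mean_shift a b u : mean (a + u) (b + u) = mean a b.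
Proof.
rewrite /mean -[RHS](stationary_integral statP (- u))//.
by apply: eq_integral => g _; rewrite cnt_translate !opprK.
Qed.

Let mean_add a b c : a <= b -> b <= c -> mean a c = (mean a b + mean b c)%E.
Proof.
move=> ab bc; rewrite /mean -ge0_integralD//.
by apply: eq_integral => g _; rewrite -EFinD -cntD.
Qed.

Let mean_bounds x : 0 < x ->
  (mean 0 x <= (x + (1 + C))%:E)%E /\ (x%:E <= mean 0 x + (1 + C)%:E)%E.
Proof.
move=> x0.
have msq' : measurable_fun setT (fun g : config R => ((cnt g 0 x - x) ^+ 2)%:E).
  by apply: measurable_sqr; apply: measurable_funB.
have sq0 (g : config R) : (0 <= ((cnt g 0 x - x) ^+ 2)%:E)%E by rewrite lee_fin sqr_ge0.
have int1 (y : R) : 0 <= y ->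
    (\int[P]_g (y%:E + ((cnt g 0 x - x) ^+ 2)%:E) <= (y + C)%:E)%E.
  move=> y0; rewrite ge0_integralD// probability_integral_cst EFinD leeD2l//.
  exact: varP.
have dev (g : config R) : `|cnt g 0 x - x| <= 1 + (cnt g 0 x - x) ^+ 2.
  rewrite -[in leRHS]real_normK ?num_real//; move: `|_| => t.
  have := sqr_ge0 (t - 2^-1); rewrite -subr_ge0 => h; rewrite -subr_ge0.
  rewrite (_ : _ - _ = (t - 2^-1) ^+ 2 + 3 / 4); last by field.
  by rewrite addr_ge0// sqr_ge0.
split.
  rewrite addrA; apply: le_trans (int1 (x + 1) _); last by rewrite addr_ge0// ltW.
  apply: ge0_le_integral => //; first exact: emeasurable_funD.
  move=> g _; rewrite -EFinD lee_fin.
  by have := dev g; rewrite ler_norml => /andP[_]; lra.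
rewrite -(probability_integral_cst P x).
apply: (@le_trans _ _ (\int[P]_g ((cnt g 0 x)%:E + (1%:E + ((cnt g 0 x - x) ^+ 2)%:E)))%E).
  apply: ge0_le_integral => //.
  - by move=> g _; rewrite lee_fin ltW.
  - by apply: emeasurable_funD => //; exact: emeasurable_funD.
  - move=> g _; rewrite -!EFinD lee_fin.
    by have := dev g; rewrite ler_norml => /andP[+ _]; lra.
rewrite ge0_integralD//.
- by rewrite leeD2l// int1.
- by move=> g _; rewrite adde_ge0.
- exact: emeasurable_funD.
Qed.

Let mean_multiple x (n : nat) : 0 < x ->
  mean 0 (n%:R * x) = (n%:R%:E * mean 0 x)%E.
Proof.
move=> x0; elim: n => [|n IH].
  rewrite mul0r mul0e /mean integral0_eq// => g _.
  by rewrite cnt_eq0.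
rewrite -natr1 mulrDl mul1r (@mean_add _ (n%:R * x)).
- have -> : mean (n%:R * x) (n%:R * x + x) = mean 0 x.
    by have := mean_shift 0 x (n%:R * x); rewrite add0r addrC.
  rewrite IH [in RHS]EFinD ge0_muleDl ?lee_fin//.
  by rewrite mul1e.
- by rewrite mulr_ge0// ltW.
- by rewrite lerDl ltW.
Qed.

(** A stationary process whose counts stay within bounded mean square of the
    lengths has unit intensity: otherwise the mean error would grow linearly. *)
Lemma mean_cnt x : 0 < x -> mean 0 x = x%:E.
Proof.
move=> x0.
have [up low] := mean_bounds x0.
have fin : mean 0 x \is a fin_num.
  by rewrite ge0_fin_numE ?integral_ge0// (le_lt_trans up)// ltry.
rewrite -(fineK fin); congr _%:E; apply/eqP; rewrite -subr_eq0; apply/eqP.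
set m := fine _.
have bound n : n%:R * `|m - x| <= 1 + C.
  have [->|n0] := posnP n.
    rewrite mul0r; have := varP x0; rewrite -lee_fin EFinD => h.
    by rewrite adde_ge0// (le_trans _ h)// integral_ge0// => g _; rewrite lee_fin sqr_ge0.
  have nx0 : 0 < n%:R * x by rewrite mulr_gt0// ltr0n.
  have [] := mean_bounds nx0; rewrite mean_multiple// -(fineK fin) -/m.
  rewrite -!EFinM -!EFinD !lee_fin => h1 h2.
  rewrite -(ger0_norm (ler0n R n)) -normrM ler_norml mulrBr.
  by apply/andP; split; lra.
apply/eqP; rewrite -normr_eq0; apply/negPn/negP => mx0.
have mx : 0 < `|m - x| by rewrite lt0r mx0 normr_ge0.
have := bound (Num.truncn ((1 + C) / `|m - x|)).+1.
by rewrite -ler_pdivlMr// leNgt truncnS_gt.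
Qed.

Lemma stationary_unit_intensity : unit_intensity P.
Proof.
move=> A mA; rewrite -[LHS]/(intensity A); apply/esym.
apply: lebesgue_measure_unique => // _ [[a b] _ <-] /=.
rewrite /intensity; under eq_integral do rewrite cntE.
rewrite [LHS]lebesgue_measure_itv/= lte_fin; case: ltP => ab; last first.
  by rewrite integral0_eq// => g _; rewrite cnt_eq0.
rewrite -[RHS]/(mean a b); have := mean_shift 0 (b - a) a.
by rewrite add0r subrK => ->; rewrite mean_cnt ?subr_gt0.
Qed.

(** By [stationary_unit_intensity] the expected number of points at [a] is the
    Lebesgue measure of a point. *)
Lemma ae_point_null (a : R) : {ae P, forall g : config R, g [set a] = 0%E}.
Proof.
have ma := measurable_config_ev (measurable_set1 a).
have : (\int[P]_g `|config_ev [set a] g| = 0)%E.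
  under eq_integral do rewrite gee0_abs//.
  by rewrite (stationary_unit_intensity (measurable_set1 a)) [LHS]lebesgue_measure_set1.
move=> h; have : ae_eq P setT (@config_ev R [set a]) (cst 0%E).
  by apply/(ae_eq_integral_abs P measurableT ma).
by apply: filterS => g /(_ I).
Qed.

Let variance_cnt a b : a <= b -> (msq P (fun g => cnt g a b - (b - a))%R <= C%:E)%E.
Proof.
move=> ab.
have C0 : (0 <= C%:E)%E.
  apply: le_trans (varP ltr01); exact: (msq_ge0 P (fun g => cnt g 0 1 - 1)).
have [ba|ba] := leP b a.
  rewrite /msq integral0_eq// => g _.
  have <- : a = b by apply/eqP; rewrite eq_le ab.
  by rewrite cnt_eq0// subrr subrr expr0n.
have ba0 : 0 < b - a by rewrite subr_gt0.
apply: le_trans (varP ba0).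
have mf : measurable_fun setT (fun g : config R => cnt g 0 (b - a) - (b - a)).
  exact: measurable_funB.
rewrite le_eqVlt; apply/orP; left; apply/eqP.
rewrite -[RHS](stationary_msq statP (- a) mf); apply: eq_integral => g _.
by rewrite cnt_translate opprK add0r subrK.
Qed.

(** The endpoints of an interval almost surely carry no point, so half-open
    intervals suffice, and for those the bound is the hypothesis. *)
Lemma stationary_hyperuniform : hyperuniform_I P.
Proof.
have C0 : (0 <= C%:E)%E.
  apply: le_trans (varP ltr01); exact: (msq_ge0 P (fun g => cnt g 0 1 - 1)).
exists C => I iI bI.
have mI : measurable I by exact: is_interval_measurable.
have [->|/set0P[x0 Ix0]] := eqVneq I set0.
  rewrite (_ : number_in set0 = cst 0) ?variance_cst//.
  by apply/funext => g; rewrite /number_in measure0.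
have [M M0 IM] := pinfty_ex_gt0 bI.
have hasu : has_ubound I by exists M => y /IM; exact: le_trans (ler_norm _).
have hasl : has_lbound I.
  by exists (- M) => y /IM /=; rewrite ler_norml => /andP[].
pose a := inf I; pose b := sup I.
have aI y : I y -> a <= y by move=> Iy; exact: inf_lbound.
have Ib y : I y -> y <= b by move=> Iy; exact: ub_le_sup.
have ab : a <= b by rewrite (le_trans (aI _ Ix0))// Ib.
have IE y : a < y < b -> I y.
  move=> /andP[ay yb].
  have [u Iu uy] := @inf_lt _ I y (ex_intro _ x0 Ix0) ay.
  have [v Iv yv] := @sup_gt _ I y (ex_intro _ x0 Ix0) yb.
  by apply: (iI u v) => //; rewrite (ltW uy) (ltW yv).
have aeI : {ae P, forall g : config R, number_in I g = cnt g a b}.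
  have ha := ae_point_null a; have hb := ae_point_null b.
  apply: filterS2 ha hb => g ga gb; rewrite /number_in /cnt; congr fine.
  have null (A : set R) : measurable A -> A `<=` [set a] `|` [set b] -> g A = 0%E.
    move=> mA Aab; apply: (@subset_measure0 _ _ _ (config_measure g) A ([set a] `|` [set b])) => //.
      exact: measurableU.
    apply/eqP; rewrite -measure_le0 (le_trans (measureU2 _ _ _))//.
    by rewrite [X in (X + _ <= _)%E]ga [X in (_ + X <= _)%E]gb adde0.
  have mo : measurable `]a, b[%classic by exact: measurable_itv.
  have decomp (A : set R) : measurable A -> `]a, b[%classic `<=` A ->
      A `<=` `[a, b]%classic -> g A = g `]a, b[%classic.
    move=> mA oA Ac; rewrite -(setDUK oA) measureU//.
    - rewrite [X in (_ + X)%E]null ?adde0//; first exact: measurableD.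
      move=> y [/Ac + /= nab]; rewrite /= in_itv/= => /andP[ay yb].
      have [ya|ya] := eqVneq y a; [by left|right].
      apply/eqP; rewrite eq_le yb/= leNgt; apply/negP => yb'; apply: nab.
      by rewrite in_itv/= yb' lt_neqAle eq_sym ya ay.
    - exact: measurableD.
    - by rewrite setDE setICA setICr setI0.
  rewrite !decomp//.
  - by move=> y; rewrite /= !in_itv/= => /andP[-> /ltW ->].
  - by move=> y; rewrite /= !in_itv/= => /andP[/ltW -> ->].
  - by move=> y Iy; rewrite /= in_itv/= aI// Ib.
have mN : measurable_fun setT (number_in I : config R -> R).
  exact: (measurableT_comp (@fine_measurable R setT measurableT) (measurable_config_ev mI)).
have EI : fine 'E_P[number_in I] = b - a.
  rewrite unlock; rewrite (_ : integral _ _ _ = (b - a)%:E)//.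
  rewrite (ge0_ae_eq_integral (g := fun g => (cnt g a b)%:E))//.
  - have [ba|ba] := leP b a.
      have <- : a = b by apply/eqP; rewrite eq_le ab.
      by rewrite integral0_eq ?subrr// => g _; rewrite cnt_eq0.
    have := mean_shift 0 (b - a) a; rewrite add0r subrK mean_cnt ?subr_gt0//.
  - exact/measurable_EFinP.
  - by move=> g _; rewrite lee_fin /number_in fine_ge0.
  - by apply: filterS aeI => g /= -> _.
rewrite /variance covariance.unlock EI expectation.unlock.
apply: le_trans (variance_cnt ab).
rewrite le_eqVlt; apply/orP; left; apply/eqP.
apply: ge0_ae_eq_integral => //.
- apply/measurable_EFinP; apply: measurable_funM; exact: measurable_funB.
- by apply: measurable_sqr; exact: measurable_funB.
- by move=> g _; rewrite lee_fin -expr2 sqr_ge0.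
- by move=> g _; rewrite lee_fin sqr_ge0.
apply: filterS aeI => g E _.
change (((number_in I g - (b - a)) * (number_in I g - (b - a)))%:E =
  ((cnt g a b - (b - a)) ^+ 2)%:E).
by rewrite E expr2.
Qed.

(** * Number rigidity *)

Variable p_ : nat -> average R.
Hypothesis minp : forall n, radius P (p_ n) <= min_radius P + 8^-1 ^+ n.

(** The same phase is read off averages located far to the right and far to the
    left of a window; comparing the two gives the number of points inside. *)
Lemma window_count (a b : R) : a <= b ->
  exists W : nat -> config R -> R,
  [/\ forall n, measurable_fun setT (W n),
      forall n (g h : config R),
        (forall x, b <= x -> cnt g b x = cnt h b x) ->
        (forall x, x <= a -> cnt g x a = cnt h x a) -> W n g = W n h &
      {ae P, forall g, W ^~ g @ \oo --> cnt g a b}].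
Proof.
move=> ab.
pose K n := sval (cid (average_within_bounds (p_ n))).
have KP n : 0 < K n /\ average_within (- K n) (K n) (p_ n).
  by rewrite /K; case: cid.
pose pr n := average_shift (b + K n) (p_ n).
pose pl n := average_shift (a - K n) (p_ n).
have prP n : average_within b (b + K n *+ 2) (pr n).
  have [_ /(average_within_shift (b + K n))] := KP n.
  by rewrite addrCA addNr addr0 addrCA -mulr2n.
have plP n : average_within (a - K n *+ 2) a (pl n).
  have [_ /(average_within_shift (a - K n))] := KP n.
  rewrite /pl; move: (K n) => k.
  have -> : - k + (a - k) = a - k *+ 2 by rewrite mulr2n; ring.
  by have -> : k + (a - k) = a by ring.
pose W n (g : config R) := average_eval (pl n) (fun x => - cnt g x a - x) -
  average_eval (pr n) (fun x => cnt g b x - x).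
have mev p (F : config R -> R -> R) : (forall x, measurable_fun setT (F ^~ x)) ->
    measurable_fun setT (fun g => average_eval p (F g)).
  move=> mF; elim: p => [x|p IHp q IHq]; first exact: mF.
  by apply: measurable_funD; exact: measurable_funM.
exists W; split.
- move=> n; apply: measurable_funB.
    apply: (mev (pl n) (fun g x => - cnt g x a - x)) => x.
    by apply: measurable_funB => //; exact: measurableT_comp.
  by apply: (mev (pr n) (fun g x => cnt g b x - x)) => x; exact: measurable_funB.
- move=> n g h gr gl; congr (_ - _).
    by apply: (average_eval_ext (plP n)) => x /andP[_ xa]; rewrite gl.
  by apply: (average_eval_ext (prP n)) => x /andP[bx _]; rewrite gr.
have := ae_average_shift statP varP minp (fun n => b + K n) (fun n => a - K n).
apply: filterS => g h.
have Wg n : W n g = cnt g a b - (average_discr (pr n) g - average_discr (pl n) g).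
  have -> : average_discr (pr n) g =
      average_eval (pr n) (fun x => cnt g b x - x) + counting g b.
    rewrite -average_eval_affine; apply: (average_eval_ext (prP n)) => x /andP[bx _].
    by rewrite /discr (cnt_counting _ bx); ring.
  have -> : average_discr (pl n) g =
      average_eval (pl n) (fun x => - cnt g x a - x) + counting g a.
    rewrite -average_eval_affine; apply: (average_eval_ext (plP n)) => x /andP[_ xa].
    by rewrite /discr (cnt_counting _ xa); ring.
  by rewrite /W (cnt_counting _ ab); ring.
rewrite (_ : W ^~ g = fun n => cnt g a b - (average_discr (pr n) g - average_discr (pl n) g)).
  by rewrite -[X in _ --> X]subr0; apply: cvgB => //; exact: cvg_cst.
exact/funext.
Qed.

(** Counts the points of a window around [A] from outside the window and
    subtracts those outside [A]. *)
Lemma stationary_number_rigid : number_rigid P.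
Proof.
move=> A mA bA.
have [M M0 AM] := pinfty_ex_gt0 bA.
(* the half-open window from a to b must contain - M *)
pose a := - M - 1; pose b := M.
have ab : a <= b by rewrite /a /b; lra.
have [W [mW Wext Wcvg]] := window_count ab.
have mab : measurable (`]a, b]%classic : set R) by exact: measurable_itv.
have Aab : A `<=` `]a, b]%classic.
  move=> x /AM /=; rewrite ler_norml in_itv/= => /andP[x1 x2].
  by rewrite x2 andbT (lt_le_trans _ x1)// /a; lra.
exists (fun h : config R => limn_esup (fun n => (W n h)%:E) - h `]a, b]%classic)%E.
  apply: emeasurable_funB; last exact: (measurable_config_ev mab).
  by apply: measurable_fun_limn_esup => n; exact/measurable_EFinP.
apply: filterS Wcvg => g Wg.
set h := restrict_config (measurableC mA) g.
have hE B : h B = g (B `&` ~` A) by [].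
have Wh n : W n h = W n g.
  apply: Wext => x bx; rewrite /cnt hE; congr (fine (g _)); apply/setIidl => y;
    rewrite /= in_itv/= => /andP[y1 y2] /Aab; rewrite /= in_itv/= => /andP[y3 y4].
    by move: y1; rewrite ltNge y4.
  by move: y3; rewrite ltNge y2.
have -> : limn_esup (fun n => (W n h)%:E) = (cnt g a b)%:E.
  have : (fun n => (W n h)%:E) @ \oo --> (cnt g a b)%:E.
    by under eq_fun do rewrite Wh; apply: cvg_EFin => //; exact: nearW.
  by move=> /cvg_limn_einf_sup[].
rewrite hE -cntE -{1}(setDUK Aab) measureU//.
- rewrite -setDE addeK//; apply: config_fin; first exact: measurableD.
  apply: (@sub_boundedr _ _ _ _ (globally `]a, b]%classic)); last exact: bounded_oc.
  by move=> Pr; rewrite /globally/= => PD y [/PD].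
- exact: measurableD.
- by rewrite setDE setICA setICr setI0.
Qed.

End intensity.

(** * Cyclic factor *)

Section frac.
Context {R : realType}.
Implicit Types x y : R.

Definition frac x : R := x - (Num.floor x)%:~R.

Lemma frac_itv x : 0 <= frac x < 1.
Proof.
have /andP[h1 h2] := floor_itv x; rewrite /frac subr_ge0 h1/=.
by rewrite ltrBlDr addrC; move: h2; rewrite rmorphD.
Qed.

Lemma frac_id x : 0 <= x < 1 -> frac x = x.
Proof. by move=> h; rewrite /frac (@floor_def _ x 0) ?subr0. Qed.

Lemma frac_addz x (z : int) : frac (x + z%:~R) = frac x.
Proof. by rewrite /frac floorDrz ?intr_int// intrKfloor rmorphD; ring. Qed.

Lemma frac_eq x y (z : int) : x = y + z%:~R -> frac x = frac y.
Proof. by move=> ->; exact: frac_addz. Qed.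

Lemma frac_add x y : frac (frac x + y) = frac (x + y).
Proof. by apply: (@frac_eq _ _ (- Num.floor x)); rewrite /frac rmorphN/=; ring. Qed.

Lemma measurable_frac : measurable_fun setT frac.
Proof.
apply: measurable_funB => //.
apply: nondecreasing_measurable => // x y xy.
by rewrite ler_int floor_ge_int; exact: le_trans (floor_le x) xy.
Qed.

(** A rotation by [t] that does not wind from its start does not wind back
    from its end either. *)
Lemma frac_rotation (c t : R) : 0 <= c < 1 ->
  (0 <= c + t < 1) = (0 <= frac (c + t) - t < 1).
Proof.
move=> /andP[c0 c1]; apply/idP/idP => [h|].
  by rewrite frac_id// addrK c0.
rewrite /frac; set k := Num.floor _ => /andP[h1 h2].
have k0 : k = 0.
  apply/eqP; rewrite eq_le; apply/andP; split.
    rewrite -ltzD1 -(ltr_int R) rmorphD/=; lra.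
  by rewrite -ltzD1 -(ltr_int R) rmorphD/=; lra.
by have := floor_itv (c + t); rewrite -/k k0 add0r.
Qed.

End frac.

Lemma probability_ae_eq d (T : measurableType d) {R : realType}
    (mu : probability T R) (A B : set T) : measurable A -> measurable B ->
  {ae mu, forall w, A w = B w} -> mu A = mu B.
Proof.
move=> mA mB AB; rewrite -[A]setIT -[B]setIT -!integral_indic//.
apply: ge0_ae_eq_integral => //; try exact/measurable_EFinP/measurable_indic.
apply: filterS AB => w ABw _; rewrite !indicE; congr (_%:R%:E).
by congr nat_of_bool; apply/idP/idP; rewrite !inE ABw.
Qed.

Section cyclic_factor.
Context {R : realType} (P : probability (config R) R) (C : R).
Local Notation leb := (@lebesgue_measure R).
Hypothesis statP : stationary P.
Hypothesis varP : forall x, 0 < x ->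
  (\int[P]_g ((cnt g 0 x - x) ^+ 2)%:E <= C%:E)%E.
Variable p_ : nat -> average R.
Hypothesis minp : forall n, radius P (p_ n) <= min_radius P + 8^-1 ^+ n.
Implicit Types g : config R.

Local Notation phased := (phased p_).

(** The lattice with the phase of [g] is the shift of the integers by
    [- phase p_ g], of which only the fractional part matters. *)
Definition angle g : R := frac (- phase p_ g).

Lemma measurable_angle : measurable_fun setT angle.
Proof.
apply: (measurableT_comp measurable_frac).
by apply: measurable_funN; exact: measurable_phase.
Qed.

Lemma angle_itv g : 0 <= angle g < 1. Proof. exact: frac_itv. Qed.

(** The counting function being integer valued, [phase_translate] becomes a
    rotation. *)
Lemma angle_translate u g : phased g -> angle (translate u g) = frac (angle g + u).
Proof.
move=> pg; rewrite /angle frac_add (phase_translate u pg) /discr.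
have [z ->] := counting_int g (- u).
by apply: (@frac_eq _ _ _ z); ring.
Qed.

(** Rotates the angle back to 0. *)
Definition unwind g : config R := translate (- angle g) g.

Lemma measurable_unwind : measurable_fun setT unwind.
Proof.
apply: measurable_translate2 => //.
by apply: measurable_funN; exact: measurable_angle.
Qed.

HB.instance Definition _ := isMeasurableFun.Build _ _ _ _ unwind measurable_unwind.

Definition unwound_law : probability (config R) R := distribution P unwind.

Lemma translate_unwind u g : translate u (unwind g) = translate (- angle g + u) g.
Proof. by rewrite /unwind translateD. Qed.

Definition angle_set (u : R) : set (config R) :=
  phased `&` [set g | angle g = u].

Lemma measurable_angle_set u : measurable (angle_set u).
Proof.
apply: measurableI; first exact: measurable_phased.
have := measurable_angle measurableT (measurable_set1 u); rewrite setTI.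
by congr measurable; apply/seteqP; split.
Qed.

Lemma unwound_angle_set u : 0 <= u < 1 ->
  translate_law u unwound_law (angle_set u) = 1%E.
Proof.
move=> u01.
rewrite -[LHS]/(P [set g | angle_set u (translate u (unwind g))]).
have mS : measurable [set g | angle_set u (translate u (unwind g))].
  have := measurableT_comp (measurable_translate u) measurable_unwind.
  move=> /(_ measurableT _ (measurable_angle_set u)); rewrite setTI.
  by congr measurable; apply/seteqP; split.
apply/eqP; rewrite eq_le probability_le1//=.
rewrite -(phased_prob statP varP minp); apply: le_measure; rewrite ?inE//.
  exact: measurable_phased.
move=> g pg; rewrite /= translate_unwind; split; first exact: phased_translate.
rewrite /= angle_translate// (_ : angle g + (- angle g + u) = u); last by ring.
exact: frac_id.
Qed.

Lemma unwound_Z_stationary : Z_stationary unwound_law.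
Proof.
move=> z A mA.
rewrite -[LHS]/(P [set g | A (translate z%:~R (unwind g))]).
rewrite -[RHS]/(P [set g | A (unwind g)]).
have mS : measurable [set g | A (unwind g)].
  have := measurable_unwind measurableT mA; rewrite setTI.
  by congr measurable; apply/seteqP; split.
have mS' : measurable [set g | A (translate z%:~R (unwind g))].
  have := measurableT_comp (measurable_translate z%:~R) measurable_unwind.
  move=> /(_ measurableT _ mA); rewrite setTI.
  by congr measurable; apply/seteqP; split.
rewrite -[RHS](statP z%:~R mS) /translate_law /pushforward.
have mS2 : measurable (translate z%:~R @^-1` [set g | A (unwind g)]).
  by rewrite -[X in measurable X]setTI; exact: measurable_translate.
have pE g : phased g -> A (translate z%:~R (unwind g)) =
    (translate z%:~R @^-1` [set g | A (unwind g)]) g.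
  move=> pg; rewrite /preimage/= translate_unwind /unwind translateD.
  rewrite angle_translate// frac_addz frac_id ?angle_itv//.
  by rewrite addrC.
apply: probability_ae_eq => //.
by apply: filterS (ae_phased statP varP minp) => g /pE.
Qed.

(** Stationarity would make the law sit on the disjoint sets of angle 0 and
    [2^-1] at the same time. *)
Lemma unwound_not_stationary : ~ stationary unwound_law.
Proof.
move=> st; pose h : R := 2^-1.
have h01 : 0 <= h < 1 by rewrite /h; apply/andP; split; lra.
have e1 := unwound_angle_set h01.
have : unwound_law (angle_set 0) = 1%E.
  rewrite -(st 0 _ (measurable_angle_set 0)) unwound_angle_set//.
  by rewrite lexx ltr01.
have : unwound_law (angle_set h) = 1%E by rewrite -(st h _ (measurable_angle_set h)).
move=> h1 h0.
have : unwound_law (angle_set 0 `|` angle_set h) = (1 + 1)%E.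
  rewrite measureU//; [|exact: measurable_angle_set|exact: measurable_angle_set|].
    by rewrite -[X in (X + _)%E]h0 -[X in (_ + X)%E]h1.
  apply/seteqP; split => // g [[_ g0] [_ gh]].
  have : h = 0 by rewrite -gh -g0.
  by move=> /eqP; rewrite /h invr_eq0 pnatr_eq0.
have : (unwound_law (angle_set 0 `|` angle_set h) <= 1)%E.
  by apply: probability_le1; apply: measurableU; exact: measurable_angle_set.
move=> h2 h3; have : (1 + 1 <= 1 :> \bar R)%E by apply: le_trans h2; rewrite h3.
by rewrite -EFinD lee_fin; lra.
Qed.

Let wind (A : set (config R)) (z : R * config R) : \bar R :=
  ((\1_(`[0, 1[%classic : set R) (z.1 + angle z.2))%:E *
   (\1_A (translate z.1 z.2))%:E)%E.

Let measurable_wind A : measurable A -> measurable_fun setT (wind A).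
Proof.
move=> mA; apply: emeasurable_funM; apply/measurable_EFinP.
  apply: measurableT_comp; first exact: measurable_indic.
  apply: measurable_funD => //.
  exact: (measurableT_comp measurable_angle).
apply: measurableT_comp; first exact: measurable_indic.
exact: (@measurable_translate2 R _ (R * config R)%type fst snd).
Qed.

Let wind_ge0 A z : (0 <= wind A z)%E.
Proof. by rewrite mule_ge0// lee_fin. Qed.

(** Averaging the unwound law over a full turn restores the stationary law: by
    stationarity one may move the observer instead of the configuration, and for
    each configuration the angles that are compatible with not winding form an
    interval of length one. *)
Lemma unwound_mean A : measurable A ->
  (P A = \int[leb]_(u in `[0%R, 1%R]) translate_law u unwound_law A)%E.
Proof.
move=> mA.
have mw := measurable_wind mA.
have w0 := wind_ge0 A.
have mu01 : measurable (`[0, 1[%classic : set R) by exact: measurable_itv.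
have mE (u : R) : measurable [set g | A (translate (- angle g + u) g)].
  have : measurable_fun setT (fun g : config R => translate (- angle g + u) g).
    apply: measurable_translate2 => //; apply: measurable_funD => //.
    by apply: measurable_funN; exact: measurable_angle.
  by move=> /(_ measurableT _ mA); rewrite setTI.
pose F (z : R * config R) : \bar R := ((\1_(`[0, 1[%classic : set R) z.1)%:E *
   (\1_A (translate (- angle z.2 + z.1) z.2))%:E)%E.
have mF : measurable_fun setT F.
  apply: emeasurable_funM; apply/measurable_EFinP.
    by apply: measurableT_comp => //; exact: measurable_indic.
  apply: measurableT_comp; first exact: measurable_indic.
  apply: measurable_translate2 => //; apply: measurable_funD => //.
  by apply: measurable_funN; exact: (measurableT_comp measurable_angle).
have F0 z : (0 <= F z)%E by rewrite mule_ge0// lee_fin.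
have lawE (u : R) : translate_law u unwound_law A =
    (\int[P]_g (\1_A (translate (- angle g + u) g))%:E)%E.
  rewrite -[LHS]/(P [set g | A (translate u (unwind g))]).
  rewrite (_ : [set g | _] = [set g | A (translate (- angle g + u) g)]); last first.
    by apply/seteqP; split => g /=; rewrite translate_unwind.
  rewrite -[in LHS](setIT [set g | _]) -integral_indic//.
have mlaw : measurable_fun setT (fun u : R => translate_law u unwound_law A).
  pose F1 (z : R * config R) : \bar R := (\1_A (translate (- angle z.2 + z.1) z.2))%:E.
  have mF1 : measurable_fun setT F1.
    apply/measurable_EFinP.
    apply: measurableT_comp; first exact: measurable_indic.
    apply: measurable_translate2 => //; apply: measurable_funD => //.
    by apply: measurable_funN; exact: (measurableT_comp measurable_angle).
  have F10 z : (0 <= F1 z)%E by rewrite lee_fin.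
  rewrite (funext lawE).
  exact: (@measurable_fun_fubini_tonelli_F _ _ (measurableTypeR R) (config R) R P F1 mF1 F10).
apply/esym.
transitivity (\int[leb]_u \int[P]_g F (u, g))%E.
  rewrite -integral_itv_bndo_bndc; last first.
    exact: measurable_funTS mlaw.
  rewrite -integral_indic_mul; apply: eq_integral => u _.
  rewrite lawE /F/=.
  have m1 : measurable_fun setT (fun g : config R => (\1_A (translate (- angle g + u) g) : R)%:E).
    apply/measurable_EFinP; rewrite (_ : (fun g => _) = \1_[set g | A (translate (- angle g + u) g)])//.
  have i0 g : (0 <= (\1_A (translate (- angle g + u) g) : R)%:E)%E by rewrite lee_fin.
  by rewrite (ge0_integralZl_EFin P measurableT (fun g _ => i0 g) m1).
rewrite (@fubini_tonelli _ _ (measurableTypeR R) (config R) R leb P F mF F0).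
transitivity (\int[P]_g \int[leb]_t wind A (t, g))%E.
  apply: eq_integral => g _.
  have mFg : measurable_fun setT (fun u : R => F (u, g)).
    exact: (measurableT_comp mF (measurable_pair2 g)).
  (* for a fixed configuration, measure the rotation from its angle *)
  rewrite -(ge0_integral_shift (angle g) mFg)//.
  apply: eq_integral => t _; rewrite /F /wind/=.
  by congr (_ * (\1_A (translate _ _))%:E)%E; ring.
rewrite -(@fubini_tonelli _ _ (measurableTypeR R) (config R) R leb P (wind A) mw w0).
pose G (z : R * config R) : \bar R := ((\1_A z.2)%:E * (\1_(`[0, 1[%classic : set R) (angle z.2 - z.1))%:E)%E.
have mG : measurable_fun setT G.
  apply: emeasurable_funM; apply/measurable_EFinP.
    by apply: measurableT_comp => //; exact: measurable_indic.
  apply: measurableT_comp; first exact: measurable_indic.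
  by apply: measurable_funB => //; exact: (measurableT_comp measurable_angle).
have G0 z : (0 <= G z)%E by rewrite mule_ge0// lee_fin.
transitivity (\int[leb]_t \int[P]_g G (t, g))%E.
  apply: eq_integral => t _.
  have mwt : measurable_fun setT (fun g => wind A (t, g)).
    exact: (measurableT_comp mw (measurable_pair1 t)).
  (* move the observer by t; the configuration itself is then untouched *)
  rewrite -(stationary_integral statP (- t) mwt)//.
  apply: ge0_ae_eq_integral => //.
  - exact: (measurableT_comp mwt (measurable_translate (- t))).
  - exact: (measurableT_comp mG (measurable_pair1 t)).
  apply: filterS (ae_phased statP varP minp) => g pg _; rewrite /wind /G/=.
  rewrite translateD addNr translate0 muleC; congr (_ * _)%E; congr _%:E.
  rewrite !indicE angle_translate//; congr (_%:R); congr nat_of_bool.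
  rewrite !mem_setE !in_itv/= addrC.
  have := frac_rotation (- t) (angle_itv g); rewrite opprK => <-.
  by [].
rewrite (@fubini_tonelli _ _ (measurableTypeR R) (config R) R leb P G mG G0).
transitivity (\int[P]_g (\1_A g)%:E)%E; last by rewrite integral_indic// setIT.
apply: eq_integral => g _; rewrite /G/=.
have mI : measurable_fun setT (fun t : R => (\1_(`[0, 1[%classic : set R) (angle g - t) : R)%:E).
  apply/measurable_EFinP; apply: measurableT_comp; first exact: measurable_indic.
  exact: measurable_funB.
have I0 (t : R) : (0 <= (\1_(`[0, 1[%classic : set R) (angle g - t) : R)%:E)%E by rewrite lee_fin.
rewrite (ge0_integralZl_EFin leb measurableT (fun t _ => I0 t) mI)//.
rewrite (_ : \int[leb]__ _ = 1)%E ?mule1//.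
rewrite (_ : (fun t => _) = fun t : R => (\1_(`](angle g - 1), (angle g)]%classic : set R) t : R)%:E).
  rewrite integral_indic// setIT [LHS]lebesgue_measure_itv/= lte_fin.
  rewrite ltrBlDr ltrDl ltr01 -EFinB; congr _%:E; ring.
apply/funext => t; rewrite !indicE !mem_setE !in_itv/=; congr (_%:R%:E).
congr nat_of_bool; apply/idP/idP => /andP[h1 h2]; apply/andP; split; lra.
Qed.

Lemma stationary_cyclic_factor : has_cyclic_factor P.
Proof.
split=> //; first exact: (stationary_unit_intensity statP varP).
exists unwound_law; split.
- exact: unwound_mean.
- exact: unwound_Z_stationary.
- exact: unwound_not_stationary.
exists angle_set; split.
- by move=> u _; exact: measurable_angle_set.
- by move=> u; rewrite in_itv/=; exact: unwound_angle_set.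
- by move=> u v _ _ [g [[_ <-] [_ <-]]].
Qed.

End cyclic_factor.

(** * An ergodic inequality *)

Section limn_esup.
Context {R : realType}.
Implicit Types (u v : nat -> \bar R) (c : \bar R).

Lemma limn_esup_lt u c : (limn_esup u < c)%E -> \forall n \near \oo, (u n < c)%E.
Proof.
move=> /ereal_inf_lt[_ [A FA <-] supA].
apply: filterS FA => n An; apply: le_lt_trans supA.
by apply: ereal_sup_ubound; exists n.
Qed.

Lemma limn_esup_le u c : (\forall n \near \oo, (u n <= c)%E) -> (limn_esup u <= c)%E.
Proof.
move=> uc; apply: (@le_trans _ _ (ereal_sup (u @` [set n | (u n <= c)%E]))).
  by apply: ereal_inf_lbound; exists [set n | (u n <= c)%E].
by apply: ge_ereal_sup => _ [n /= unc <-].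
Qed.

Lemma limn_esup_ge0 u : (forall n, 0 <= u n)%E -> (0 <= limn_esup u)%E.
Proof.
move=> u0; rewrite leNgt; apply/negP => /limn_esup_lt[n _ /(_ n (leqnn n))/=].
by rewrite ltNge u0.
Qed.

(** The levels that eventually bound [v] eventually bound [u] up to an
    arbitrary error. *)
Lemma limn_esup_le_eps u v : (forall n, 0 <= v n)%E ->
  (forall c e : R, 0 < e -> (\forall n \near \oo, (v n <= c%:E)%E) ->
    \forall n \near \oo, (u n <= (c + e)%:E)%E) ->
  (limn_esup u <= limn_esup v)%E.
Proof.
move=> v0 uv; have := limn_esup_ge0 v0.
case E : (limn_esup v) => [r| |] // _; last by rewrite leey.
apply/lee_addgt0Pr => e e0; apply: limn_esup_le.
have e2 : 0 < e / 2 by rewrite divr_gt0.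
have : \forall n \near \oo, (v n <= (r + e / 2)%:E)%E.
  apply: (@filterS _ _ _ (fun n => v n < (r + e / 2)%:E)%E).
    by move=> n /ltW.
  by apply: limn_esup_lt; rewrite E lte_fin ltrDl.
by move=> /(uv _ _ e2); rewrite -addrA -splitr.
Qed.

End limn_esup.

Section ergodic.
Context d {X : measurableType d} {R : realType} (P : probability X R).
Variables (T : X -> X) (f : X -> R).
Hypothesis mT : measurable_fun setT T.
Hypothesis invT : forall F : X -> \bar R, measurable_fun setT F ->
  (forall x, 0 <= F x)%E -> (\int[P]_x F (T x) = \int[P]_x F x)%E.
Hypothesis mf : measurable_fun setT f.
Hypothesis f0 : forall x, 0 <= f x.

Definition birkhoff_sum n x : R := \sum_(k < n) f (iter k T x).

Definition birkhoff_limsup x : \bar R :=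
  limn_esup (fun n => (n%:R^-1 * birkhoff_sum n x)%:E).

Lemma birkhoff_sumS n x : birkhoff_sum n.+1 x = f x + birkhoff_sum n (T x).
Proof.
rewrite /birkhoff_sum big_ord_recl/=; congr (_ + _).
by apply: eq_bigr => k _; rewrite -iterSr.
Qed.

Lemma birkhoff_sum_ge0 n x : 0 <= birkhoff_sum n x.
Proof. exact: sumr_ge0. Qed.

Lemma measurable_birkhoff_sum n : measurable_fun setT (birkhoff_sum n).
Proof.
elim: n => [|n IH].
  by rewrite (_ : birkhoff_sum 0 = cst 0)//; apply/funext => x; rewrite /birkhoff_sum big_ord0.
rewrite (_ : birkhoff_sum n.+1 = fun x => f x + birkhoff_sum n (T x)).
  by apply: measurable_funD => //; exact: measurableT_comp.
by apply/funext => x; exact: birkhoff_sumS.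
Qed.

Lemma measurable_birkhoff_limsup : measurable_fun setT birkhoff_limsup.
Proof.
apply: measurable_fun_limn_esup => n; apply/measurable_EFinP.
by apply: measurable_funM => //; exact: measurable_birkhoff_sum.
Qed.

Let avg_ge0 x n : (0 <= (n%:R^-1 * birkhoff_sum n x)%:E)%E.
Proof. by rewrite lee_fin mulr_ge0// birkhoff_sum_ge0. Qed.

Lemma birkhoff_limsup_ge0 x : (0 <= birkhoff_limsup x)%E.
Proof. exact: limn_esup_ge0. Qed.

Let near_small (K e : R) : 0 < e -> \forall n \near \oo, K <= e * n%:R.
Proof.
move=> e0; exists (Num.truncn (K / e)).+1 => // n /= Kn.
rewrite mulrC -ler_pdivrMr//; apply: ltW.
by apply: lt_le_trans (truncnS_gt _) _; rewrite ler_nat.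
Qed.

(** The one extra term separating the two averages is negligible. *)
Lemma birkhoff_limsup_invariant x : birkhoff_limsup (T x) = birkhoff_limsup x.
Proof.
apply/eqP; rewrite eq_le; apply/andP; split; apply: limn_esup_le_eps => //.
- move=> c e e0 [N _ Nc].
  have [M _ Me] := near_small c e0.
  exists (maxn N M).+1 => // n /= nNM.
  have n0 : (0 : R) < n%:R by rewrite ltr0n; exact: leq_trans nNM.
  have := Nc n.+1; rewrite /= lee_fin ler_pdivrMl ?ltr0Sn// birkhoff_sumS => h.
  have {}h := h (leq_trans (leq_maxl N M) (ltnW (leqW nNM))).
  have := Me n (leq_trans (leq_maxr N M) (ltnW nNM)) => /= h'.
  rewrite lee_fin ler_pdivrMl//; have := f0 x.
  by move: h; rewrite -natr1; nra.
- move=> c e e0 [N _ Nc].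
  have [M _ Me] := near_small (f x - c) e0.
  exists (maxn N M).+1 => // -[//|n] /= nNM.
  have := Nc n (leq_trans (leq_maxl N M) nNM).
  have := Me n.+1 (leq_trans (leq_maxr N M) (ltnW nNM)) => /= h'.
  rewrite /= !lee_fin => h.
  rewrite ler_pdivrMl ?ltr0Sn// birkhoff_sumS.
  have [n0|n0] := posnP n.
    move: h h'; rewrite n0 /birkhoff_sum big_ord0; lra.
  rewrite ler_pdivrMl ?ltr0n// in h.
  by move: h'; rewrite -natr1; nra.
Qed.

Section maximal.
Variable psi : X -> R.
Hypothesis mpsi : measurable_fun setT psi.
Hypothesis psi0 : forall x, 0 <= psi x.
Hypothesis psiT : forall x, psi (T x) = psi x.
Hypothesis psi_lt : forall x, 0 < psi x -> exists n, n%:R * psi x < birkhoff_sum n x.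
Hypothesis intf : (\int[P]_x (f x)%:E < +oo)%E.

(** [best n x] is the largest of the first [n] Birkhoff sums of [f - psi],
    the empty sum included. *)
Fixpoint best n x : R :=
  if n is n'.+1 then Num.max 0 (f x - psi x + best n' (T x)) else 0.

Let best_ge0 n x : 0 <= best n x.
Proof. by case: n => //= n; rewrite le_max lexx. Qed.

Let best_mono n x : best n x <= best n.+1 x.
Proof.
elim: n x => [|n IH] x; first exact: best_ge0.
rewrite [leLHS]/= [leRHS]/= ge_max le_max lexx/= le_max.
by rewrite lerD2l IH orbT.
Qed.

Let measurable_best n : measurable_fun setT (best n).
Proof.
elim: n => [|n IH]; first exact: measurable_cst.
apply: measurable_maxr => //; apply: measurable_funD.
  exact: measurable_funB.
exact: measurableT_comp.
Qed.

Let int_best n : (\int[P]_x (best n x)%:E < +oo)%E.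
Proof.
elim: n => [|n IH]; first by rewrite integral0.
have mb : measurable_fun setT (fun x => (best n x)%:E) by apply/measurable_EFinP.
have mbT : measurable_fun setT (fun x => (best n (T x))%:E).
  exact: (measurableT_comp mb mT).
apply: (@le_lt_trans _ _ (\int[P]_x ((f x)%:E + (best n (T x))%:E))%E).
  apply: ge0_le_integral => //.
  - by move=> x _; rewrite lee_fin; exact: best_ge0.
  - exact/measurable_EFinP/measurable_best.
  - by apply: emeasurable_funD => //; exact/measurable_EFinP.
  - move=> x _; rewrite -EFinD lee_fin/= ge_max addr_ge0//=.
    by have := psi0 x; lra.
rewrite ge0_integralD//.
- by rewrite (invT mb); [exact: lte_add_pinfty|move=> x; rewrite lee_fin; exact: best_ge0].
- by move=> x _; rewrite lee_fin.
- exact/measurable_EFinP.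
- by move=> x _; rewrite lee_fin.
Qed.

Let best_ge n x : birkhoff_sum n x - n%:R * psi x <= best n x.
Proof.
elim: n x => [|n IH] x; first by rewrite /birkhoff_sum big_ord0 mul0r subr0.
rewrite [leRHS]/= le_max; apply/orP; right.
by have := IH (T x); rewrite psiT birkhoff_sumS -natr1; lra.
Qed.

Let hit n : set X := [set x | 0 < best n x].

Let measurable_hit n : measurable (hit n).
Proof.
rewrite -[X in measurable X]setTI.
have := measurable_best n measurableT (measurable_itv `]0, +oo[).
by congr (measurable (_ `&` _)); apply/seteqP; split => x; rewrite /hit/= in_itv/= andbT.
Qed.

(** [f - psi] dominates [best n - best n \o T] on [hit n.+1], and off that set
    [best n] vanishes. *)
Let int_hit n : (\int[P]_x (psi x * \1_(hit n.+1) x)%:E <= \int[P]_x (f x)%:E)%E.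
Proof.
have mb : measurable_fun setT (fun x => (best n x)%:E) by apply/measurable_EFinP.
have mbT : measurable_fun setT (fun x => (best n (T x))%:E).
  exact: (measurableT_comp mb mT).
have mfE : measurable_fun setT (fun x => (f x)%:E) by apply/measurable_EFinP.
have mh : measurable_fun setT (fun x => (psi x * \1_(hit n.+1) x)%:E).
  apply/measurable_EFinP; exact: measurable_funM.
have b0 x : (0 <= (best n x)%:E)%E by rewrite lee_fin.
have bf : (\int[P]_x (best n x)%:E \is a fin_num)%E.
  by rewrite ge0_fin_numE ?int_best// integral_ge0.
rewrite -(leeD2rE _ _ bf).
rewrite -[in leRHS](invT mb b0) -!ge0_integralD//.
- apply: ge0_le_integral => //.
  + by move=> x _; rewrite adde_ge0// lee_fin mulr_ge0.
  + exact: emeasurable_funD.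
  + exact: emeasurable_funD.
  + move=> x _; rewrite -!EFinD lee_fin indicE.
    have [xh|xh] := boolP (x \in hit n.+1).
      move: xh (best_mono n x); rewrite mulr1 inE /hit/= lt_max ltxx/= => xh.
      by rewrite (max_r (ltW xh)); lra.
    rewrite mulr0 add0r; apply: (@le_trans _ _ 0); last exact: addr_ge0.
    apply: le_trans (best_mono n x) _.
    by move: xh; rewrite notin_setE /hit => /negP; rewrite -leNgt.
- by move=> x _; rewrite lee_fin.
- by move=> x _; rewrite lee_fin mulr_ge0.
Qed.

(** Maximal inequality: where some Birkhoff sum of [f - psi] is positive,
    [f - psi] dominates [best n - best n \o T], whose integral vanishes. *)
Lemma maximal_ergodic : (\int[P]_x (psi x)%:E <= \int[P]_x (f x)%:E)%E.
Proof.
pose h n x : \bar R := (psi x * \1_(hit n.+1) x)%:E.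
have mh n : measurable_fun setT (h n).
  apply/measurable_EFinP; exact: measurable_funM.
have h0 n x : setT x -> (0 <= h n x)%E by move=> _; rewrite lee_fin mulr_ge0.
have ndh x : setT x -> {homo h ^~ x : n m / (n <= m)%N >-> (n <= m)%E}.
  move=> _; apply/nondecreasing_seqP => n; rewrite /h lee_fin ler_wpM2l//.
  rewrite !indicE ler_nat; case: (boolP (x \in hit n.+1)) => //.
  rewrite inE /hit => xh; rewrite mem_set//.
  exact: lt_le_trans (best_mono n.+1 x).
have limh : (\int[P]_x limn (h ^~ x) = \int[P]_x (psi x)%:E)%E.
  apply: eq_integral => x _; apply/cvg_lim => //.
  have [p0|p0] := eqVneq (psi x) 0.
    rewrite (_ : (fun n => h n x) = cst (psi x)%:E); first exact: cvg_cst.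
    by apply/funext => n; rewrite /h p0 mul0r.
  have [N psiN] : exists n, n%:R * psi x < birkhoff_sum n x.
    by apply: psi_lt; rewrite lt_neqAle eq_sym p0 psi0.
  apply: cvg_near_cst; exists N => // n /= Nn; rewrite /h.
  rewrite indicE mem_set ?mulr1// /hit/=.
  apply: (@lt_le_trans _ _ (best N x)).
    by apply: lt_le_trans (best_ge N x); rewrite subr_gt0.
  have /nondecreasing_seqP bm := fun n => best_mono n x.
  by apply: (bm N n.+1); exact: leqW.
rewrite -limh (monotone_convergence P measurableT mh h0 ndh); apply: lime_le; last by apply: nearW => n; exact: int_hit.
apply: ereal_nondecreasing_is_cvgn => n m nm; apply: ge0_le_integral => //.
- by move=> x _; exact: h0.
- by move=> x _; exact: ndh.
Qed.

End maximal.

(** The limsup is invariant, so the maximal inequality applies to it once it has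
    been truncated and lowered a little. *)
Lemma ergodic_inequality :
  (\int[P]_x birkhoff_limsup x <= \int[P]_x (f x)%:E)%E.
Proof.
have [intf|] := ltP (\int[P]_x (f x)%:E)%E +oo%E; last first.
  by rewrite leye_eq => /eqP ->; rewrite leey.
pose h n x := mine (birkhoff_limsup x) n%:R%:E.
have mh n : measurable_fun setT (h n).
  by apply: measurable_mine => //; exact: measurable_birkhoff_limsup.
have h0 n x : setT x -> (0 <= h n x)%E.
  by move=> _; rewrite /h le_min birkhoff_limsup_ge0 lee_fin ler0n.
have ndh x : setT x -> {homo h ^~ x : n m / (n <= m)%N >-> (n <= m)%E}.
  move=> _ n m nm; rewrite /h le_min ge_min lexx/= ge_min lee_fin ler_nat nm.
  by rewrite orbT.
have limh : (\int[P]_x limn (h ^~ x) = \int[P]_x birkhoff_limsup x)%E.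
  apply: eq_integral => x _; apply/cvg_lim => //; rewrite /h.
  have := birkhoff_limsup_ge0 x; case: (birkhoff_limsup x) => [r| |]// _.
    apply: cvg_near_cst; exists (Num.truncn r).+1 => // n /= rn.
    rewrite min_l// lee_fin ltW//; apply: lt_le_trans (truncnS_gt _) _.
    by rewrite ler_nat.
  apply/cvgeyPge => A; exists (Num.truncn A).+1 => // n /= An.
  rewrite min_r ?leey// lee_fin ltW//; apply: lt_le_trans (truncnS_gt _) _.
  by rewrite ler_nat.
rewrite -limh (monotone_convergence P measurableT mh h0 ndh); apply: lime_le.
  apply: ereal_nondecreasing_is_cvgn => n m nm; apply: ge0_le_integral => //.
  - by move=> x _; exact: h0.
  - by move=> x _; exact: ndh.
apply: nearW => n; apply/lee_addgt0Pr => e e0.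
pose psi x := Num.max 0 (fine (h n x) - e).
have hfin x : h n x \is a fin_num.
  rewrite ge0_fin_numE; last exact: h0.
  by apply: le_lt_trans (ltry n%:R); rewrite /h ge_min lexx orbT.
have mpsi : measurable_fun setT psi.
  apply: measurable_maxr => //; apply: measurable_funB => //.
  exact: (measurableT_comp (@fine_measurable R setT measurableT)).
have psi0 x : 0 <= psi x by rewrite /psi le_max lexx.
have psiT x : psi (T x) = psi x by rewrite /psi /h birkhoff_limsup_invariant.
have psi_lt x : 0 < psi x -> exists m, m%:R * psi x < birkhoff_sum m x.
  move=> px; apply/not_existsP => le_all.
  have : (birkhoff_limsup x <= (psi x)%:E)%E.
    apply: limn_esup_le; exists 1%N => // m /= m0.
    rewrite lee_fin ler_pdivrMl ?ltr0n// leNgt; apply/negP; exact: le_all.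
  have hx : (h n x <= birkhoff_limsup x)%E by rewrite /h ge_min lexx.
  move=> /(le_trans hx); rewrite -[h n x]fineK// lee_fin.
  move: px; rewrite /psi lt_max ltxx/= => px.
  by rewrite (max_r (ltW px)) lerDl oppr_ge0 leNgt e0.
have := maximal_ergodic mpsi psi0 psiT psi_lt intf.
move=> /(leeD2r e%:E); apply: le_trans.
have -> : (e%:E = \int[P]_x (cst e%:E x))%E.
  exact: (esym (probability_integral_cst P e)).
rewrite -ge0_integralD//.
- apply: ge0_le_integral => //.
  + by move=> x _; exact: h0.
  + by apply: emeasurable_funD => //; exact/measurable_EFinP.
  + move=> x _; rewrite /cst -[h n x]fineK// -EFinD lee_fin -lerBlDr.
    by rewrite /psi le_max lexx orbT.
- by move=> x _; rewrite lee_fin.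
- exact/measurable_EFinP.
- by move=> x _; rewrite lee_fin ltW.
Qed.

End ergodic.

(** * The shifted lattice *)

Section lattice.
Context {R : realType}.
Implicit Types (u x : R).

Lemma dirac_series_none (c : nat -> R) (A : set R) : (forall k, ~ A (c k)) ->
  (\sum_(0 <= k <oo) \d_(c k) A = 0 :> \bar R)%E.
Proof. by move=> Ac; apply: eseries0 => k _ _; rewrite diracE memNset. Qed.

Lemma dirac_series_one (c : nat -> R) (A : set R) n : (forall k, A (c k) <-> k = n) ->
  (\sum_(0 <= k <oo) \d_(c k) A = 1 :> \bar R)%E.
Proof.
move=> Ac; rewrite (nneseries_split 0 n.+1)// add0n [X in (_ + X)%E]eseries0.
  rewrite adde0 big_nat_recr//= [X in (X + _)%E]big_nat_cond big1 => [|k /andP[/andP[_ kn] _]].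
    by rewrite add0e diracE mem_set//; exact/Ac.
  by rewrite diracE memNset// => /Ac kE; rewrite kE ltnn in kn.
move=> k nk _; rewrite diracE memNset// => /Ac kE.
by rewrite kE ltnn in nk.
Qed.

(** The only integer translate of [u] in the interval comes from
    [Num.floor (x - u) + 1]. *)
Lemma lattice_unit u x : lattice u `]x, (x + 1)]%classic = 1%E.
Proof.
pose z : int := Num.floor (x - u) + 1.
have zE (w : int) : `]x, (x + 1)]%classic (w%:~R + u) <-> w = z.
  have /andP[h1 h2] := floor_itv (x - u).
  rewrite /= in_itv/=; split=> [/andP[h3 h4]|->].
    apply/eqP; rewrite eq_le; apply/andP; split.
      rewrite -ltzD1 /z -(ltr_int R) !rmorphD/= in h1 h2 *; lra.
    rewrite /z lezD1 -(ltr_int R); lra.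
  by rewrite /z rmorphD/= in h2 *; apply/andP; split; lra.
rewrite -[LHS]/(measure_add _ _ _) measure_addE.
case zn : z => [n|n].
  rewrite [X in (X + _)%E](@dirac_series_one _ _ n); last first.
    by move=> k; rewrite zE zn; split => [[]|->].
  rewrite [X in (_ + X)%E]dirac_series_none ?adde0// => k.
  by rewrite zE zn.
rewrite [X in (_ + X)%E](@dirac_series_one _ _ n); last first.
  by move=> k; rewrite zE zn; split => [[]|->].
rewrite [X in (X + _)%E]dirac_series_none ?add0e// => k.
by rewrite zE zn.
Qed.

Lemma cnt_lattice u x (k : nat) : cnt (lattice u) x (x + k%:R) = k%:R.
Proof.
elim: k => [|k IH]; first by rewrite addr0 cnt_eq0.
rewrite (@cntD _ _ _ (x + k%:R)) ?lerD2l ?ler_nat ?lerDl// IH -natr1.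
by rewrite addrA /cnt lattice_unit.
Qed.

Lemma lattice_cc_le u x (r : R) : 0 <= r ->
  (lattice u `[x, (x + r)%R]%classic <= (2 + r)%:E)%E.
Proof.
move=> r0; pose k := (Num.truncn r).+2.
apply: (@le_trans _ _ (lattice u `](x - 1)%R, ((x - 1) + k%:R)%R]%classic)).
  apply: le_measure; rewrite ?inE//.
  move=> y /=; rewrite !in_itv/= => /andP[h1 h2].
  have := truncnS_gt r; rewrite /k -[_.+2%:R]natr1.
  by move=> h; apply/andP; split; lra.
rewrite cntE cnt_lattice lee_fin /k -[_.+2%:R]natr1 -natr1.
have /andP[h _] := truncn_itv r0; lra.
Qed.

End lattice.

Section lattice_angle.
Context {R : realType} (P : probability (config R) R) (C : R).
Local Notation leb := (@lebesgue_measure R).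
Hypothesis statP : stationary P.
Hypothesis varP : forall x, 0 < x ->
  (\int[P]_g ((cnt g 0 x - x) ^+ 2)%:E <= C%:E)%E.
Variable p_ : nat -> average R.
Hypothesis minp : forall n, radius P (p_ n) <= min_radius P + 8^-1 ^+ n.
Implicit Types g : config R.

Lemma measurable_lattice_angle :
  measurable_fun setT (fun g => lattice (angle p_ g) : config R).
Proof.
exact: (measurableT_comp (@measurable_lattice R) (measurable_angle p_)).
Qed.

(** The angle is uniform, since it takes the value [u] on the [u]-th phase. *)
Lemma lattice_angle_law (B : set (config R)) : measurable B ->
  P [set g | B (lattice (angle p_ g))] = lattice_law R B.
Proof.
move=> mB; pose A := [set g | B (lattice (angle p_ g))].
have mA : measurable A.
  by have := measurable_lattice_angle measurableT mB; rewrite setTI.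
have mLB : measurable [set u : R | B (lattice u)].
  by have := @measurable_lattice R measurableT _ mB; rewrite setTI.
rewrite -[LHS]/(P A) (unwound_mean statP varP minp mA).
have lawE (u : R) : 0 <= u < 1 ->
    translate_law u (unwound_law P p_) A = ((\1_[set u : R | B (lattice u)] u : R)%:E).
  move=> u01.
  rewrite -[LHS]/(P [set g | A (translate u (unwind p_ g))]).
  have mS : measurable [set g | A (translate u (unwind p_ g))].
    have := measurableT_comp (measurable_translate u) (measurable_unwind p_).
    by move=> /(_ measurableT _ mA); rewrite setTI.
  have AE g : phased p_ g -> A (translate u (unwind p_ g)) = B (lattice u).
    move=> pg; rewrite /A/= translate_unwind angle_translate//.
    rewrite (_ : angle p_ g + (- angle p_ g + u) = u); last by ring.
    by rewrite frac_id.
  have [Bu|Bu] := pselect (B (lattice u)).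
    rewrite indicE mem_set// -(probability_setT P).
    apply: probability_ae_eq => //.
    apply: filterS (ae_phased statP varP minp) => g pg.
    by rewrite -[LHS]/(A (translate u (unwind p_ g))) AE//; apply/propext.
  rewrite indicE memNset//; transitivity (P set0); last by rewrite measure0.
  apply: probability_ae_eq => //.
  apply: filterS (ae_phased statP varP minp) => g pg.
  by rewrite -[LHS]/(A (translate u (unwind p_ g))) AE//; apply/propext.
transitivity (\int[leb]_(u in `[0%R, 1%R[) (\1_[set u : R | B (lattice u)] u : R)%:E)%E.
  rewrite -integral_itv_bndo_bndc.
    by apply: eq_integral => u; rewrite inE/= in_itv/= => /lawE.
  apply: (@eq_measurable_fun _ _ _ _ _ (fun u : R => (\1_[set u : R | B (lattice u)] u : R)%:E)).
    by move=> u; rewrite inE/= in_itv/= => /lawE.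
  by apply/measurable_EFinP; exact: measurable_indic.
rewrite -[RHS]/(uniform_prob (@ltr01 R) [set u : R | B (lattice u)]).
rewrite -[in RHS](setIT [set u : R | _]) -integral_indic//.
rewrite integral_uniform//.
- rewrite subr0 invr1 mul1e integral_itv_bndo_bndc//.
  by apply/measurable_EFinP; exact: measurable_indic.
- by apply/measurable_EFinP; exact: measurable_indic.
Qed.

End lattice_angle.

(** * Transport to the lattice *)

Section telescope.
Context {R : realType}.
Implicit Types (x l a : R) (c : nat -> R) (K : nat).

(** [(l - x) ^+ 2] telescopes along the integers between [x] and [l], and the
    increment at [m] is at most twice the distance from [m] to [l]. *)
Lemma square_le_sum_right x l a c K : a <= x -> x <= l -> l <= a + K%:R ->
  (forall i, (i < K)%N -> 0 <= c i) ->
  (forall i, (i < K)%N -> x <= a + i%:R + 1 -> a + i%:R <= l ->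
     2 * (l - (a + i%:R)) <= c i) ->
  (l - x) ^+ 2 <= \sum_(i < K) c i.
Proof.
move=> ax xl lK c0 cx.
pose u i : R := Num.max 0 (l - Num.max x (a + i%:R)).
have -> : (l - x) ^+ 2 = u 0%N ^+ 2 - u K ^+ 2.
  rewrite /u addr0 (max_l ax) max_r ?subr_ge0// max_l ?expr0n ?subr0//.
  by rewrite subr_le0 le_max lK orbT.
rewrite -[leLHS]opprB -(@telescope_sumr _ 0 K (fun i => u i ^+ 2))// -sumrN big_mkord.
apply: ler_sum => i _; have := cx i (ltn_ord i); have := c0 i (ltn_ord i).
rewrite opprB /u (_ : a + i.+1%:R = a + i%:R + 1); last by rewrite -natr1 addrA.
set m := a + i%:R => ci0 cmi.
have [xm|xm] := leP x m.
  rewrite (@max_r _ _ x (m + 1)); last lra.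
  have [ml|ml] := leP m l.
    have := cmi _ ml; rewrite (@max_r _ _ 0 (l - m)); last lra.
    have [ml1|ml1] := leP 0 (l - (m + 1)) => h; have := h ltac:(lra); nra.
  rewrite !(@max_l _ _ 0) //; lra.
have [xm1|xm1] := leP x (m + 1).
  have := cmi ltac:(lra) ltac:(lra); rewrite (@max_r _ _ 0 (l - x)); last lra.
  by have [ml1|ml1] := leP 0 (l - (m + 1)) => h; nra.
by rewrite subrr.
Qed.

(** The mirror image of [square_le_sum_right]; the strict inequality on [x] is
    the one that the quantile provides. *)
Lemma square_le_sum_left x l a c K : a <= l -> l <= x -> x <= a + K%:R ->
  (forall i, (i < K)%N -> 0 <= c i) ->
  (forall i, (i < K)%N -> a + i%:R < x -> l <= a + i%:R + 1 ->
     2 * (a + i%:R + 1 - l) <= c i) ->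
  (x - l) ^+ 2 <= \sum_(i < K) c i.
Proof.
move=> al lx xK c0 cx.
pose u i : R := Num.max 0 (Num.min x (a + i%:R) - l).
have -> : (x - l) ^+ 2 = u K ^+ 2 - u 0%N ^+ 2.
  rewrite /u addr0 (@min_l _ _ x (a + _))// max_r ?subr_ge0// max_l ?expr0n ?subr0//.
  by rewrite subr_le0 ge_min al orbT.
rewrite -(@telescope_sumr _ 0 K (fun i => u i ^+ 2))// big_mkord.
apply: ler_sum => i _; have := cx i (ltn_ord i); have := c0 i (ltn_ord i).
rewrite /u (_ : a + i.+1%:R = a + i%:R + 1); last by rewrite -natr1 addrA.
set m := a + i%:R => ci0 cmi.
have [xm|xm] := leP x m.
  by rewrite (@min_l _ _ x (m + 1)) ?subrr//; lra.
have [lm|lm] := leP l (m + 1); last first.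
  rewrite !(@max_l _ _ 0); [lra|lra|].
  by rewrite min_r; lra.
have := cmi xm lm.
have [xm1|xm1] := leP x (m + 1).
  rewrite (@max_r _ _ 0 (x - l)); last lra.
  by have [ml1|ml1] := leP 0 (m - l) => h; nra.
rewrite (@max_r _ _ 0 (m + 1 - l)); last lra.
by have [ml1|ml1] := leP 0 (m - l) => h; nra.
Qed.

End telescope.

Section quantile.
Context {R : realType} (g : config R).
Hypothesis Nge : forall v, exists x, v <= counting g x.
Hypothesis Nlt : forall v, exists x, counting g x < v.
Implicit Types (v t l Y theta a b : R).

Definition quantile v : R := inf [set x | v <= counting g x].

(** Right continuity puts the infimum in the set. *)
Lemma quantile_le v t : (quantile v <= t) = (v <= counting g t).
Proof.
have lb : has_lbound [set x | v <= counting g x].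
  have [x0 x0v] := Nlt v; exists x0 => x /= vx.
  rewrite leNgt; apply/negP => xx0.
  by have := counting_mono g (ltW xx0); lra.
have hi : has_inf [set x | v <= counting g x] by split=> //; exact: Nge.
apply/idP/idP => [Qt|vt]; last exact: ge_inf.
have [e e0 Ne] := counting_right g (quantile v).
have [x /= vx xQ] := inf_adherent e0 hi.
apply: le_trans vx _; apply: le_trans (counting_mono g (ltW xQ)) _.
by rewrite Ne counting_mono.
Qed.

Lemma quantile_gt v t : (t < quantile v) = (counting g t < v).
Proof. by rewrite !ltNge quantile_le. Qed.

Lemma measurable_quantile : measurable_fun setT quantile.
Proof.
apply: nondecreasing_measurable => // v w vw.
rewrite quantile_le; apply: le_trans vw _.
by rewrite -quantile_le.
Qed.

Definition match_point Y l : R * R := (quantile (l + Y), l).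

Lemma measurable_match_point Y : measurable_fun setT (match_point Y).
Proof.
apply/measurable_fun_pairP; split; last exact: measurable_id.
apply: (measurableT_comp measurable_quantile); exact: measurable_funD.
Qed.

(** The monotone matching, as an image of the lattice: the lattice point [l] has
    label [l + Y] and is matched with the point of [g] of the same label. *)
Definition match_plan Y theta : {measure set (R * R) -> \bar R} :=
  measure_function_pushforward__canonical__measure_function_Measure
    (lattice theta) (measurable_match_point Y).

(** [quantile] lists the points of [g] in increasing order, so that the lattice
    points whose labels fall between [counting g a] and [counting g b] are
    matched with the points of [g] in the interval from [a] to [b]. *)
Lemma match_plan_coupling Y theta :
  config_coupling g (lattice theta) (match_plan Y theta).
Proof.
split; last first.
  move=> B mB; rewrite /= /pushforward; congr (lattice_measure _ _).
  by apply/seteqP; split => l //= [].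
pose h l := quantile (l + Y).
have mh : measurable_fun setT h.
  apply: (measurableT_comp measurable_quantile); exact: measurable_funD.
pose m := measure_function_pushforward__canonical__measure_function_Measure
  (lattice theta) mh.
move=> A mA; transitivity (m A).
  rewrite /= /pushforward; congr (lattice_measure _ _).
  by apply/seteqP; split => l //= [].
apply/esym.
apply: (@measure_unique _ R R (@ocitv R) (fun k => `](- k%:R)%R, k%:R]%classic)
  _ _ _ _ g m) => //.
- exact: ocitvI.
- by move=> k; exists (- k%:R, k%:R)%R.
- by rewrite bigcup_itvT.
- move=> _ [[a b] _ <-] /=; rewrite /pushforward.
  have [ba|ab] := leP b a.
    rewrite set_itv_ge ?bnd_simp -?leNgt// measure0 preimage_set0.
    by rewrite [RHS](measure0 (lattice_measure theta)).
  rewrite (_ : h @^-1` _ = `](counting g a - Y), (counting g b - Y)]%classic); last first.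
    apply/seteqP; split => l /=; rewrite !in_itv/= /h quantile_gt quantile_le.
      by move=> /andP[h1 h2]; apply/andP; split; lra.
    by move=> /andP[h1 h2]; apply/andP; split; lra.
  rewrite cntE -[RHS]/(lattice theta _) cntE; congr (_%:E).
  have [k kE] := cnt_nat g a b.
  rewrite kE -(cnt_lattice theta (counting g a - Y) k); congr cnt.
  by rewrite -kE cnt_counting ?ltW//; ring.
- move=> k; rewrite -ge0_fin_numE//; apply: config_fin => //.
  exact: bounded_oc.
Qed.

End quantile.

Section match_cost.
Context {R : realType} (g : config R) (Y theta : R).
Implicit Types (x l r : R).

(** The signed difference between the counting functions of [g] and of the
    lattice, up to a bounded term. *)
Definition deviation x : R := discr g x - Y.
Local Notation dev := deviation.

Variable M : nat.
Hypothesis dev_small : forall m : nat, (M <= m)%N ->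
  `|dev m%:R| <= m%:R / 4 /\ `|dev (- m%:R)| <= m%:R / 4.

Let countingE x : counting g x = x + Y + dev x.
Proof. by rewrite /deviation /discr; ring. Qed.

Let large (v : R) : exists2 m, (M <= m)%N & v <= m%:R.
Proof.
exists (maxn M (Num.truncn v).+1); first exact: leq_maxl.
apply: ltW; apply: lt_le_trans (truncnS_gt _) _.
by rewrite ler_nat leq_maxr.
Qed.

Lemma counting_unbounded_above v : exists x, v <= counting g x.
Proof.
have [m Mm vm] := large (4 * (`|v| + `|Y|)); exists m%:R; rewrite countingE.
have [+ _] := dev_small Mm; rewrite ler_norml => /andP[h _].
have := ler_norm v; have := ler_norm (- Y); rewrite normrN.
by have := normr_ge0 v; have := normr_ge0 Y; lra.
Qed.

Lemma counting_unbounded_below v : exists x, counting g x < v.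
Proof.
have [m Mm vm] := large (4 * (`|v| + `|Y| + 1)); exists (- m%:R); rewrite countingE.
have [_] := dev_small Mm; rewrite ler_norml => /andP[_ h].
have := ler_norm (- v); have := ler_norm Y; rewrite normrN.
by have := normr_ge0 v; have := normr_ge0 Y; lra.
Qed.

Let Nge := counting_unbounded_above.
Let Nlt := counting_unbounded_below.

(** A deviation that is small with respect to the position cannot carry a point
    of the half-size box out of the interval from [- n%:R] to [n%:R]. *)
Lemma match_point_range n l : (2 * M + 4 <= n)%N -> box n (quantile g (l + Y)) ->
  [/\ - n%:R <= quantile g (l + Y) <= n%:R & - n%:R <= l <= n%:R].
Proof.
move=> Mn; rewrite /box/= in_itv/= => /andP[Q1 Q2].
have n0 : (0 : R) <= n%:R by [].
split; first by apply/andP; split; lra.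
have n4 : (4 : R) <= n%:R by rewrite ler_nat (leq_trans _ Mn)// leq_addl.
pose m := (n./2).+1.
have Mm : (M <= m)%N.
  rewrite /m leqW// -(doubleK M); apply: half_leq; rewrite -mul2n.
  exact: leq_trans (leq_addr _ _) Mn.
have nE : (n%:R : R) = (odd n)%:R + 2 * (n./2)%:R.
  by rewrite -{1}(odd_double_half n) natrD -mul2n natrM.
have odd1 : ((odd n)%:R : R) <= 1 by rewrite lern1; case: (odd n).
have odd0 : (0 : R) <= (odd n)%:R by [].
have mE : m%:R = (n./2)%:R + 1 :> R by rewrite natr1.
have m1 : n%:R / 2 < m%:R :> R by rewrite mE; lra.
have m2 : m%:R <= n%:R / 2 + 1 :> R by rewrite mE; lra.
have [] := dev_small Mm; rewrite !ler_norml => /andP[_ h1] /andP[h2 _].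
have : quantile g (l + Y) <= m%:R by lra.
rewrite quantile_le// countingE => h3.
have : - m%:R < quantile g (l + Y) by lra.
rewrite quantile_gt// countingE => h4.
by apply/andP; split; lra.
Qed.

(** The contribution of one site to the cost of the lattice point [l]: the
    lattice points within the deviation [r] of the site, each at distance at
    most [1 + r]. *)
Let spike r x l : R := 2 * (1 + r) * \1_(`[x, (x + (1 + r))%R]%classic : set R) l.

Let spike_ge0 r x l : 0 <= r -> 0 <= spike r x l.
Proof. by move=> r0; rewrite mulr_ge0// mulr_ge0// addr_ge0. Qed.

Let measurable_spike r x : measurable_fun setT (fun l => (spike r x l)%:E).
Proof. by apply/measurable_EFinP; exact: measurable_funM. Qed.

Let integral_spike r x : 0 <= r ->
  (\int[lattice theta]_l (spike r x l)%:E <= (6 * (1 + r) ^+ 2)%:E)%E.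
Proof.
move=> r0.
pose J := `[x, (x + (1 + r))%R]%classic : set R.
have mJ' : measurable J by exact: measurable_itv.
have -> : (\int[lattice theta]_l (spike r x l)%:E =
    \int[lattice theta]_l ((2 * (1 + r))%:E * (\1_J l : R)%:E))%E.
  by apply: eq_integral => l _; rewrite /spike EFinM.
have mJ : measurable_fun setT (fun l : R => (\1_J l : R)%:E).
  by apply/measurable_EFinP; exact: measurable_indic.
have J0 l : (0 <= (\1_J l : R)%:E)%E by rewrite lee_fin.
have k0 : 0 <= 2 * (1 + r) by rewrite mulr_ge0// addr_ge0.
rewrite (ge0_integralZl_EFin (lattice theta) measurableT (fun l _ => J0 l) mJ)//.
rewrite integral_indic// setIT.
have h := @lattice_cc_le R theta x (1 + r) (addr_ge0 ler01 r0).
apply: (@le_trans _ _ ((2 * (1 + r))%:E * (2 + (1 + r))%:E)%E).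
  by apply: lee_wpmul2l => //; rewrite lee_fin.
by rewrite -EFinM lee_fin; nra.
Qed.

Let cost n i l : R :=
  spike `|dev (- n%:R + i%:R + 1)| (- n%:R + i%:R) l +
  spike `|dev (- n%:R + i%:R)| (- n%:R + i%:R - `|dev (- n%:R + i%:R)|) l.

Let cost_ge0 n i l : 0 <= cost n i l.
Proof. by rewrite addr_ge0// spike_ge0. Qed.

Lemma square_match_le n l : (2 * M + 4 <= n)%N -> box n (quantile g (l + Y)) ->
  (quantile g (l + Y) - l) ^+ 2 <= \sum_(i < n + n) cost n i l.
Proof.
move=> Mn Qn; have [/andP[Q1 Q2] /andP[l1 l2]] := match_point_range Mn Qn.
have nE : (- n%:R + (n + n)%:R : R) = n%:R by rewrite natrD addrA addNr add0r.
have c0 i : (i < n + n)%N -> 0 <= cost n i l by move=> _; exact: cost_ge0.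
rewrite -nE in Q2 l2.
have [Ql|/ltW lQ] := leP (quantile g (l + Y)) l.
  rewrite -sqrrN opprB.
  apply: (square_le_sum_right Q1 Ql l2 c0).
  move=> i _; set m := - n%:R + i%:R.
  rewrite quantile_le// countingE => h ml.
  have hd := ler_norm (dev (m + 1)).
  rewrite -[leLHS]addr0 /cost -/m; apply: lerD; last exact: spike_ge0.
  rewrite /spike indicE mem_set ?mulr1; last by rewrite /= in_itv/=; apply/andP; split; lra.
  lra.
apply: (square_le_sum_left l1 lQ Q2 c0).
move=> i _; set m := - n%:R + i%:R.
rewrite quantile_gt// countingE => h ml.
have hd := ler_norm (- dev m); rewrite normrN in hd.
rewrite -[leLHS]add0r /cost -/m; apply: lerD; first exact: spike_ge0.
rewrite /spike indicE mem_set ?mulr1; last by rewrite /= in_itv/=; apply/andP; split; lra.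
lra.
Qed.

(** A deviation [r] at a site misplaces about [r] points by at most [1 + r], so
    that the sites contribute squares although a single point may be misplaced
    across many sites. *)
Lemma match_plan_cost n : (2 * M + 4 <= n)%N ->
  (\int[match_plan Nge Nlt Y theta]_(z in box n `*` setT) (`|z.1 - z.2| `^ 2)%:E <=
   (\sum_(i < n + n) (6 * (1 + `|dev (- n%:R + i%:R + 1)|) ^+ 2 +
                      6 * (1 + `|dev (- n%:R + i%:R)|) ^+ 2))%:E)%E.
Proof.
move=> Mn.
have mbox : measurable (@box R n `*` [set: R]).
  by apply: measurableX => //; exact: measurable_itv.
have mF : measurable_fun setT (fun z : R * R => (`|z.1 - z.2| `^ 2)%:E).
  apply/measurable_EFinP; apply: (measurableT_comp (measurable_powR 2)).
  by apply: (measurableT_comp (@normr_measurable R setT)); exact: measurable_funB.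
rewrite (@ge0_integral_pushforward _ _ _ _ R _ (measurable_match_point Nge Nlt Y)
  (lattice theta) _ (fun z : R * R => (`|z.1 - z.2| `^ 2)%:E) mbox); last 2 first.
- exact: measurable_funTS mF.
- by move=> z _; rewrite lee_fin powR_ge0.
set E := _ @^-1` _.
have mE : measurable E.
  by rewrite -[E]setTI; exact: (measurable_match_point Nge Nlt Y).
have mc i : measurable_fun setT (fun l => (cost n i l)%:E).
  by rewrite /cost; under eq_fun do rewrite EFinD; exact: emeasurable_funD.
have c0 i l : setT l -> (0 <= (cost n i l)%:E)%E by rewrite lee_fin.
apply: (@le_trans _ _ (\int[lattice theta]_(l in E) \sum_(i < n + n) (cost n i l)%:E)%E).
  apply: ge0_le_integral => //.
  - by move=> l _; rewrite lee_fin powR_ge0.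
  - apply: measurable_funTS; exact: (measurableT_comp mF (measurable_match_point Nge Nlt Y)).
  - by apply: measurable_funTS; apply: emeasurable_sum => i.
  - move=> l [/= Qn _]; rewrite powR_mulrn// real_normK ?num_real// sumEFin lee_fin.
    exact: square_match_le.
apply: (@le_trans _ _ (\int[lattice theta]_l \sum_(i < n + n) (cost n i l)%:E)%E).
  apply: ge0_subset_integral => //.
  - by apply: emeasurable_sum => i.
  - by move=> l _; apply: sume_ge0 => i _; exact: c0.
rewrite ge0_integral_sum//; last by move=> i l _; exact: c0.
rewrite -sumEFin; apply: lee_sum => i _.
rewrite /cost; under eq_integral do rewrite EFinD.
rewrite ge0_integralD//.
- by rewrite EFinD; apply: leeD; exact: integral_spike.
- by move=> l _; rewrite lee_fin spike_ge0.
- by move=> l _; rewrite lee_fin spike_ge0.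
Qed.

End match_cost.

(** * Finite transport cost *)

Lemma symmetric_sum (R : realType) (F : R -> R) n :
  \sum_(i < n + n) F (- n%:R + i%:R) =
  \sum_(i < n) F (- (i%:R + 1)) + \sum_(i < n) F i%:R.
Proof.
rewrite big_split_ord/=; congr (_ + _).
  rewrite (reindex_inj rev_ord_inj)/=; apply: eq_bigr => i _; congr F.
  by rewrite natrB ?ltn_ord// -natr1; ring.
by apply: eq_bigr => i _; congr F; rewrite natrD addrA addNr add0r.
Qed.

Lemma symmetric_sum_le (R : realType) (F : R -> R) n : (forall x, 0 <= F x) ->
  \sum_(i < n + n) (6 * F (- n%:R + i%:R + 1) + 6 * F (- n%:R + i%:R)) <=
  12 * (\sum_(k < n.+1) F k%:R + \sum_(k < n.+1) F (- k%:R)).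
Proof.
move=> F0; rewrite big_split/= -!mulr_sumr symmetric_sum.
rewrite (symmetric_sum (fun x => F (x + 1))).
have e1 : \sum_(i < n) F (- (i%:R + 1) + 1) = \sum_(i < n) F (- i%:R).
  by apply: eq_bigr => i _; congr F; ring.
have e2 : \sum_(k < n.+1) F k%:R = F 0 + \sum_(i < n) F (i%:R + 1).
  rewrite big_ord_recl/=; congr (_ + _).
  by apply: eq_bigr => i _; rewrite natr1.
have e3 : \sum_(k < n.+1) F (- k%:R) = F 0 + \sum_(i < n) F (- (i%:R + 1)).
  rewrite big_ord_recl/= oppr0; congr (_ + _).
  by apply: eq_bigr => i _; rewrite natr1.
have e4 : \sum_(k < n.+1) F k%:R = \sum_(i < n) F i%:R + F n%:R.
  by rewrite big_ord_recr.
have e5 : \sum_(k < n.+1) F (- k%:R) = \sum_(i < n) F (- i%:R) + F (- n%:R).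
  by rewrite big_ord_recr.
rewrite e1; have := F0 0; have := F0 n%:R; have := F0 (- n%:R); lra.
Qed.

Lemma transport_cost_ge0 (R : realType) p (xi eta : config R) :
  (0 <= transport_cost p xi eta)%E.
Proof.
apply: le_ereal_inf_tmp => _ [q _ <-]; apply: limn_esup_ge0 => n.
by apply: mule_ge0; rewrite ?lee_fin//; apply: integral_ge0 => z _; rewrite lee_fin powR_ge0.
Qed.

Section affine_sum.
Context d (T : measurableType d) {R : realType} (P : probability T R).
Variables (k c : R) (u v : T -> \bar R).
Hypotheses (k0 : 0 <= k) (c0 : 0 <= c).
Hypotheses (mu : measurable_fun setT u) (mv : measurable_fun setT v).
Hypotheses (u0 : forall w, (0 <= u w)%E) (v0 : forall w, (0 <= v w)%E).

Lemma measurable_affine_sum : measurable_fun setT (fun w => k%:E * (u w + v w + c%:E))%E.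
Proof.
by apply: measurable_funeM; apply: emeasurable_funD => //; exact: emeasurable_funD.
Qed.

Lemma integral_affine_sum_lty : (\int[P]_w u w < +oo)%E -> (\int[P]_w v w < +oo)%E ->
  (\int[P]_w (k%:E * (u w + v w + c%:E)) < +oo)%E.
Proof.
move=> intu intv.
have muv : measurable_fun setT (fun w => u w + v w)%E by exact: emeasurable_funD.
have uv0 w : (0 <= u w + v w)%E by exact: adde_ge0.
have muvc : measurable_fun setT (fun w => u w + v w + c%:E)%E by exact: emeasurable_funD.
have uvc0 w : (0 <= u w + v w + c%:E)%E by rewrite adde_ge0.
rewrite (ge0_integralZl_EFin P measurableT (fun w _ => uvc0 w) muvc)//.
rewrite (@ge0_integralD _ _ _ P setT measurableT (fun w => u w + v w)%E (fun=> c%:E))//.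
rewrite (probability_integral_cst P c) ge0_integralD//.
have [->|kn0] := eqVneq k 0; first by rewrite mul0e ltry.
rewrite lte_mul_pinfty//; apply: lte_add_pinfty; last exact: ltry.
exact: lte_add_pinfty.
Qed.

End affine_sum.

Section finite_cost.
Context {R : realType} (P : probability (config R) R) (C : R).
Hypothesis statP : stationary P.
Hypothesis varP : forall x, 0 < x ->
  (\int[P]_g ((cnt g 0 x - x) ^+ 2)%:E <= C%:E)%E.
Variable p_ : nat -> average R.
Hypothesis minp : forall n, radius P (p_ n) <= min_radius P + 8^-1 ^+ n.
Implicit Types (g : config R) (n : nat) (theta : R).

(** At the site [m] the deviation is minus the phase of the configuration
    translated by [- m], so that the costs of the sites form a stationary
    sequence, see [site_cost_translate]. *)
Definition site_cost g : R := (1 + `|phase p_ g|) ^+ 2.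

Lemma site_cost_ge0 g : 0 <= site_cost g. Proof. exact: sqr_ge0. Qed.

Lemma measurable_site_cost : measurable_fun setT site_cost.
Proof.
apply: measurable_funX; apply: measurable_funD => //.
apply: (measurableT_comp (@normr_measurable R setT)); exact: measurable_phase.
Qed.

Lemma integral_site_cost : (\int[P]_g (site_cost g)%:E < +oo)%E.
Proof.
have mp := measurable_phase p_.
have msq0 : measurable_fun setT (fun g => (phase p_ g ^+ 2)%:E).
  by apply/measurable_EFinP; exact: measurable_funX.
have sq0 g : (0 <= (phase p_ g ^+ 2)%:E)%E by rewrite lee_fin sqr_ge0.
apply: (@le_lt_trans _ _ (\int[P]_g (2%:E + 2%:E * (phase p_ g ^+ 2)%:E))%E).
  apply: ge0_le_integral => //.
  - by move=> g _; rewrite lee_fin site_cost_ge0.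
  - by apply/measurable_EFinP; exact: measurable_site_cost.
  - by apply: emeasurable_funD => //; exact: measurable_funeM.
  - move=> g _; rewrite -EFinM -EFinD lee_fin /site_cost.
    rewrite -[phase p_ g ^+ 2](real_normK (num_real (phase p_ g))) -subr_ge0.
    move: (`|phase p_ g|) => a; rewrite (_ : _ - _ = (1 - a) ^+ 2) ?sqr_ge0//; ring.
rewrite ge0_integralD//; last 2 first.
- by move=> g _; apply: mule_ge0.
- exact: measurable_funeM.
rewrite (probability_integral_cst P 2).
rewrite (ge0_integralZl_EFin P measurableT (fun g _ => sq0 g) msq0)//.
have h := msq_discr_phase statP varP minp 0.
have e : msq P (fun g => discr g 0 - phase p_ g) = (\int[P]_g (phase p_ g ^+ 2)%:E)%E.
  apply: eq_integral => g _.
  by rewrite /discr counting0 subr0 sub0r sqrrN.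
rewrite e in h.
apply: (@le_lt_trans _ _ (2%:E + 2%:E * (4 * C)%:E)%E); last by rewrite -EFinM -EFinD ltry.
by apply: leeD => //; apply: lee_wpmul2l => //; rewrite lee_fin.
Qed.

Definition cost_up g : \bar R := birkhoff_limsup (translate (- 1)) site_cost g.
Definition cost_down g : \bar R := birkhoff_limsup (translate 1) site_cost g.

Definition cost_bound g : \bar R := (24%:E * (cost_up g + cost_down g + 2%:E))%E.

Lemma cost_up_ge0 g : (0 <= cost_up g)%E.
Proof. exact: (birkhoff_limsup_ge0 _ site_cost_ge0). Qed.

Lemma cost_down_ge0 g : (0 <= cost_down g)%E.
Proof. exact: (birkhoff_limsup_ge0 _ site_cost_ge0). Qed.

Lemma cost_bound_ge0 g : (0 <= cost_bound g)%E.
Proof.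
by apply: mule_ge0 => //; apply: adde_ge0 => //; apply: adde_ge0;
  [exact: cost_up_ge0|exact: cost_down_ge0].
Qed.

Let mup : measurable_fun setT cost_up.
Proof.
exact: (measurable_birkhoff_limsup (@measurable_translate R _) measurable_site_cost).
Qed.

Let mdown : measurable_fun setT cost_down.
Proof.
exact: (measurable_birkhoff_limsup (@measurable_translate R _) measurable_site_cost).
Qed.

Lemma measurable_cost_bound : measurable_fun setT cost_bound.
Proof. exact: (measurable_affine_sum 24 2 mup mdown). Qed.

Lemma integral_cost_bound : (\int[P]_g cost_bound g < +oo)%E.
Proof.
apply: (@integral_affine_sum_lty _ _ _ P 24 2 cost_up cost_down (ler0n _ _) (ler0n _ _)
  mup mdown cost_up_ge0 cost_down_ge0).
- apply: le_lt_trans integral_site_cost.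
  exact: (ergodic_inequality (measurable_translate _) (stationary_integral statP _)
    measurable_site_cost site_cost_ge0).
- apply: le_lt_trans integral_site_cost.
  exact: (ergodic_inequality (measurable_translate _) (stationary_integral statP _)
    measurable_site_cost site_cost_ge0).
Qed.

Local Notation dev g := (deviation g (phase p_ g)).

Lemma site_cost_translate g x : phased p_ g ->
  site_cost (translate (- x) g) = (1 + `|dev g x|) ^+ 2.
Proof.
by move=> pg; rewrite /site_cost (phase_translate _ pg) opprK /deviation -normrN opprB.
Qed.

Let iter_translate u k g : iter k (translate u) g = translate (k%:R * u) g.
Proof.
elim: k => [|k IH]; first by rewrite mul0r translate0.
by rewrite iterS IH translateD -natr1 mulrDl mul1r.
Qed.

Lemma birkhoff_up g n : phased p_ g ->
  birkhoff_sum (translate (- 1)) site_cost n g = \sum_(k < n) (1 + `|dev g k%:R|) ^+ 2.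
Proof.
move=> pg; apply: eq_bigr => k _.
by rewrite iter_translate mulrN1 site_cost_translate.
Qed.

Lemma birkhoff_down g n : phased p_ g ->
  birkhoff_sum (translate 1) site_cost n g = \sum_(k < n) (1 + `|dev g (- k%:R)|) ^+ 2.
Proof.
move=> pg; apply: eq_bigr => k _.
by rewrite iter_translate mulr1 -site_cost_translate// opprK.
Qed.

Let small_of_sum (K : R) (m : nat) (d : R) : 0 <= d ->
  (1 + d) ^+ 2 <= m.+1%:R * K -> 32 * K <= m%:R -> (0 < m)%N -> d <= m%:R / 4.
Proof.
move=> d0 h Km m0; have m1 : (1 : R) <= m%:R by rewrite ler1n.
rewrite leNgt; apply/negP => dm.
have K0 : 0 <= K by move: h; rewrite -natr1; nra.
by move: h; rewrite -natr1; nra.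
Qed.

(** The sites on each side of the origin are Birkhoff sums of [site_cost], whose
    growth is at most linear; this first shows that the deviation is small with
    respect to the position, and then bounds the cost of [match_plan]. *)
Lemma transport_cost_lattice g theta : phased p_ g ->
  (transport_cost 2 g (lattice theta) <= cost_bound g)%E.
Proof.
move=> pg; rewrite /cost_bound.
have := cost_up_ge0 g; case E1 : (cost_up g) => [r1| |] // r10; last first.
  have h := cost_down_ge0 g.
  rewrite [(+oo + cost_down g)%E]addye; last by rewrite gt_eqF// (lt_le_trans _ h).
  by rewrite addye// mulry gtr0_sg ?mul1e ?leey.
have := cost_down_ge0 g; case E2 : (cost_down g) => [r2| |] // r20; last first.
  by rewrite addey// addye// mulry gtr0_sg ?mul1e ?leey.
rewrite -!EFinD -EFinM.
rewrite lee_fin in r10; rewrite lee_fin in r20.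
have [N1 _ h1] : \forall n \near \oo,
    \sum_(k < n) (1 + `|dev g k%:R|) ^+ 2 <= n%:R * (r1 + 1).
  have : (cost_up g < (r1 + 1)%:E)%E by rewrite E1 lte_fin ltrDl.
  move=> /limn_esup_lt; apply: filter_app; exists 1%N => // n /= n0.
  by rewrite lte_fin ltr_pdivrMl ?ltr0n// birkhoff_up// => /ltW.
have [N2 _ h2] : \forall n \near \oo,
    \sum_(k < n) (1 + `|dev g (- k%:R)|) ^+ 2 <= n%:R * (r2 + 1).
  have : (cost_down g < (r2 + 1)%:E)%E by rewrite E2 lte_fin ltrDl.
  move=> /limn_esup_lt; apply: filter_app; exists 1%N => // n /= n0.
  by rewrite lte_fin ltr_pdivrMl ?ltr0n// birkhoff_down// => /ltW.
pose K := r1 + r2 + 1.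
pose M := (N1 + N2 + (Num.truncn (32 * K)).+1)%N.
have MN1 : (N1 <= M)%N by rewrite /M -addnA leq_addr.
have MN2 : (N2 <= M)%N by rewrite /M addnAC leq_addl.
have MK : 32 * K <= M%:R.
  apply: ltW; apply: lt_le_trans (truncnS_gt _) _.
  by rewrite ler_nat /M leq_addl.
have M0 : (0 < M)%N by rewrite /M addnS.
have dev_small m : (M <= m)%N ->
    `|dev g m%:R| <= m%:R / 4 /\ `|dev g (- m%:R)| <= m%:R / 4.
  move=> Mm; have m0 : (0 < m)%N by exact: leq_trans Mm.
  have Km : 32 * K <= m%:R by apply: le_trans MK _; rewrite ler_nat.
  have m1 : (0 : R) <= m.+1%:R by [].
  split; apply: (@small_of_sum K) => //.
  - have := h1 m.+1 (leq_trans MN1 (leqW Mm)); rewrite /= big_ord_recr/= => h.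
    apply: (@le_trans _ _ (m.+1%:R * (r1 + 1))); last by rewrite ler_wpM2l// /K; lra.
    by apply: le_trans h; rewrite lerDr sumr_ge0// => k _; exact: sqr_ge0.
  - have := h2 m.+1 (leq_trans MN2 (leqW Mm)); rewrite /= big_ord_recr/= => h.
    apply: (@le_trans _ _ (m.+1%:R * (r2 + 1))); last by rewrite ler_wpM2l// /K; lra.
    by apply: le_trans h; rewrite lerDr sumr_ge0// => k _; exact: sqr_ge0.
pose q := match_plan (counting_unbounded_above dev_small)
  (counting_unbounded_below dev_small) (phase p_ g) theta.
apply: (@le_trans _ _ (limn_esup (fun n => (n%:R^-1)%:E *
      \int[q]_(z in box n `*` setT) (`|z.1 - z.2| `^ 2)%:E)%E)).
  by apply: ereal_inf_lbound; exists q => //; exact: match_plan_coupling.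
apply: limn_esup_le; exists (2 * M + 4)%N => // n /= Mn.
have n0 : (0 < n)%N by apply: leq_trans Mn; rewrite addnS.
have Mn' : (M <= n)%N.
  by apply: leq_trans Mn; rewrite mul2n -addnn -addnA leq_addr.
have hc := match_plan_cost theta dev_small Mn.
apply: (@le_trans _ _ ((n%:R^-1)%:E * _)%E); first by apply: lee_wpmul2l hc; rewrite lee_fin.
rewrite -EFinM lee_fin ler_pdivrMl ?ltr0n//.
apply: le_trans (@symmetric_sum_le R (fun x => (1 + `|dev g x|) ^+ 2) n (fun x => sqr_ge0 _)) _.
have := h1 n.+1 (leq_trans MN1 (leqW Mn')).
have := h2 n.+1 (leq_trans MN2 (leqW Mn')) => /=.
have n1 : (1 : R) <= n%:R by rewrite ler1n.
by rewrite -natr1; nra.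
Qed.

Let lattice_pair g : config R * config R := (g, lattice (angle p_ g)).

Let measurable_lattice_pair : measurable_fun setT lattice_pair.
Proof.
apply/measurable_fun_pairP; split; first exact: measurable_id.
exact: measurable_lattice_angle.
Qed.

HB.instance Definition _ := isMeasurableFun.Build _ _ _ _ lattice_pair
  measurable_lattice_pair.

Import HBNNSimple.

(** The measurable bound [cost_bound] replaces the transport cost below each
    simple function that enters the definition of its integral. *)
Lemma stationary_wass : (wass 2 P (lattice_law R) < +oo)%E.
Proof.
apply: poweR_lty; apply: (@le_lt_trans _ _ (\int[P]_g cost_bound g)%E);
  last exact: integral_cost_bound.
pose J : probability (config R * config R)%type R := distribution P lattice_pair.
apply: (@le_trans _ _ (\int[J]_z transport_cost 2 z.1 z.2)%E).
  apply: ereal_inf_lbound; exists J => //; split=> [A mA|B mB].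
    rewrite -[LHS]/(P (lattice_pair @^-1` (A `*` setT))); congr (P _).
    by apply/seteqP; split => g //= [].
  rewrite -(lattice_angle_law statP varP minp mB).
  rewrite -[LHS]/(P (lattice_pair @^-1` (setT `*` B))); congr (P _).
  by apply/seteqP; split => g //= [].
rewrite ge0_integralTE; last by move=> z; exact: transport_cost_ge0.
apply: ge_ereal_sup => _ [h /= hle <-].
rewrite -integralT_nnsfun.
have mh : measurable_fun setT (fun z => (h z)%:E) by apply/measurable_EFinP.
rewrite (@ge0_integral_pushforward _ _ _ _ R _ measurable_lattice_pair P setT)//.
rewrite preimage_setT.
apply: ae_ge0_le_integral => //.
- by move=> g _; rewrite lee_fin.
- exact: (measurableT_comp mh measurable_lattice_pair).
- by move=> g _; exact: cost_bound_ge0.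
- exact: measurable_cost_bound.
apply: filterS (ae_phased statP varP minp) => g pg _ /=.
  by apply: le_trans (hle _) _; exact: transport_cost_lattice.
by move=> z _; rewrite lee_fin.
Qed.

End finite_cost.

Theorem theorem2p8 (R : realType) (s beta : R)
    (hs : -2 < s <= -1) (hbeta : 0 < beta)
    (P : probability (config R) R) (hP : is_riesz_gas s beta P) :
  [/\ (wass 2 P (lattice_law R) < +oo)%E,
      hyperuniform_I P,
      number_rigid P &
      has_cyclic_factor P].
Proof.
have [statP [C _ varP]] := riesz_gas_stationary_variance hs hbeta hP.
have [p_ minp] := minimizing_averages statP varP.
split.
- exact: (stationary_wass statP varP minp).
- exact: (stationary_hyperuniform statP varP).
- exact: (stationary_number_rigid statP varP minp).
- exact: (stationary_cyclic_factor statP varP minp).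
Qed.
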